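(* The following are equivalent over $\mathsf{RCA}_0$: 1. $\mathrm{I}\Sigma^0_2$. 2. $\Sigma^0_1\text{-}\mathrm{WKL}(w\text{-}bd)$: for every infinite $\Sigma^0_1$ tree $T\subseteq 2^{<\mathbb{N}}$, if there exists $c\in\mathbb{N}$ such that $|T^{=n}|\le c$ for all $n\in\mathbb{N}$, then $T$ has a path. 3. $\mathrm{KL}(w\text{-}bd)$: for every infinite tree $T\subseteq \mathbb{N}^{<\mathbb{N}}$, if there exists $c\in\mathbb{N}$ such that $|T^{=n}|\le c$ for all $n\in\mathbb{N}$, then $T$ has a path.
   Context: $\mathsf{RCA}_0$ is the usual base system of second-order arithmetic and $\mathrm{I}\Sigma^0_2$ is the $\Sigma^0_2$ induction scheme (with set parameters); the equivalences are provable in $\mathsf{RCA}_0$. A tree is a collection of finite sequences (from $2^{<\mathbb{N}}$ or $\mathbb{N}^{<\mathbb{N}}$) closed under initial segments; $\mathrm{lh}(\sigma)$ is the length of $\sigma$, and $T^{=n}=\{\sigma\in T\mid \mathrm{lh}(\sigma)=n\}$. In item 3, $T$ is a set. A $\Sigma^0_1$ tree $T\subseteq 2^{<\mathbb{N}}$ need not exist as a set: it is given by an enumeration of binary strings $\{\sigma_i\}_{i\in\mathbb{N}}$ such that $T=\{\sigma_i\mid i\in\mathbb{N}\}$ is a tree. A path of $T$ is a function (existing as a second-order object) all of whose finite initial segments are in $T$. For a definable collection $A$, $|A|\le c$ means that every finite set $F\subseteq A$ (coded by a natural number) satisfies $|F|\le c$. *)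

(* Defs.v *)
From Stdlib Require Import List.
Import ListNotations.

(** Two sorts of variables, both as de Bruijn indices with independent
    counters: [all] and [ex] bind number variables, [allS] and [exS] bind set
    variables. The only set terms are variables; as usual in second-order
    arithmetic, [=] is primitive for numbers only. *)

Inductive term : Type :=
  | tvar (i : nat)
  | tzero
  | tone
  | tadd (t u : term)
  | tmul (t u : term).

Inductive form : Type :=
  | bot
  | eqn (t u : term)
  | lt (t u : term)
  | mem (t : term) (X : nat)
  | imp (p q : form)
  | and (p q : form)
  | or (p q : form)
  | all (p : form)
  | ex (p : form)
  | allS (p : form)
  | exS (p : form).

Definition neg (p : form) : form := imp p bot.
Definition iff (p q : form) : form := and (imp p q) (imp q p).

Definition scons {A : Type} (a : A) (f : nat -> A) (i : nat) : A :=
  match i with 0 => a | S j => f j end.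

Fixpoint tsubst (f : nat -> term) (t : term) : term :=
  match t with
  | tvar i => f i
  | tzero => tzero
  | tone => tone
  | tadd t u => tadd (tsubst f t) (tsubst f u)
  | tmul t u => tmul (tsubst f t) (tsubst f u)
  end.

Definition tshift : term -> term := tsubst (fun i => tvar (S i)).

Definition up (f : nat -> term) : nat -> term :=
  scons (tvar 0) (fun i => tshift (f i)).
Definition upS (r : nat -> nat) : nat -> nat :=
  scons 0 (fun i => S (r i)).

Fixpoint subst (f : nat -> term) (r : nat -> nat) (p : form) : form :=
  match p with
  | bot => bot
  | eqn t u => eqn (tsubst f t) (tsubst f u)
  | lt t u => lt (tsubst f t) (tsubst f u)
  | mem t X => mem (tsubst f t) (r X)
  | imp p q => imp (subst f r p) (subst f r q)
  | and p q => and (subst f r p) (subst f r q)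
  | or p q => or (subst f r p) (subst f r q)
  | all p => all (subst (up f) r p)
  | ex p => ex (subst (up f) r p)
  | allS p => allS (subst f (upS r) p)
  | exS p => exS (subst f (upS r) p)
  end.

Definition shift : form -> form := subst (fun i => tvar (S i)) (fun X => X).
Definition shiftS : form -> form := subst tvar S.
Definition inst (t : term) : form -> form :=
  subst (scons t tvar) (fun X => X).
Definition instS (X : nat) : form -> form :=
  subst tvar (scons X (fun Y => Y)).

Inductive prv : list form -> form -> Prop :=
  | Ax G p : In p G -> prv G p
  | ImpI G p q : prv (p :: G) q -> prv G (imp p q)
  | ImpE G p q : prv G (imp p q) -> prv G p -> prv G q
  | Raa G p : prv (neg p :: G) bot -> prv G p
  | AndI G p q : prv G p -> prv G q -> prv G (and p q)
  | AndE1 G p q : prv G (and p q) -> prv G p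
  | AndE2 G p q : prv G (and p q) -> prv G q
  | OrI1 G p q : prv G p -> prv G (or p q)
  | OrI2 G p q : prv G q -> prv G (or p q)
  | OrE G p q r : prv G (or p q) -> prv (p :: G) r -> prv (q :: G) r -> prv G r
  | AllI G p : prv (map shift G) p -> prv G (all p)
  | AllE G p t : prv G (all p) -> prv G (inst t p)
  | ExI G p t : prv G (inst t p) -> prv G (ex p)
  | ExE G p q : prv G (ex p) -> prv (p :: map shift G) (shift q) -> prv G q
  | AllSI G p : prv (map shiftS G) p -> prv G (allS p)
  | AllSE G p X : prv G (allS p) -> prv G (instS X p)
  | ExSI G p X : prv G (instS X p) -> prv G (exS p)
  | ExSE G p q : prv G (exS p) -> prv (p :: map shiftS G) (shiftS q) -> prv G q
  | EqRefl G t : prv G (eqn t t)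
  | EqSubst G p t u : prv G (eqn t u) -> prv G (inst t p) -> prv G (inst u p).

Definition theory : Type := form -> Prop.

Definition proves (T : theory) (p : form) : Prop :=
  exists G : list form, (forall q, In q G -> T q) /\ prv G p.

Definition union (T U : theory) : theory := fun p => T p \/ U p.

(** Principles are taken as theories, because an axiom scheme need not be a
    single sentence. *)
Definition equivalent_over (T A B : theory) : Prop :=
  (forall p, B p -> proves (union T A) p) /\
  (forall p, A p -> proves (union T B) p).

Inductive bounded : form -> Prop :=
  | b_bot : bounded bot
  | b_eqn t u : bounded (eqn t u)
  | b_lt t u : bounded (lt t u)
  | b_mem t X : bounded (mem t X)
  | b_imp p q : bounded p -> bounded q -> bounded (imp p q)
  | b_and p q : bounded p -> bounded q -> bounded (and p q)
  | b_or p q : bounded p -> bounded q -> bounded (or p q)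
  | b_all t p : bounded p -> bounded (all (imp (lt (tvar 0) (tshift t)) p))
  | b_ex t p : bounded p -> bounded (ex (and (lt (tvar 0) (tshift t)) p)).

Definition Sigma1 (p : form) : Prop := exists q, bounded q /\ p = ex q.
Definition Pi1 (p : form) : Prop := exists q, bounded q /\ p = all q.
Definition Sigma2 (p : form) : Prop := exists q, bounded q /\ p = ex (all q).

(** [fvt], [fvn] and [fvs] are strict upper bounds for the indices of the free
    variables (of the indicated sort). *)

Fixpoint fvt (t : term) : nat :=
  match t with
  | tvar i => S i
  | tzero | tone => 0
  | tadd t u | tmul t u => max (fvt t) (fvt u)
  end.

Fixpoint fvn (p : form) : nat :=
  match p with
  | bot => 0
  | eqn t u | lt t u => max (fvt t) (fvt u)
  | mem t _ => fvt t
  | imp p q | and p q | or p q => max (fvn p) (fvn q)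
  | all p | ex p => pred (fvn p)
  | allS p | exS p => fvn p
  end.

Fixpoint fvs (p : form) : nat :=
  match p with
  | bot | eqn _ _ | lt _ _ => 0
  | mem _ X => S X
  | imp p q | and p q | or p q => max (fvs p) (fvs q)
  | all p | ex p => fvs p
  | allS p | exS p => pred (fvs p)
  end.

Definition closure (p : form) : form :=
  Nat.iter (fvs p) allS (Nat.iter (fvn p) all p).

(** The induction variable is number variable [0] of [p]; all other free
    variables, of both sorts, are parameters. *)
Definition induction (p : form) : form :=
  imp (and (inst tzero p)
           (all (imp p (subst (scons (tadd (tvar 0) tone) (fun i => tvar (S i)))
                              (fun X => X) p))))
      (all p).

Definition comprehension (p q : form) : form :=
  imp (all (iff p q))
      (exS (all (iff (mem (tvar 0) 0) (shiftS p)))).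

Definition ISigma1 : theory := fun s =>
  exists p, Sigma1 p /\ s = closure (induction p).

Definition ISigma2 : theory := fun s =>
  exists p, Sigma2 p /\ s = closure (induction p).

Definition Delta1_CA : theory := fun s =>
  exists p q, Sigma1 p /\ Pi1 q /\ s = closure (comprehension p q).

(** An [fm] is a formula as a function of the numbers of number and set binders
    above it; [tm] and [sv] are the corresponding number terms and set
    variables. A binder entered at depth [n] is, seen from depth [m > n], the
    index [m - S n]. Functions [tm -> fm] thus serve as definable classes that
    can be used under further binders. *)

Definition tm : Type := nat -> term.
Definition sv : Type := nat -> nat.
Definition fm : Type := nat -> nat -> form.

Definition qall (F : tm -> fm) : fm :=
  fun n s => all (F (fun m => tvar (m - S n)) (S n) s).
Definition qex (F : tm -> fm) : fm :=
  fun n s => ex (F (fun m => tvar (m - S n)) (S n) s).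
Definition qallS (F : sv -> fm) : fm :=
  fun n s => allS (F (fun m => m - S s) n (S s)).
Definition qexS (F : sv -> fm) : fm :=
  fun n s => exS (F (fun m => m - S s) n (S s)).

Definition sentence (p : fm) : form := p 0 0.

Declare Scope tm_scope.
Delimit Scope tm_scope with tm.
Bind Scope tm_scope with tm.
Declare Scope fm_scope.
Delimit Scope fm_scope with fm.
Bind Scope fm_scope with fm.

Notation "0" := ((fun _ => tzero) : tm) : tm_scope.
Notation "1" := ((fun _ => tone) : tm) : tm_scope.
Notation "t + u" := ((fun n => tadd (t%tm n) (u%tm n)) : tm) : tm_scope.
Notation "t * u" := ((fun n => tmul (t%tm n) (u%tm n)) : tm) : tm_scope.

Notation "t = u" := ((fun n _ => eqn (t%tm n) (u%tm n)) : fm) : fm_scope.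
Notation "t < u" := ((fun n _ => lt (t%tm n) (u%tm n)) : fm) : fm_scope.
Notation "t <= u" := ((fun n _ => or (lt (t%tm n) (u%tm n))
                                     (eqn (t%tm n) (u%tm n))) : fm) : fm_scope.
Notation "t ∈ X" := ((fun n s => mem (t%tm n) (X s)) : fm)
  (at level 70, no associativity) : fm_scope.
Notation "~ p" := ((fun n s => neg (p%fm n s)) : fm) : fm_scope.
Notation "p /\ q" := ((fun n s => and (p%fm n s) (q%fm n s)) : fm) : fm_scope.
Notation "p \/ q" := ((fun n s => or (p%fm n s) (q%fm n s)) : fm) : fm_scope.
Notation "p ⟶ q" := ((fun n s => imp (p%fm n s) (q%fm n s)) : fm)
  (at level 90, right associativity) : fm_scope.
Notation "p ⟷ q" := ((fun n s => iff (p%fm n s) (q%fm n s)) : fm)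
  (at level 95, no associativity) : fm_scope.
Notation "∀ x .. y , p" := (qall (fun x => .. (qall (fun y => p%fm)) ..))
  (at level 200, x binder, y binder, right associativity) : fm_scope.
Notation "∃ x .. y , p" := (qex (fun x => .. (qex (fun y => p%fm)) ..))
  (at level 200, x binder, y binder, right associativity) : fm_scope.
Notation "∀² x .. y , p" := (qallS (fun x => .. (qallS (fun y => p%fm)) ..))
  (at level 200, x binder, y binder, right associativity) : fm_scope.
Notation "∃² x .. y , p" := (qexS (fun x => .. (qexS (fun y => p%fm)) ..))
  (at level 200, x binder, y binder, right associativity) : fm_scope.

Local Open Scope fm_scope.

Definition basic_axioms : list fm :=
  [ ∀ m, ~ (m + 1 = 0);
    ∀ m n, m + 1 = n + 1 ⟶ m = n;
    ∀ m, m + 0 = m;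
    ∀ m n, m + (n + 1) = (m + n) + 1;
    ∀ m, m * 0 = 0;
    ∀ m n, m * (n + 1) = (m * n) + m;
    ∀ m, ~ (m < 0);
    ∀ m n, m < n + 1 ⟷ (m < n \/ m = n) ].

Definition RCA0 : theory := fun s =>
  (In s (map sentence basic_axioms) \/ ISigma1 s \/ Delta1_CA s)%type.

(** The coding of finite sets is the one of Simpson, _Subsystems of Second Order Arithmetic_,
    II.2. A number of the form (k,(m,n)) represents the set of the [i < k] such
    that [m(i+1)+1] divides [n]; every finite set is represented, and its code
    is the least number that represents it, so that codes are unique. A finite
    sequence is a finite set of pairs that is the graph of a function with
    domain an initial segment of the numbers. *)

Definition pair (i j : tm) : tm := ((i + j) * (i + j) + i)%tm.

Definition is_triple (c : tm) : fm := ∃ k m n, c = pair k (pair m n).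

Definition fin_mem (i c : tm) : fm :=
  ∃ k m n, c = pair k (pair m n) /\ i < k /\ ∃ q, n = q * (m * (i + 1) + 1).

Definition fin_set (c : tm) : fm :=
  is_triple c /\
  ∀ d, d < c ⟶ is_triple d ⟶ ~ (∀ i, fin_mem i d ⟷ fin_mem i c).

Definition has_length (s l : tm) : fm :=
  ∀ i, i < l ⟷ (∃ j, fin_mem (pair i j) s).

Definition fin_seq (s : tm) : fm :=
  fin_set s /\
  (∀ x, fin_mem x s ⟶ ∃ i j, x = pair i j) /\
  (∀ i j k, fin_mem (pair i j) s ⟶ fin_mem (pair i k) s ⟶ j = k) /\
  (∃ l, has_length s l).

(** For finite sequences, [s] is an initial segment of [t] exactly when the
    graph of [s] is contained in that of [t]. *)
Definition initial_segment (s t : tm) : fm :=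
  ∀ i j, fin_mem (pair i j) s ⟶ fin_mem (pair i j) t.

Definition binary (s : tm) : fm :=
  ∀ i j, fin_mem (pair i j) s ⟶ (j = 0 \/ j = 1).

Definition card (F l : tm) : fm :=
  ∃ s, fin_seq s /\ has_length s l /\
    (∀ i j x, fin_mem (pair i x) s ⟶ fin_mem (pair j x) s ⟶ i = j) /\
    (∀ x, fin_mem x F ⟷ (∃ i, fin_mem (pair i x) s)).

Definition card_le (F c : tm) : fm := ∃ l, l <= c /\ card F l.

Definition function (f : sv) : fm :=
  (∀ x, x ∈ f ⟶ ∃ i j, x = pair i j) /\
  (∀ i, ∃ j, pair i j ∈ f /\ ∀ k, pair i k ∈ f ⟶ k = j).

Definition is_tree (T : tm -> fm) : fm :=
  (∀ s, T s ⟶ fin_seq s) /\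
  (∀ s t, T t ⟶ fin_seq s ⟶ initial_segment s t ⟶ T s).

(** Unboundedness of the codes, for sets and for classes alike. *)
Definition infinite (A : tm -> fm) : fm := ∀ m, ∃ x, m < x /\ A x.

Definition class_card_le (A : tm -> fm) (c : tm) : fm :=
  ∀ F, fin_set F ⟶ (∀ x, fin_mem x F ⟶ A x) ⟶ card_le F c.

Definition level (T : tm -> fm) (n : tm) : tm -> fm :=
  fun s => T s /\ has_length s n.

Definition weakly_bounded (T : tm -> fm) : fm :=
  ∃ c, ∀ n, class_card_le (level T n) c.

Definition has_path (T : tm -> fm) : fm :=
  ∃² g, function g /\
    ∀ n, ∃ s, fin_seq s /\ has_length s n /\
      (∀ i j, fin_mem (pair i j) s ⟶ pair i j ∈ g) /\ T s.

Definition range (f : sv) : tm -> fm := fun s => ∃ i, pair i s ∈ f.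

Definition Sigma1_WKL_wbd_sentence : form := sentence (
  ∀² f, function f ⟶ is_tree (range f) ⟶ (∀ s, range f s ⟶ binary s) ⟶
    infinite (range f) ⟶ weakly_bounded (range f) ⟶ has_path (range f)).

Definition KL_wbd_sentence : form := sentence (
  ∀² X, is_tree (fun s => s ∈ X) ⟶ infinite (fun s => s ∈ X) ⟶
    weakly_bounded (fun s => s ∈ X) ⟶ has_path (fun s => s ∈ X)).

Local Close Scope fm_scope.

Definition Sigma1_WKL_wbd : theory := fun s => s = Sigma1_WKL_wbd_sentence.
Definition KL_wbd : theory := fun s => s = KL_wbd_sentence.

(* Main.v *)
From Stdlib Require Import List Lia Arith Cantor QArith Lqa Ring.
From Stdlib Require Import Classical ClassicalEpsilon FunctionalExtensionality PropExtensionality ProofIrrelevance.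
From Stdlib Require Import RingMicromega EnvRing.
From Stdlib.micromega Require Tauto.
Import ListNotations.
Require Import Defs.
Local Close Scope Q_scope.
Local Open Scope nat_scope.

(** By completeness, it is enough to show that the three principles hold in
    the same models of RCA0. A model need not be standard, so induction and
    comprehension are available only for the predicates that are definable in
    the relevant class, and sequences are the numbers that code them.

    ISigma2 -> KL: let K be the limit superior of the widths of the levels, a
    number by Sigma_2 induction. Past some level, an enumeration of K nodes of
    a level is an enumeration of all of them, so "extendible" becomes a Pi_1
    notion. In an antichain of extendible nodes of the largest size, no node
    [t0] has two incomparable extendible extensions; hence a node is on the path
    above [t0] as soon as all nodes above [t0] of some later full level extend
    it, and the path is Delta_1.

    KL -> Sigma_1-WKL: replace a string by the sequence of the first indices, in
    the given enumeration, of its nonempty initial segments.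

    Sigma_1-WKL -> ISigma2: let [phi] be Sigma_2, true at 0, inductive and false at
    [a]. The least [k <= a] that seems to refute [phi] at stage [s] is a computable
    [J s <= a], and its limit inferior would be the least counterexample to [phi].
    It exists if the set of the [m] with [J m <= J t] for all [t > m] does. This set is
    the path of the Sigma_1 tree of its approximations at stages [s], restricted
    to [n <= s]; the approximation depends only on the minimum of [J] on [[n, s]], so
    that the tree has width at most [a + 1]. *)

(** * Substitution and derivations *)

(** Classes of formulas are treated as classes of predicates on environments, so that definability
    is settled by closure lemmas; syntax returns only where an axiom scheme is instantiated. Maxima
    and collection are proved once for an abstract class and used for Sigma_1 and Sigma_2.

    In KL the levels come without a bounding function: even nodes of every length need Sigma_2
    induction, and having extensions of every length is a Pi_2 property. Levels of eventually
    maximal width can be recognised as completely listed, which removes the inner existential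
    quantifier. The size of an antichain of extendible nodes can then be maximised by Sigma_2
    induction.

    A Sigma_1 tree need not be a set. A sequence of indices carries the evidence for its own
    membership, so the sequences do form a set.

    In the reversal, the set to be found consists of the true stages of [J], as known from
    enumerations of c.e. sets: those after which no smaller value appears. Cutting the strings at
    [n <= s] has the effect that every bit of a path is confirmed by approximations at arbitrarily
    late stages. *)

Lemma tsubst_comp f g t :
  tsubst f (tsubst g t) = tsubst (fun i => tsubst f (g i)) t.
Proof. induction t; simpl; congruence. Qed.

Lemma tsubst_id t : tsubst tvar t = t.
Proof. induction t; simpl; congruence. Qed.

Lemma up_comp f g : (fun i => tsubst (up f) (up g i)) = up (fun i => tsubst f (g i)).
Proof.
  extensionality i; destruct i as [|i]; simpl; [reflexivity|].
  unfold tshift; rewrite !tsubst_comp; reflexivity.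
Qed.

Lemma upS_comp r s : (fun i => upS r (upS s i)) = upS (fun i => r (s i)).
Proof. extensionality i; destruct i; reflexivity. Qed.

Lemma up_id : up tvar = tvar.
Proof. extensionality i; destruct i; reflexivity. Qed.

Lemma upS_id : upS (fun X => X) = (fun X => X).
Proof. extensionality i; destruct i; reflexivity. Qed.

Lemma subst_comp p : forall f r g s,
  subst f r (subst g s p) = subst (fun i => tsubst f (g i)) (fun X => r (s X)) p.
Proof.
  induction p; intros f r g s; simpl; 
    rewrite ?tsubst_comp, ?IHp1, ?IHp2; try reflexivity.
  - now rewrite IHp, up_comp.
  - now rewrite IHp, up_comp.
  - now rewrite IHp, upS_comp.
  - now rewrite IHp, upS_comp.
Qed.

Lemma subst_id p : subst tvar (fun X => X) p = p.
Proof.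
  induction p; simpl; rewrite ?tsubst_id, ?up_id, ?upS_id; congruence.
Qed.

Lemma tsubst_agree f g t : (forall i, i < fvt t -> f i = g i) -> tsubst f t = tsubst g t.
Proof.
  induction t; simpl; intros H; auto.
  - rewrite IHt1, IHt2; auto; intros; apply H; lia.
  - rewrite IHt1, IHt2; auto; intros; apply H; lia.
Qed.

Lemma subst_agree p : forall f g r s,
  (forall i, i < fvn p -> f i = g i) -> (forall X, X < fvs p -> r X = s X) ->
  subst f r p = subst g s p.
Proof.
  assert (Hup : forall n f g, (forall i, i < pred n -> f i = g i) ->
            forall i, i < n -> up f i = up g i).
  { intros n f g H [|i] Hi; simpl; [reflexivity|]. rewrite H; [reflexivity|lia]. }
  assert (HupS : forall n r s, (forall i, i < pred n -> r i = s i) ->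
            forall i, i < n -> upS r i = upS s i).
  { intros n f g H [|i] Hi; simpl; [reflexivity|]. rewrite H; [reflexivity|lia]. }
  induction p; intros f g r s Hf Hr; simpl in *;
    try (rewrite (tsubst_agree f g t) by (intros; apply Hf; lia));
    try (rewrite (tsubst_agree f g u) by (intros; apply Hf; lia));
    try (f_equal; eauto; fail).
  - rewrite (IHp1 f g r s), (IHp2 f g r s); auto; intros; (apply Hf || apply Hr); lia.
  - rewrite (IHp1 f g r s), (IHp2 f g r s); auto; intros; (apply Hf || apply Hr); lia.
  - rewrite (IHp1 f g r s), (IHp2 f g r s); auto; intros; (apply Hf || apply Hr); lia.
Qed.

Lemma subst_shift f r p : subst (up f) r (shift p) = shift (subst f r p).
Proof. unfold shift; rewrite !subst_comp; reflexivity. Qed.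

Lemma subst_shiftS f r p : subst f (upS r) (shiftS p) = shiftS (subst f r p).
Proof.
  unfold shiftS; rewrite !subst_comp; f_equal.
  extensionality i; simpl; rewrite tsubst_id; reflexivity.
Qed.

Lemma subst_inst f r t p : subst f r (inst t p) = inst (tsubst f t) (subst (up f) r p).
Proof.
  unfold inst; rewrite !subst_comp; f_equal.
  extensionality i; destruct i; simpl; [reflexivity|].
  unfold tshift; rewrite tsubst_comp; symmetry; apply tsubst_id.
Qed.

Lemma subst_instS f r X p : subst f r (instS X p) = instS (r X) (subst f (upS r) p).
Proof.
  unfold instS; rewrite !subst_comp; f_equal.
  - extensionality i; simpl; rewrite tsubst_id; reflexivity.
  - extensionality i; destruct i; reflexivity.
Qed.

Lemma inst_up f r t p : inst t (subst (up f) r p) = subst (scons t f) r p.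
Proof.
  unfold inst; rewrite subst_comp; f_equal.
  extensionality i; destruct i; simpl; [reflexivity|].
  unfold tshift; rewrite tsubst_comp; apply tsubst_id.
Qed.

Lemma instS_upS f r X p : instS X (subst f (upS r) p) = subst f (scons X r) p.
Proof.
  unfold instS; rewrite subst_comp; f_equal.
  - extensionality i; apply tsubst_id.
  - extensionality i; destruct i; reflexivity.
Qed.

Lemma prv_weak G p : prv G p -> forall G', incl G G' -> prv G' p.
Proof.
  induction 1; intros G' HG.
  - apply Ax; auto.
  - apply ImpI, IHprv, incl_cons; [now left|]. now apply incl_tl.
  - eapply ImpE; eauto.
  - apply Raa, IHprv, incl_cons; [now left|]. now apply incl_tl.
  - apply AndI; auto.
  - eapply AndE1; eauto.
  - eapply AndE2; eauto.
  - apply OrI1; auto.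
  - apply OrI2; auto.
  - eapply OrE; [eauto| |].
    + apply IHprv2, incl_cons; [now left|]. now apply incl_tl.
    + apply IHprv3, incl_cons; [now left|]. now apply incl_tl.
  - apply AllI, IHprv, incl_map, HG.
  - apply AllE; auto.
  - eapply ExI; eauto.
  - eapply ExE; [eauto|].
    apply IHprv2, incl_cons; [now left|]. apply incl_tl, incl_map, HG.
  - apply AllSI, IHprv, incl_map, HG.
  - apply AllSE; auto.
  - eapply ExSI; eauto.
  - eapply ExSE; [eauto|].
    apply IHprv2, incl_cons; [now left|]. apply incl_tl, incl_map, HG.
  - apply EqRefl.
  - eapply EqSubst; eauto.
Qed.

Lemma prv_subst G p : prv G p -> forall f r, prv (map (subst f r) G) (subst f r p).
Proof.
  assert (Hsh : forall f r G, map (subst (up f) r) (map shift G) = map shift (map (subst f r) G)).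
  { intros f r L; rewrite !map_map; apply map_ext; intros q; apply subst_shift. }
  assert (HshS : forall f r G, map (subst f (upS r)) (map shiftS G) = map shiftS (map (subst f r) G)).
  { intros f r L; rewrite !map_map; apply map_ext; intros q; apply subst_shiftS. }
  induction 1; intros f g; simpl in *.
  - apply Ax, in_map, H.
  - apply ImpI, IHprv.
  - eapply ImpE; eauto.
  - apply Raa, IHprv.
  - apply AndI; auto.
  - eapply AndE1; eauto.
  - eapply AndE2; eauto.
  - apply OrI1; auto.
  - apply OrI2; auto.
  - eapply OrE; eauto.
  - apply AllI. rewrite <- Hsh. apply IHprv.
  - rewrite subst_inst. apply AllE, IHprv.
  - apply ExI with (tsubst f t). rewrite <- subst_inst. apply IHprv.
  - eapply ExE; [apply IHprv1|]. rewrite <- Hsh, <- subst_shift. apply IHprv2.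
  - apply AllSI. rewrite <- HshS. apply IHprv.
  - rewrite subst_instS. apply AllSE, IHprv.
  - apply ExSI with (g X). rewrite <- subst_instS. apply IHprv.
  - eapply ExSE; [apply IHprv1|]. rewrite <- HshS, <- subst_shiftS. apply IHprv2.
  - apply EqRefl.
  - rewrite subst_inst. eapply EqSubst; [apply IHprv1|]. rewrite <- subst_inst. apply IHprv2.
Qed.

Lemma prv_cut G p q : prv G p -> prv (p :: G) q -> prv G q.
Proof. intros H1 H2; eapply ImpE; [apply ImpI, H2|apply H1]. Qed.

Lemma prv_exfalso G p : prv G bot -> prv G p.
Proof.
  intros H; apply Raa; eapply prv_weak; [apply H|]. apply incl_tl, incl_refl.
Qed.

Lemma prv_fresh_ex G q k :
  (forall p, In p G -> fvn p <= k) -> fvn (ex q) <= k ->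
  prv (inst (tvar k) q :: G) bot -> prv (ex q :: G) bot.
Proof.
  intros HG Hq H.
  eapply ExE; [apply Ax; now left|].
  pose (f i := if Nat.eqb i k then tvar 0 else tvar (S i)).
  apply prv_subst with (f := f) (r := fun X => X) in H; simpl in H.
  assert (E1 : subst f (fun X => X) (inst (tvar k) q) = q).
  { unfold inst; rewrite subst_comp; rewrite <- (subst_id q) at 2.
    apply subst_agree; [|reflexivity].
    intros [|i] Hi; simpl; unfold f.
    - now rewrite Nat.eqb_refl.
    - simpl in Hq. destruct (Nat.eqb_spec i k); [lia|reflexivity]. }
  assert (E2 : map (subst f (fun X => X)) G = map shift G).
  { apply map_ext_in; intros p Hp; apply subst_agree; [|reflexivity].
    intros i Hi; unfold f. specialize (HG p Hp).
    destruct (Nat.eqb_spec i k); [lia|reflexivity]. }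
  rewrite E1, E2 in H. eapply prv_weak; [apply H|].
  apply incl_cons; [now left|]. do 2 apply incl_tl. apply incl_refl.
Qed.

Lemma prv_fresh_exS G q k :
  (forall p, In p G -> fvs p <= k) -> fvs (exS q) <= k ->
  prv (instS k q :: G) bot -> prv (exS q :: G) bot.
Proof.
  intros HG Hq H.
  eapply ExSE; [apply Ax; now left|].
  pose (f i := if Nat.eqb i k then 0 else S i).
  apply prv_subst with (f := tvar) (r := f) in H; simpl in H.
  assert (E1 : subst tvar f (instS k q) = q).
  { unfold instS; rewrite subst_comp; rewrite <- (subst_id q) at 2.
    apply subst_agree; [reflexivity|].
    intros [|i] Hi; simpl; unfold f.
    - now rewrite Nat.eqb_refl.
    - simpl in Hq. destruct (Nat.eqb_spec i k); [lia|reflexivity]. }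
  assert (E2 : map (subst tvar f) G = map shiftS G).
  { apply map_ext_in; intros p Hp; apply subst_agree; [reflexivity|].
    intros i Hi; unfold f. specialize (HG p Hp).
    destruct (Nat.eqb_spec i k); [lia|reflexivity]. }
  rewrite E1, E2 in H. eapply prv_weak; [apply H|].
  apply incl_cons; [now left|]. do 2 apply incl_tl. apply incl_refl.
Qed.

(** * An enumeration of all formulas *)

Fixpoint tcode (t : term) : nat :=
  match t with
  | tvar i => to_nat (0, i)
  | tzero => to_nat (1, 0)
  | tone => to_nat (2, 0)
  | tadd t u => to_nat (3, to_nat (tcode t, tcode u))
  | tmul t u => to_nat (4, to_nat (tcode t, tcode u))
  end.

Fixpoint fcode (p : form) : nat :=
  match p with
  | bot => to_nat (0, 0)
  | eqn t u => to_nat (1, to_nat (tcode t, tcode u))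
  | lt t u => to_nat (2, to_nat (tcode t, tcode u))
  | mem t X => to_nat (3, to_nat (tcode t, X))
  | imp p q => to_nat (4, to_nat (fcode p, fcode q))
  | and p q => to_nat (5, to_nat (fcode p, fcode q))
  | or p q => to_nat (6, to_nat (fcode p, fcode q))
  | all p => to_nat (7, fcode p)
  | ex p => to_nat (8, fcode p)
  | allS p => to_nat (9, fcode p)
  | exS p => to_nat (10, fcode p)
  end.

Lemma to_nat_inj' x y x' y' : to_nat (x, y) = to_nat (x', y') -> x = x' /\ y = y'.
Proof. intros H; apply to_nat_inj in H; now inversion H. Qed.

Ltac code_inj :=
  repeat match goal with
  | H : to_nat (_, _) = to_nat (_, _) |- _ => apply to_nat_inj' in H; destruct H
  end; try discriminate.

Lemma tcode_inj t : forall u, tcode t = tcode u -> t = u.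
Proof.
  induction t; intros [] H; cbn [tcode] in H; code_inj; f_equal; auto.
Qed.

Lemma fcode_inj p : forall q, fcode p = fcode q -> p = q.
Proof.
  induction p; intros [] H; cbn [fcode] in H; code_inj; f_equal; auto using tcode_inj.
Qed.

(** Inverting an injective code by choice suffices: the Henkin construction asks only that every
    formula be met. *)
Definition fenum (n : nat) : form :=
  epsilon (inhabits bot) (fun p => fcode p = n).

Lemma fenum_fcode p : fenum (fcode p) = p.
Proof. apply fcode_inj, (epsilon_spec (inhabits bot) (fun q => fcode q = fcode p)). now exists p. Qed.

(** * Structures and satisfaction *)

Record structure : Type := {
  dom : Type;
  sets : Type;
  izero : dom;
  ione : dom;
  iadd : dom -> dom -> dom;
  imul : dom -> dom -> dom;
  ilt : dom -> dom -> Prop;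
  imem : dom -> sets -> Prop }.

Fixpoint teval (A : structure) (e : nat -> dom A) (t : term) : dom A :=
  match t with
  | tvar i => e i
  | tzero => izero A
  | tone => ione A
  | tadd t u => iadd A (teval A e t) (teval A e u)
  | tmul t u => imul A (teval A e t) (teval A e u)
  end.

Fixpoint sat (A : structure) (e : nat -> dom A) (E : nat -> sets A) (p : form) : Prop :=
  match p with
  | bot => False
  | eqn t u => teval A e t = teval A e u
  | lt t u => ilt A (teval A e t) (teval A e u)
  | mem t X => imem A (teval A e t) (E X)
  | imp p q => sat A e E p -> sat A e E q
  | and p q => sat A e E p /\ sat A e E q
  | or p q => sat A e E p \/ sat A e E q
  | all p => forall x, sat A (scons x e) E p
  | ex p => exists x, sat A (scons x e) E p
  | allS p => forall X, sat A e (scons X E) p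
  | exS p => exists X, sat A e (scons X E) p
  end.

Lemma teval_subst A e f t : teval A e (tsubst f t) = teval A (fun i => teval A e (f i)) t.
Proof. induction t; simpl; congruence. Qed.

Lemma sat_subst A p : forall e E f r,
  sat A e E (subst f r p) <-> sat A (fun i => teval A e (f i)) (fun X => E (r X)) p.
Proof.
  assert (Hup : forall (x : dom A) e f,
    (fun i => teval A (scons x e) (up f i)) = scons x (fun i => teval A e (f i))).
  { intros x e f; extensionality i; destruct i as [|i]; simpl; [reflexivity|].
    unfold tshift; rewrite teval_subst; reflexivity. }
  assert (HupS : forall (x : sets A) E r,
    (fun i => scons x E (upS r i)) = scons x (fun i => E (r i))).
  { intros x E r; extensionality i; destruct i as [|i]; reflexivity. }
  induction p; intros e E f r; simpl; rewrite ?teval_subst; try tauto.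
  - now rewrite IHp1, IHp2.
  - now rewrite IHp1, IHp2.
  - now rewrite IHp1, IHp2.
  - split; intros H x; specialize (H x); rewrite IHp, Hup in *; exact H.
  - split; intros [x H]; exists x; rewrite IHp, Hup in *; exact H.
  - split; intros H x; specialize (H x); rewrite IHp, HupS in *; exact H.
  - split; intros [x H]; exists x; rewrite IHp, HupS in *; exact H.
Qed.

Lemma teval_agree A e e' t : (forall i, i < fvt t -> e i = e' i) -> teval A e t = teval A e' t.
Proof.
  induction t; simpl; intros H; auto; rewrite IHt1, IHt2; auto; intros; apply H; lia.
Qed.

Lemma sat_agree A p : forall e e' E E',
  (forall i, i < fvn p -> e i = e' i) -> (forall X, X < fvs p -> E X = E' X) ->
  sat A e E p <-> sat A e' E' p.
Proof.
  assert (Hs : forall T n (e e' : nat -> T) x, (forall i, i < pred n -> e i = e' i) ->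
            forall i, i < n -> scons x e i = scons x e' i).
  { intros T n e e' x H [|i] Hi; simpl; [reflexivity|]. apply H; lia. }
  induction p; intros e e' E E' He HE; simpl in *;
    try (rewrite (teval_agree A e e' t) by (intros; apply He; lia));
    try (rewrite (teval_agree A e e' u) by (intros; apply He; lia));
    try tauto.
  - rewrite HE by lia; tauto.
  - rewrite (IHp1 e e' E E'), (IHp2 e e' E E');
      solve [tauto | intros; apply He; lia | intros; apply HE; lia].
  - rewrite (IHp1 e e' E E'), (IHp2 e e' E E');
      solve [tauto | intros; apply He; lia | intros; apply HE; lia].
  - rewrite (IHp1 e e' E E'), (IHp2 e e' E E');
      solve [tauto | intros; apply He; lia | intros; apply HE; lia].
  - split; intros H x; specialize (H x); revert H; apply IHp;
      solve [eauto | intros; symmetry; eauto].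
  - split; intros [x H]; exists x; revert H; apply IHp;
      solve [eauto | intros; symmetry; eauto].
  - split; intros H x; specialize (H x); revert H; apply IHp;
      solve [eauto | intros; symmetry; eauto].
  - split; intros [x H]; exists x; revert H; apply IHp;
      solve [eauto | intros; symmetry; eauto].
Qed.

(** * Completeness *)

Definition closed (p : form) : Prop := fvn p = 0 /\ fvs p = 0.

Section Henkin.
Context (T : theory) (HT : forall q, T q -> closed q) (p0 : form) (Hp0 : ~ proves T p0).

Definition tprv (G : list form) (p : form) : Prop :=
  exists L, (forall q, In q L -> T q) /\ prv (L ++ G) p.

Lemma tprv_weak G G' p : tprv G p -> incl G G' -> tprv G' p.
Proof.
  intros [L [HL H]] HG; exists L; split; [exact HL|].
  eapply prv_weak; [apply H|]. apply incl_app; [apply incl_appl, incl_refl|apply incl_appr, HG].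
Qed.

Lemma tprv_prv G p : prv G p -> tprv G p.
Proof. exists nil; split; [intros _ []|assumption]. Qed.

Lemma tprv_cut G p q : tprv G p -> tprv (p :: G) q -> tprv G q.
Proof.
  intros [L [HL H]] [L' [HL' H']]; exists (L ++ L'); split.
  { intros r Hr; apply in_app_or in Hr; destruct Hr; auto. }
  apply prv_cut with p.
  - eapply prv_weak; [apply H|]. intros r Hr.
    rewrite !in_app_iff in *; tauto.
  - eapply prv_weak; [apply H'|]. intros r Hr; simpl in *.
    rewrite !in_app_iff in *; simpl in *; rewrite ?in_app_iff; tauto.
Qed.

Lemma tprv_raa G p : tprv (neg p :: G) bot -> tprv G p.
Proof.
  intros [L [HL H]]; exists L; split; [exact HL|]. apply Raa.
  eapply prv_weak; [apply H|]. intros r Hr; simpl; rewrite in_app_iff in *; simpl in *; tauto.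
Qed.

Lemma tprv_impI G p q : tprv (p :: G) q -> tprv G (imp p q).
Proof.
  intros [L [HL H]]; exists L; split; [exact HL|]. apply ImpI.
  eapply prv_weak; [apply H|]. intros r Hr; simpl; rewrite in_app_iff in *; simpl in *; tauto.
Qed.

Definition fresh (G : list form) : nat := list_max (map fvn G ++ map fvs G).

Lemma fresh_fvn G p : In p G -> fvn p <= fresh G.
Proof.
  intros H. unfold fresh.
  pose proof (proj1 (list_max_le (map fvn G ++ map fvs G) _) (le_n _)) as HF.
  rewrite Forall_forall in HF. apply HF, in_or_app; left; now apply in_map.
Qed.

Lemma fresh_fvs G p : In p G -> fvs p <= fresh G.
Proof.
  intros H. unfold fresh.
  pose proof (proj1 (list_max_le (map fvn G ++ map fvs G) _) (le_n _)) as HF.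
  rewrite Forall_forall in HF. apply HF, in_or_app; right; now apply in_map.
Qed.

(** A formula that is not existential is its own witness, so that the construction needs no case
    distinction. *)
Definition witness (p : form) (k : nat) : form :=
  match p with ex q => inst (tvar k) q | exS q => instS k q | _ => p end.

Lemma tprv_witness G p :
  tprv (witness p (fresh (p :: G)) :: p :: G) bot -> tprv (p :: G) bot.
Proof.
  intros [L [HL H]]. set (k := fresh (p :: G)) in *.
  assert (H' : prv (witness p k :: p :: L ++ G) bot).
  { eapply prv_weak; [apply H|]. intros r Hr; simpl; rewrite in_app_iff in *; simpl in *; tauto. }
  assert (Hn : forall r, In r (p :: L ++ G) -> fvn r <= k).
  { intros r [<-|Hr]; [apply fresh_fvn; now left|].
    apply in_app_or in Hr; destruct Hr as [Hr|Hr].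
    - destruct (HT r (HL r Hr)) as [-> _]; lia.
    - apply fresh_fvn; now right. }
  assert (Hs : forall r, In r (p :: L ++ G) -> fvs r <= k).
  { intros r [<-|Hr]; [apply fresh_fvs; now left|].
    apply in_app_or in Hr; destruct Hr as [Hr|Hr].
    - destruct (HT r (HL r Hr)) as [_ ->]; lia.
    - apply fresh_fvs; now right. }
  exists L; split; [exact HL|].
  apply prv_weak with (p :: p :: L ++ G).
  2:{ intros r Hr; simpl in *; rewrite in_app_iff in *; simpl in *; tauto. }
  destruct p; try exact H'.
  - apply prv_fresh_ex with k; auto. apply Hn; now left.
  - apply prv_fresh_exS with k; auto. apply Hs; now left.
Qed.

(** Lindenbaum's completion and Henkin's witnesses are combined in one step, since existential
    formulas of both sorts occur in the same enumeration. *)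
Fixpoint stage (n : nat) : list form :=
  match n with
  | 0 => [neg p0]
  | S n =>
    let p := fenum n in
    if excluded_middle_informative (tprv (p :: stage n) bot) then stage n
    else witness p (fresh (p :: stage n)) :: p :: stage n
  end.

Lemma stage_consistent n : ~ tprv (stage n) bot.
Proof.
  induction n as [|n IH]; simpl.
  - intros H; apply Hp0. apply tprv_raa in H. destruct H as [L [HL H]].
    exists L; rewrite app_nil_r in H; auto.
  - destruct excluded_middle_informative as [H|H]; [exact IH|].
    intros H'; apply H, tprv_witness, H'.
Qed.

Lemma stage_mono n m : n <= m -> incl (stage n) (stage m).
Proof.
  induction 1 as [|m _ IH]; [apply incl_refl|]. simpl.
  destruct excluded_middle_informative; [exact IH|]. now do 2 apply incl_tl.
Qed.

Definition Th (p : form) : Prop := exists n, tprv (stage n) p.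

Lemma Th_list G : (forall p, In p G -> Th p) ->
  exists n, forall p, In p G -> tprv (stage n) p.
Proof.
  induction G as [|p G IH]; intros H; [exists 0; intros _ []|].
  destruct IH as [n Hn]; [intros; apply H; now right|].
  destruct (H p) as [m Hm]; [now left|].
  exists (n + m); intros q [<-|Hq].
  - eapply tprv_weak; [apply Hm|]. apply stage_mono; lia.
  - eapply tprv_weak; [apply Hn, Hq|]. apply stage_mono; lia.
Qed.

Lemma tprv_cut_list G G' q :
  (forall p, In p G' -> tprv G p) -> tprv (G' ++ G) q -> tprv G q.
Proof.
  revert q; induction G' as [|p G' IH]; intros q H H'; [exact H'|].
  apply tprv_cut with p; [apply H; now left|].
  assert (Hi : tprv G (imp p q)).
  { apply IH; [intros; apply H; now right|]. apply tprv_impI, H'. }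
  destruct Hi as [L [HL Hi]]; exists L; split; [exact HL|].
  eapply ImpE; [eapply prv_weak; [apply Hi|]|].
  - apply incl_app; [apply incl_appl, incl_refl|]. apply incl_appr, incl_tl, incl_refl.
  - apply Ax, in_or_app; right; now left.
Qed.

Lemma Th_prv G q : (forall p, In p G -> Th p) -> prv G q -> Th q.
Proof.
  intros H Hq. destruct (Th_list G H) as [n Hn]. exists n.
  apply tprv_cut_list with G; [exact Hn|].
  apply tprv_prv. eapply prv_weak; [apply Hq|]. apply incl_appl, incl_refl.
Qed.

Lemma Th_decide p : Th p \/ Th (neg p).
Proof.
  destruct (excluded_middle_informative (tprv (p :: stage (fcode p)) bot)) as [H|H] eqn:E.
  - right; exists (fcode p); apply tprv_impI, H.
  - left; exists (S (fcode p)); apply tprv_prv, Ax; simpl; rewrite fenum_fcode, E.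
    right; now left.
Qed.

Lemma Th_bot : ~ Th bot.
Proof. intros [n H]; exact (stage_consistent n H). Qed.

Lemma Th_witness p : Th p -> exists k, Th (witness p k).
Proof.
  intros Hp. exists (fresh (p :: stage (fcode p))). exists (S (fcode p)).
  apply tprv_prv, Ax; simpl; rewrite fenum_fcode.
  destruct excluded_middle_informative as [H|H]; [|now left].
  exfalso; apply Th_bot.
  assert (Hn : Th (neg p)) by (exists (fcode p); apply tprv_impI, H).
  apply (Th_prv [p; neg p]).
  - intros q [<-|[<-|[]]]; assumption.
  - apply ImpE with p; apply Ax; simpl; auto.
Qed.

Lemma Th_imp p q : Th (imp p q) <-> (Th p -> Th q).
Proof.
  split.
  - intros H Hp. apply (Th_prv [imp p q; p]).
    + intros r [<-|[<-|[]]]; assumption.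
    + apply ImpE with p; apply Ax; simpl; auto.
  - intros H. destruct (Th_decide p) as [Hp|Hp].
    + apply (Th_prv [q]); [intros r [<-|[]]; auto|]. apply ImpI, Ax; simpl; auto.
    + apply (Th_prv [neg p]); [intros r [<-|[]]; auto|].
      apply ImpI, prv_exfalso. apply ImpE with p; apply Ax; simpl; auto.
Qed.

Lemma Th_and p q : Th (and p q) <-> Th p /\ Th q.
Proof.
  split.
  - intros H; split; apply (Th_prv [and p q]); try (intros r [<-|[]]; assumption).
    + eapply AndE1, Ax; now left.
    + eapply AndE2, Ax; now left.
  - intros [H1 H2]; apply (Th_prv [p; q]).
    + intros r [<-|[<-|[]]]; assumption.
    + apply AndI; apply Ax; simpl; auto.
Qed.

Lemma Th_or p q : Th (or p q) <-> Th p \/ Th q.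
Proof.
  split.
  - intros H. destruct (Th_decide p) as [Hp|Hp]; [now left|].
    destruct (Th_decide q) as [Hq|Hq]; [now right|].
    exfalso; apply Th_bot, (Th_prv [or p q; neg p; neg q]).
    + intros r [<-|[<-|[<-|[]]]]; assumption.
    + eapply OrE; [apply Ax; now left| |]; (eapply ImpE; [|apply Ax; now left]);
        apply Ax; simpl; auto.
  - intros [H|H]; [apply (Th_prv [p])|apply (Th_prv [q])];
      try (intros r [<-|[]]; assumption).
    + apply OrI1, Ax; now left.
    + apply OrI2, Ax; now left.
Qed.

Lemma Th_ex p : Th (ex p) <-> exists t, Th (inst t p).
Proof.
  split.
  - intros H; apply Th_witness in H; destruct H as [k H]; now exists (tvar k).
  - intros [t H]; apply (Th_prv [inst t p]); [intros r [<-|[]]; assumption|].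
    apply ExI with t, Ax; now left.
Qed.

Lemma Th_exS p : Th (exS p) <-> exists X, Th (instS X p).
Proof.
  split.
  - intros H; apply Th_witness in H; destruct H as [k H]; now exists k.
  - intros [t H]; apply (Th_prv [instS t p]); [intros r [<-|[]]; assumption|].
    apply ExSI with t, Ax; now left.
Qed.

Lemma inst_shift_var p : inst (tvar 0) (subst (up (fun i => tvar (S i))) (fun X => X) p) = p.
Proof.
  rewrite inst_up. rewrite <- (subst_id p) at 2. f_equal.
  extensionality i; destruct i; reflexivity.
Qed.

Lemma instS_shiftS_var p : instS 0 (subst tvar (upS S) p) = p.
Proof.
  rewrite instS_upS. rewrite <- (subst_id p) at 2. f_equal.
  extensionality i; destruct i; reflexivity.
Qed.

Lemma Th_all p : Th (all p) <-> forall t, Th (inst t p).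
Proof.
  split.
  - intros H t; apply (Th_prv [all p]); [intros r [<-|[]]; assumption|].
    apply AllE, Ax; now left.
  - intros H. destruct (Th_decide (ex (neg p))) as [He|He].
    + exfalso. apply Th_ex in He; destruct He as [t Ht].
      apply Th_bot. exact (proj1 (Th_imp _ _) Ht (H t)).
    + apply (Th_prv [neg (ex (neg p))]); [intros r [<-|[]]; assumption|].
      apply AllI, Raa. eapply ImpE; [apply Ax; simpl; right; left; reflexivity|].
      apply ExI with (tvar 0), Ax. left. symmetry. exact (inst_shift_var (neg p)).
Qed.

Lemma Th_allS p : Th (allS p) <-> forall X, Th (instS X p).
Proof.
  split.
  - intros H t; apply (Th_prv [allS p]); [intros r [<-|[]]; assumption|].
    apply AllSE, Ax; now left.
  - intros H. destruct (Th_decide (exS (neg p))) as [He|He].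
    + exfalso. apply Th_exS in He; destruct He as [t Ht].
      apply Th_bot. exact (proj1 (Th_imp _ _) Ht (H t)).
    + apply (Th_prv [neg (exS (neg p))]); [intros r [<-|[]]; assumption|].
      apply AllSI, Raa. eapply ImpE; [apply Ax; simpl; right; left; reflexivity|].
      apply ExSI with 0, Ax. left. symmetry. exact (instS_shiftS_var (neg p)).
Qed.

Lemma Th_eq_refl t : Th (eqn t t).
Proof. apply (Th_prv []); [intros _ []|apply EqRefl]. Qed.

Lemma Th_eq_subst p t u : Th (eqn t u) -> Th (inst t p) -> Th (inst u p).
Proof.
  intros H1 H2; apply (Th_prv [eqn t u; inst t p]).
  - intros r [<-|[<-|[]]]; assumption.
  - apply EqSubst with t; apply Ax; simpl; auto.
Qed.

Lemma inst_tshift t u : tsubst (scons u tvar) (tshift t) = t.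
Proof. unfold tshift; rewrite tsubst_comp; apply tsubst_id. Qed.

Lemma Th_eq_sym t u : Th (eqn t u) -> Th (eqn u t).
Proof.
  intros H. pose proof (Th_eq_subst (eqn (tvar 0) (tshift t)) t u H) as H1.
  unfold inst in H1; simpl in H1; rewrite !inst_tshift in H1. apply H1, Th_eq_refl.
Qed.

Lemma Th_eq_trans t u v : Th (eqn t u) -> Th (eqn u v) -> Th (eqn t v).
Proof.
  intros H H'. pose proof (Th_eq_subst (eqn (tshift t) (tvar 0)) u v H') as H1.
  unfold inst in H1; simpl in H1; rewrite !inst_tshift in H1. auto.
Qed.

(** A quotient by representatives: the choice depends on [t] only through the predicate
    [fun u => Th (eqn t u)], and by extensionality terms that are equal in [Th] have the same
    predicate, hence the same representative. *)
Definition rep (t : term) : term := epsilon (inhabits tzero) (fun u => Th (eqn t u)).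

Lemma rep_spec t : Th (eqn t (rep t)).
Proof. apply (epsilon_spec (inhabits tzero) (fun u => Th (eqn t u))). exists t; apply Th_eq_refl. Qed.

Lemma rep_eq t u : rep t = rep u <-> Th (eqn t u).
Proof.
  split.
  - intros H. apply Th_eq_trans with (rep t); [apply rep_spec|].
    rewrite H; apply Th_eq_sym, rep_spec.
  - intros H. unfold rep. f_equal.
    extensionality v; apply propositional_extensionality; split; intros Hv.
    + eapply Th_eq_trans; [apply Th_eq_sym, H|exact Hv].
    + eapply Th_eq_trans; [exact H|exact Hv].
Qed.

Definition cls (t : term) : {t : term | rep t = t} :=
  exist _ (rep t) (proj2 (rep_eq (rep t) t) (Th_eq_sym _ _ (rep_spec t))).

Lemma cls_eq t u : cls t = cls u <-> Th (eqn t u).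
Proof.
  rewrite <- rep_eq; split; intros H.
  - apply (f_equal (@proj1_sig _ _)) in H; exact H.
  - apply subset_eq_compat, H.
Qed.

Lemma cls_val x : cls (proj1_sig x) = x.
Proof. destruct x as [t Ht]; apply subset_eq_compat, Ht. Qed.

(** Set variables interpret themselves: the language has no equality between sets, so this sort
    needs no quotient. *)
Definition term_model : structure := {|
  dom := {t : term | rep t = t};
  sets := nat;
  izero := cls tzero;
  ione := cls tone;
  iadd x y := cls (tadd (proj1_sig x) (proj1_sig y));
  imul x y := cls (tmul (proj1_sig x) (proj1_sig y));
  ilt x y := Th (lt (proj1_sig x) (proj1_sig y));
  imem x X := Th (mem (proj1_sig x) X) |}.

Lemma Th_add_cong t u t' u' :
  Th (eqn t t') -> Th (eqn u u') -> Th (eqn (tadd t u) (tadd t' u')).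
Proof.
  intros H H'.
  pose proof (Th_eq_subst (eqn (tshift (tadd t u)) (tadd (tvar 0) (tshift u))) t t' H) as H1.
  pose proof (Th_eq_subst (eqn (tshift (tadd t u)) (tadd (tshift t') (tvar 0))) u u' H') as H2.
  unfold inst in *; cbn [subst tsubst scons] in *.
  rewrite !inst_tshift in *. apply H2, H1, Th_eq_refl.
Qed.

Lemma Th_mul_cong t u t' u' :
  Th (eqn t t') -> Th (eqn u u') -> Th (eqn (tmul t u) (tmul t' u')).
Proof.
  intros H H'.
  pose proof (Th_eq_subst (eqn (tshift (tmul t u)) (tmul (tvar 0) (tshift u))) t t' H) as H1.
  pose proof (Th_eq_subst (eqn (tshift (tmul t u)) (tmul (tshift t') (tvar 0))) u u' H') as H2.
  unfold inst in *; cbn [subst tsubst scons] in *.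
  rewrite !inst_tshift in *. apply H2, H1, Th_eq_refl.
Qed.

Lemma Th_lt_cong t u t' u' :
  Th (eqn t t') -> Th (eqn u u') -> Th (lt t u) -> Th (lt t' u').
Proof.
  intros H H'.
  pose proof (Th_eq_subst (lt (tvar 0) (tshift u)) t t' H) as H1.
  pose proof (Th_eq_subst (lt (tshift t') (tvar 0)) u u' H') as H2.
  unfold inst in *; cbn [subst tsubst scons] in *.
  rewrite !inst_tshift in *. auto.
Qed.

Lemma Th_mem_cong t t' X : Th (eqn t t') -> Th (mem t X) -> Th (mem t' X).
Proof. intros H; apply (Th_eq_subst (mem (tvar 0) X) t t' H). Qed.

Lemma teval_term_model f t : teval term_model (fun i => cls (f i)) t = cls (tsubst f t).
Proof.
  induction t; simpl; auto.
  - rewrite IHt1, IHt2; apply cls_eq, Th_add_cong; apply Th_eq_sym, rep_spec.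
  - rewrite IHt1, IHt2; apply cls_eq, Th_mul_cong; apply Th_eq_sym, rep_spec.
Qed.

Lemma sat_term_model p : forall f r,
  sat term_model (fun i => cls (f i)) r p <-> Th (subst f r p).
Proof.
  assert (Hs : forall f x, scons (cls x) (fun i => cls (f i)) = (fun i => cls (scons x f i))).
  { intros f x; extensionality i; destruct i; reflexivity. }
  induction p; intros f r; cbn [sat subst].
  - split; [intros []|apply Th_bot].
  - rewrite !teval_term_model. apply cls_eq.
  - rewrite !teval_term_model; simpl. split; apply Th_lt_cong;
      solve [apply rep_spec|apply Th_eq_sym, rep_spec].
  - rewrite !teval_term_model; simpl. split; apply Th_mem_cong;
      solve [apply rep_spec|apply Th_eq_sym, rep_spec].
  - rewrite Th_imp, IHp1, IHp2; tauto.
  - rewrite Th_and, IHp1, IHp2; tauto.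
  - rewrite Th_or, IHp1, IHp2; tauto.
  - rewrite Th_all; split; intros H.
    + intros t. rewrite inst_up, <- IHp, <- Hs. apply H.
    + intros x. specialize (H (proj1_sig x)). rewrite inst_up, <- IHp, <- Hs, cls_val in H. exact H.
  - rewrite Th_ex; split; intros [x H].
    + exists (proj1_sig x). rewrite inst_up, <- IHp, <- Hs, cls_val. exact H.
    + exists (cls x). rewrite inst_up, <- IHp, <- Hs in H. exact H.
  - rewrite Th_allS; split; intros H X; specialize (H X);
      rewrite instS_upS, <- IHp in *; exact H.
  - rewrite Th_exS; split; intros [X H]; exists X;
      rewrite instS_upS, <- IHp in *; exact H.
Qed.

Lemma henkin_model :
  exists A e E, (forall q, T q -> forall e E, sat A e E q) /\ ~ sat A e E p0.
Proof.
  exists term_model, (fun i => cls (tvar i)), (fun X => X); split.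
  - intros q Hq e E. apply (sat_agree term_model q (fun i => cls (tvar i)) e (fun X => X) E).
    + destruct (HT q Hq) as [-> _]; intros; lia.
    + destruct (HT q Hq) as [_ ->]; intros; lia.
    + apply sat_term_model. exists 0, [q]. rewrite subst_id. split.
      * intros r [<-|[]]; exact Hq.
      * apply Ax; now left.
  - intros H. apply (sat_term_model p0 tvar (fun X => X)) in H. rewrite subst_id in H.
    assert (Hn : Th (neg p0)) by (exists 0; apply tprv_prv, Ax; now left).
    apply Th_bot. exact (proj1 (Th_imp _ _) Hn H).
Qed.
End Henkin.

Theorem completeness (T : theory) p :
  (forall q, T q -> closed q) ->
  (forall A, (forall q, T q -> forall e E, sat A e E q) -> forall e E, sat A e E p) ->
  proves T p.
Proof.
  intros HT H. apply NNPP; intros Hp.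
  destruct (henkin_model T HT p Hp) as [A [e [E [HA Hn]]]]. exact (Hn (H A HA e E)).
Qed.

(** * Universal closures *)

Lemma fvn_iter n p : fvn (Nat.iter n all p) = fvn p - n.
Proof. induction n; simpl; [lia|]. rewrite IHn; lia. Qed.

Lemma fvs_iter_all n p : fvs (Nat.iter n all p) = fvs p.
Proof. induction n; simpl; auto. Qed.

Lemma fvn_iter_allS n p : fvn (Nat.iter n allS p) = fvn p.
Proof. induction n; simpl; auto. Qed.

Lemma fvs_iter_allS n p : fvs (Nat.iter n allS p) = fvs p - n.
Proof. induction n; simpl; [lia|]. rewrite IHn; lia. Qed.

Lemma closed_closure p : closed (closure p).
Proof.
  unfold closed, closure. rewrite fvn_iter_allS, fvn_iter, fvs_iter_allS, fvs_iter_all. lia.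
Qed.

Lemma sat_iter_all A n p : forall e E, sat A e E (Nat.iter n all p) ->
  forall e', (forall i, e' (n + i) = e i) -> sat A e' E p.
Proof.
  induction n as [|n IH]; intros e E H e' He.
  - replace e' with e; [exact H|]. extensionality i; symmetry; apply He.
  - simpl in H. apply (IH (scons (e' n) e) E); [apply H|].
    intros [|i]; simpl.
    + f_equal; lia.
    + rewrite <- He; f_equal; lia.
Qed.

Lemma sat_iter_allS A n p : forall e E, sat A e E (Nat.iter n allS p) ->
  forall E', (forall i, E' (n + i) = E i) -> sat A e E' p.
Proof.
  induction n as [|n IH]; intros e E H E' HE.
  - replace E' with E; [exact H|]. extensionality i; symmetry; apply HE.
  - simpl in H. apply (IH e (scons (E' n) E)); [apply H|].
    intros [|i]; simpl.
    + f_equal; lia.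
    + rewrite <- HE; f_equal; lia.
Qed.

Lemma sat_closure A p : (forall e E, sat A e E (closure p)) <-> (forall e E, sat A e E p).
Proof.
  unfold closure; split; intros H e E.
  - eapply sat_iter_all.
    + eapply sat_iter_allS; [apply (H (fun i => e (fvn p + i)) (fun i => E (fvs p + i)))|].
      reflexivity.
    + reflexivity.
  - assert (H1 : forall e E, sat A e E (Nat.iter (fvn p) all p)).
    { generalize (fvn p); intros n; induction n; simpl; intros; auto. }
    revert E; generalize (fvs p); intros n; induction n; simpl; intros; auto.
Qed.

Declare Scope num_scope.
Delimit Scope num_scope with num.
Bind Scope num_scope with dom.
Arguments izero {_}.
Arguments ione {_}.
Arguments iadd {_} _ _.
Arguments imul {_} _ _.
Arguments ilt {_} _ _.
Arguments imem {_} _ _.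
Definition ile {A : structure} (x y : dom A) : Prop := ilt x y \/ x = y.
Notation "0" := (@izero _) : num_scope.
Notation "1" := (@ione _) : num_scope.
Notation "2" := (iadd (@ione _) (@ione _)) : num_scope.
Notation "x + y" := (iadd x y) : num_scope.
Notation "x * y" := (imul x y) : num_scope.
Notation "x < y" := (ilt x%num y%num) : num_scope.
Notation "x <= y" := (ile x%num y%num) : num_scope.
Notation "x ∈ X" := (imem x%num X) (at level 70) : num_scope.

(** * Definable predicates *)

Section Delta0.
Context {A : structure}.
Local Notation M := (dom A).
Local Notation env := (nat -> dom A).

Inductive Tm : (env -> M) -> Prop :=
  | Tm_var i : Tm (fun r => r i)
  | Tm_cst c : Tm (fun _ => c)
  | Tm_add t u : Tm t -> Tm u -> Tm (fun r => iadd (t r) (u r))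
  | Tm_mul t u : Tm t -> Tm u -> Tm (fun r => imul (t r) (u r)).

(** A semantic rendering of the bounded formulas with parameters of both sorts: the
    predicates, on environments for the number variables, that they define. *)
Inductive D0 : (env -> Prop) -> Prop :=
  | D0_eq t u : Tm t -> Tm u -> D0 (fun r => t r = u r)
  | D0_lt t u : Tm t -> Tm u -> D0 (fun r => ilt (t r) (u r))
  | D0_mem t X : Tm t -> D0 (fun r => imem (t r) X)
  | D0_not P : D0 P -> D0 (fun r => ~ P r)
  | D0_and P Q : D0 P -> D0 Q -> D0 (fun r => P r /\ Q r)
  | D0_ball_scons t P : Tm t -> D0 P -> D0 (fun r => forall x, ilt x (t r) -> P (scons x r))
  | D0_ext P Q : D0 P -> (forall r, P r <-> Q r) -> D0 Q.

Lemma D0_ball t P :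
  Tm t -> D0 (fun r => P (r 0) (fun i => r (S i))) ->
  D0 (fun r => forall x, ilt x (t r) -> P x r).
Proof.
  intros Ht HP. eapply D0_ext; [apply D0_ball_scons; [apply Ht|apply HP]|].
  intros r; reflexivity.
Qed.

Lemma D0_bex t P :
  Tm t -> D0 (fun r => P (r 0) (fun i => r (S i))) ->
  D0 (fun r => exists x, ilt x (t r) /\ P x r).
Proof.
  intros Ht HP.
  eapply D0_ext; [apply D0_not, (D0_ball t (fun x r => ~ P x r)); [apply Ht|apply D0_not, HP]|].
  intros r; split; [|firstorder].
  intros H. apply NNPP; intros H'; apply H; intros x Hx Hp; apply H'; eauto.
Qed.

Lemma D0_or P Q : D0 P -> D0 Q -> D0 (fun r => P r \/ Q r).
Proof.
  intros HP HQ. eapply D0_ext; [apply D0_not, D0_and; apply D0_not; [apply HP|apply HQ]|].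
  intros r; cbv beta; tauto.
Qed.

Lemma D0_imp P Q : D0 P -> D0 Q -> D0 (fun r => P r -> Q r).
Proof.
  intros HP HQ. eapply D0_ext; [apply D0_or; [apply D0_not, HP|apply HQ]|].
  intros r; cbv beta; tauto.
Qed.

(** Truth is classical: a proposition that ignores the environment is equivalent to [0 = 0] or to
    its negation. *)
Lemma D0_const (P : Prop) : D0 (fun _ => P).
Proof.
  assert (HT : @D0 (fun _ => izero = izero)) by (apply (D0_eq (fun _ => izero) (fun _ => izero)); constructor).
  destruct (classic P) as [H|H].
  - eapply D0_ext; [apply HT|]; tauto.
  - eapply D0_ext; [apply D0_not, HT|]; tauto.
Qed.

Lemma Tm_comp t (s : env -> env) :
  Tm t -> (forall i, Tm (fun r => s r i)) -> Tm (fun r => t (s r)).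
Proof.
  intros Ht Hs; induction Ht; [apply Hs|constructor..]; assumption.
Qed.

Lemma Tm_scons (s : env -> env) :
  (forall i, Tm (fun r => s r i)) ->
  forall i, Tm (fun r => scons (r 0) (s (fun j => r (S j))) i).
Proof.
  intros Hs [|i]; simpl; [apply Tm_var|].
  apply (Tm_comp (fun r => s r i) (fun r j => r (S j)));
    [apply Hs|intros j; apply Tm_var].
Qed.

Lemma D0_comp P : D0 P -> forall s : env -> env,
  (forall i, Tm (fun r => s r i)) -> D0 (fun r => P (s r)).
Proof.
  induction 1; intros s Hs.
  - apply (D0_eq (fun r => t (s r)) (fun r => u (s r))); apply Tm_comp; auto.
  - apply (D0_lt (fun r => t (s r)) (fun r => u (s r))); apply Tm_comp; auto.
  - apply (D0_mem (fun r => t (s r))); apply Tm_comp; auto.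
  - apply D0_not, IHD0, Hs.
  - apply (D0_and (fun r => P (s r)) (fun r => Q (s r))); auto.
  - apply (D0_ball (fun r => t (s r)) (fun x r => P (scons x (s r)))).
    + apply Tm_comp; auto.
    + apply IHD0, Tm_scons, Hs.
  - eapply D0_ext; [apply IHD0, Hs|]. intros r; apply H0.
Qed.

Lemma Tm_teval t (s : env -> env) :
  (forall i, Tm (fun r => s r i)) -> Tm (fun r => teval A (s r) t).
Proof.
  intros Hs; induction t; simpl; [apply Hs|apply Tm_cst|apply Tm_cst|..];
    constructor; assumption.
Qed.

Lemma D0_sat p : bounded p -> forall E (s : env -> env),
  (forall i, Tm (fun r => s r i)) -> D0 (fun r => sat A (s r) E p).
Proof.
  assert (Htail : forall t x (e : env), teval A (scons x e) (tshift t) = teval A e t).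
  { intros t x e; unfold tshift; rewrite teval_subst; reflexivity. }
  induction 1; intros E s Hs; simpl.
  - apply D0_const.
  - apply D0_eq; apply Tm_teval, Hs.
  - apply D0_lt; apply Tm_teval, Hs.
  - apply D0_mem, Tm_teval, Hs.
  - apply D0_imp; auto.
  - apply D0_and; auto.
  - apply D0_or; auto.
  - eapply D0_ext; [apply (D0_ball (fun r => teval A (s r) t) (fun x r => sat A (scons x (s r)) E p))|].
    + apply Tm_teval, Hs.
    + apply IHbounded, Tm_scons, Hs.
    + intros r; cbv beta; split; intros H1 x; specialize (H1 x); rewrite Htail in *; exact H1.
  - eapply D0_ext; [apply (D0_bex (fun r => teval A (s r) t) (fun x r => sat A (scons x (s r)) E p))|].
    + apply Tm_teval, Hs.
    + apply IHbounded, Tm_scons, Hs.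
    + intros r; cbv beta; split; intros [x H1]; exists x; rewrite Htail in *; exact H1.
Qed.

(** The indices below [n] are the variables proper; from [n] on they hold the parameters, which a
    formula can mention only as variables. *)
Definition app (n : nat) (r a : env) (i : nat) : M := if i <? n then r i else a (i - n).

Lemma app_scons n x r a : app (S n) (scons x r) a = scons x (app n r a).
Proof. extensionality i; destruct i; reflexivity. Qed.

Lemma Tm_term t : Tm t -> exists N L, forall n a, N <= n -> (forall c, In c L -> exists k, a k = c) ->
  exists u, forall r, teval A (app n r a) u = t r.
Proof.
  induction 1 as [i|c|t u _ [N [L IH]] _ [N' [L' IH']]|t u _ [N [L IH]] _ [N' [L' IH']]].
  - exists (S i), nil; intros n a Hn _. exists (tvar i); intros r; simpl; unfold app.
    destruct (Nat.ltb_spec i n); [reflexivity|lia].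
  - exists 0, [c]; intros n a _ Ha. destruct (Ha c) as [k Hk]; [now left|].
    exists (tvar (n + k)); intros r; simpl; unfold app.
    destruct (Nat.ltb_spec (n + k) n); [lia|]. rewrite <- Hk; f_equal; lia.
  - exists (N + N'), (L ++ L'); intros n a Hn Ha.
    destruct (IH n a) as [v Hv]; [lia|intros; apply Ha, in_or_app; auto|].
    destruct (IH' n a) as [v' Hv']; [lia|intros; apply Ha, in_or_app; auto|].
    exists (tadd v v'); intros r; simpl; congruence.
  - exists (N + N'), (L ++ L'); intros n a Hn Ha.
    destruct (IH n a) as [v Hv]; [lia|intros; apply Ha, in_or_app; auto|].
    destruct (IH' n a) as [v' Hv']; [lia|intros; apply Ha, in_or_app; auto|].
    exists (tmul v v'); intros r; simpl; congruence.
Qed.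

(** The way back from predicates to bounded formulas. The depth [n] stays arbitrary because the
    quantifier case uses the induction hypothesis at [S n]; the parameter environments stay
    arbitrary because the parts of a compound formula have to share them. *)
Lemma D0_form P : D0 P -> exists N L LS, forall n a E, N <= n ->
  (forall c, In c L -> exists k, a k = c) -> (forall X, In X LS -> exists k, E k = X) ->
  exists p, bounded p /\ forall r, sat A (app n r a) E p <-> P r.
Proof.
  induction 1 as [t u Ht Hu|t u Ht Hu|t X Ht|P _ [N [L [K IH]]]|
    P Q _ [N [L [K IH]]] _ [N' [L' [K' IH']]]|t P Ht _ [N [L [K IH]]]|P Q _ [N [L [K IH]]] HPQ].
  - destruct (Tm_term t Ht) as [N [L IH]], (Tm_term u Hu) as [N' [L' IH']].
    exists (N + N'), (L ++ L'), nil; intros n a E Hn Ha _.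
    destruct (IH n a) as [v Hv]; [lia|intros; apply Ha, in_or_app; auto|].
    destruct (IH' n a) as [v' Hv']; [lia|intros; apply Ha, in_or_app; auto|].
    exists (eqn v v'); split; [constructor|]; intros r; simpl; rewrite Hv, Hv'; tauto.
  - destruct (Tm_term t Ht) as [N [L IH]], (Tm_term u Hu) as [N' [L' IH']].
    exists (N + N'), (L ++ L'), nil; intros n a E Hn Ha _.
    destruct (IH n a) as [v Hv]; [lia|intros; apply Ha, in_or_app; auto|].
    destruct (IH' n a) as [v' Hv']; [lia|intros; apply Ha, in_or_app; auto|].
    exists (lt v v'); split; [constructor|]; intros r; simpl; rewrite Hv, Hv'; tauto.
  - destruct (Tm_term t Ht) as [N [L IH]].
    exists N, L, [X]; intros n a E Hn Ha HE.
    destruct (IH n a) as [v Hv]; auto.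
    destruct (HE X) as [k Hk]; [now left|].
    exists (mem v k); split; [constructor|]; intros r; simpl; rewrite Hv, Hk; tauto.
  - exists N, L, K; intros n a E Hn Ha HE. destruct (IH n a E) as [p [Hp H]]; auto.
    exists (neg p); split; [repeat constructor; exact Hp|]. intros r; simpl; rewrite H; tauto.
  - exists (N + N'), (L ++ L'), (K ++ K'); intros n a E Hn Ha HE.
    destruct (IH n a E) as [p [Hp H]]; [lia|intros; apply Ha, in_or_app; auto|intros; apply HE, in_or_app; auto|].
    destruct (IH' n a E) as [p' [Hp' H']]; [lia|intros; apply Ha, in_or_app; auto|intros; apply HE, in_or_app; auto|].
    exists (and p p'); split; [constructor; assumption|]. intros r; simpl; rewrite H, H'; tauto.
  - destruct (Tm_term t Ht) as [N' [L' IH']].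
    exists (N + N'), (L ++ L'), K; intros n a E Hn Ha HE.
    destruct (IH (S n) a E) as [p [Hp H]]; [lia|intros; apply Ha, in_or_app; auto|auto|].
    destruct (IH' n a) as [v Hv]; [lia|intros; apply Ha, in_or_app; auto|].
    exists (all (imp (lt (tvar 0) (tshift v)) p)); split; [constructor; exact Hp|].
    intros r; simpl. split; intros H1 x; specialize (H1 x);
      unfold tshift in *; rewrite teval_subst in *; cbn [teval scons] in *;
      change (fun i => app n r a i) with (app n r a) in *;
      rewrite Hv, <- app_scons, H in *; exact H1.
  - exists N, L, K; intros n a E Hn Ha HE. destruct (IH n a E) as [p [Hp H]]; auto.
    exists p; split; [exact Hp|]. intros r; rewrite H; apply HPQ.
Qed.

Lemma nth_covers {T} (L : list T) d c : In c L -> exists k, nth k L d = c.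
Proof. intros H; destruct (In_nth L c d H) as [k [_ Hk]]; eauto. Qed.

(** [SB D0] is Sigma_1 and [SB (co (SB D0))] is Sigma_2, so that lemmas about [SB B] serve both
    levels of the hierarchy. *)
Definition SB (B : (env -> Prop) -> Prop) (P : env -> Prop) : Prop :=
  exists Q, B Q /\ forall r, P r <-> exists x, Q (scons x r).

Definition co (B : (env -> Prop) -> Prop) (P : env -> Prop) : Prop := B (fun r => ~ P r).
End Delta0.

(** If [sets A] were empty, no environment would exist and the first field would hold vacuously; the
    second excludes this. *)
Class RCA (A : structure) : Prop := {
  rca_ax : forall q, RCA0 q -> forall e E, sat A e E q;
  rca_set : inhabited (sets A) }.

Ltac tm := repeat first [apply Tm_var | apply Tm_cst | apply Tm_add | apply Tm_mul].

(** * Arithmetic in a model of RCA0 *)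

Section Arithmetic.
Context {A : structure} {HA : RCA A}.
Local Notation M := (dom A).
Local Notation env := (nat -> dom A).
Local Open Scope num_scope.

Lemma S1_induction (P : M -> Prop) :
  SB D0 (fun r => P (r O)) -> P 0 -> (forall x, P x -> P (x + 1)) -> forall x, P x.
Proof.
  intros [Q [HQ HPQ]] H0 HS.
  destruct (D0_form Q HQ) as [N [L [K H]]].
  destruct rca_set as [X0].
  (* The two additional indices are the existential witness and the induction variable. *)
  destruct (H (S (S N)) (fun k => nth k L 0) (fun k => nth k K X0)) as [q [Hq Hs]];
    [lia|intros; now apply nth_covers|intros; now apply nth_covers|].
  assert (HI : RCA0 (closure (induction (Defs.ex q)))).
  { right; left. exists (Defs.ex q); split; [exists q; auto|reflexivity]. }
  pose proof (proj1 (sat_closure A _) (rca_ax _ HI)) as HI'.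
  set (a := fun k => nth k L 0) in *. set (E := fun k => nth k K X0) in *.
  assert (HP : forall x, sat A (scons x (app N (fun _ => 0) a)) E (Defs.ex q) <-> P x).
  { intros x; simpl. specialize (HPQ (scons x (fun _ => 0))); simpl in HPQ. rewrite HPQ.
    split; intros [y Hy]; exists y; rewrite <- !app_scons, Hs in *; exact Hy. }
  specialize (HI' (app N (fun _ => 0) a) E). simpl in HI'.
  intros x; apply HP, HI'. split.
  - change (sat A (app N (fun _ => 0) a) E (inst tzero (Defs.ex q))).
    unfold inst; rewrite sat_subst.
    replace (fun i => _) with (scons 0 (app N (fun _ => 0) a)).
    + apply HP, H0.
    + extensionality i; destruct i; reflexivity.
  - intros y Hy. apply HP, HS in Hy.
    match goal with |- exists x, sat ?B (scons x ?e) ?E (subst ?f ?r q) =>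
      change (sat B e E (subst (scons (tadd (tvar 0) tone) (fun i => tvar (S i))) r (Defs.ex q))) end.
    rewrite sat_subst.
    replace (fun i => _) with (scons (y + 1) (app N (fun _ => 0) a)).
    + apply HP, Hy.
    + extensionality i; destruct i; reflexivity.
Qed.

Lemma comprehension_D1 (P : M -> Prop) :
  SB D0 (fun r => P (r O)) -> SB D0 (fun r => ~ P (r O)) ->
  exists X, forall x, x ∈ X <-> P x.
Proof.
  intros [Q [HQ HPQ]] [R [HR HPR]].
  destruct (D0_form Q HQ) as [N [L [K H]]].
  (* The negated matrix of the Sigma_1 form of [~ P] is the matrix of a Pi_1 form of [P]. The two
     formulas get a common parameter list, since comprehension evaluates both in one environment. *)
  destruct (D0_form (fun r => ~ R r) (D0_not _ HR)) as [N' [L' [K' H']]].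
  destruct rca_set as [X0].
  set (n := (N + N')%nat).
  destruct (H (S (S n)) (fun k => nth k (L ++ L') 0) (fun k => nth k (K ++ K') X0)) as [q [Hq Hs]];
    [unfold n; lia|intros; apply nth_covers, in_or_app; auto|intros; apply nth_covers, in_or_app; auto|].
  destruct (H' (S (S n)) (fun k => nth k (L ++ L') 0) (fun k => nth k (K ++ K') X0)) as [q' [Hq' Hs']];
    [unfold n; lia|intros; apply nth_covers, in_or_app; auto|intros; apply nth_covers, in_or_app; auto|].
  set (a := fun k => nth k (L ++ L') 0) in *. set (E := fun k => nth k (K ++ K') X0) in *.
  assert (HC : RCA0 (closure (comprehension (Defs.ex q) (Defs.all q')))).
  { right; right. exists (Defs.ex q), (Defs.all q').
    split; [exists q; auto|split; [exists q'; auto|reflexivity]]. }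
  pose proof (proj1 (sat_closure A _) (rca_ax _ HC) (app n (fun _ => 0) a) E) as HC'.
  assert (HP : forall x, sat A (scons x (app n (fun _ => 0) a)) E (Defs.ex q) <-> P x).
  { intros x; simpl. specialize (HPQ (scons x (fun _ => 0))); simpl in HPQ. rewrite HPQ.
    split; intros [y Hy]; exists y; rewrite <- !app_scons, Hs in *; exact Hy. }
  assert (HP' : forall x, sat A (scons x (app n (fun _ => 0) a)) E (Defs.all q') <-> P x).
  { intros x; simpl. specialize (HPR (scons x (fun _ => 0))); simpl in HPR.
    split.
    - intros Hx. apply NNPP; intros Hn. apply HPR in Hn. destruct Hn as [y Hy].
      specialize (Hx y). rewrite <- !app_scons, Hs' in Hx. exact (Hx Hy).
    - intros Hx y. rewrite <- !app_scons, Hs'. intros Hy. apply (proj2 HPR); eauto. }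
  unfold comprehension in HC'. cbn [sat] in HC'.
  destruct HC' as [X HX].
  - intros x. unfold iff. cbn [sat]. specialize (HP x); specialize (HP' x).
    cbn [sat] in HP, HP'. tauto.
  - exists X; intros x. specialize (HX x). unfold iff in HX. cbn [sat] in HX.
    unfold shiftS in HX. rewrite sat_subst in HX.
    specialize (HP x). simpl in HX. unfold teval, scons in *. tauto.
Qed.

Lemma S1_D0 (P : env -> Prop) : D0 P -> SB D0 P.
Proof.
  intros H. exists (fun r => P (fun i => r (S i))). split.
  - apply (D0_comp P H (fun r i => r (S i))). intros; apply Tm_var.
  - intros r; simpl; split; [exists 0; exact H0|]. intros [_ Hx]; exact Hx.
Qed.

Lemma D0_induction (P : M -> Prop) :
  D0 (fun r => P (r O)) -> P 0 -> (forall x, P x -> P (x + 1)) -> forall x, P x.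
Proof. intros H; apply S1_induction, S1_D0, H. Qed.

Lemma basic_ax k e E : (k < length basic_axioms)%nat ->
  sat A e E (sentence (nth k basic_axioms (fun _ _ => bot))).
Proof.
  intros H. apply rca_ax. left. apply in_map, nth_In, H.
Qed.

Ltac basic k := destruct (@rca_set A _) as [X0];
  refine (basic_ax k (fun _ => @izero A) (fun _ => X0) _); simpl; lia.

Lemma add_0_r (x : M) : x + 0 = x. Proof. revert x; basic 2%nat. Qed.
Lemma add_succ_r (x y : M) : x + (y + 1) = (x + y) + 1. Proof. revert x y; basic 3%nat. Qed.
Lemma mul_0_r (x : M) : x * 0 = 0. Proof. revert x; basic 4%nat. Qed.
Lemma mul_succ_r (x y : M) : x * (y + 1) = x * y + x. Proof. revert x y; basic 5%nat. Qed.
Lemma nlt_0 (x : M) : ~ x < 0. Proof. revert x; basic 6%nat. Qed.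
Lemma lt_succ (x y : M) : x < y + 1 <-> x <= y. Proof. revert x y; basic 7%nat. Qed.

Ltac d0 := repeat first [apply D0_const | apply D0_and | apply D0_or | apply D0_not |
  apply D0_imp | apply D0_ball | apply D0_bex | apply D0_eq | apply D0_lt | apply D0_mem]; tm.
Ltac ind x := revert x;
  match goal with |- forall z, @?P z => apply (D0_induction P); [unfold ile; d0| |] end.

Lemma add_0_l (x : M) : 0 + x = x.
Proof. ind x; [apply add_0_r|]. intros x IH; rewrite add_succ_r, IH; reflexivity. Qed.

Lemma add_assoc (x y z : M) : (x + y) + z = x + (y + z).
Proof.
  ind z; [rewrite !add_0_r; reflexivity|].
  intros z IH; rewrite !add_succ_r, IH; reflexivity.
Qed.

Lemma add_succ_l (x y : M) : (x + 1) + y = (x + y) + 1.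
Proof.
  ind y; [rewrite !add_0_r; reflexivity|].
  intros y IH; rewrite !add_succ_r, IH; reflexivity.
Qed.

Lemma add_comm (x y : M) : x + y = y + x.
Proof.
  ind y; [rewrite add_0_r, add_0_l; reflexivity|].
  intros y IH; rewrite add_succ_r, add_succ_l, IH; reflexivity.
Qed.

Lemma mul_0_l (x : M) : 0 * x = 0.
Proof. ind x; [apply mul_0_r|]. intros x IH; rewrite mul_succ_r, IH; apply add_0_r. Qed.

Lemma mul_succ_l (x y : M) : (x + 1) * y = x * y + y.
Proof.
  ind y; [rewrite !mul_0_r, add_0_r; reflexivity|].
  intros y IH; rewrite !mul_succ_r, IH, !add_assoc. f_equal.
  rewrite <- !add_assoc; f_equal; apply add_comm.
Qed.

Lemma mul_comm (x y : M) : x * y = y * x.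
Proof.
  ind y; [rewrite mul_0_r, mul_0_l; reflexivity|].
  intros y IH; rewrite mul_succ_r, mul_succ_l, IH; reflexivity.
Qed.

Lemma mul_1_l (x : M) : 1 * x = x.
Proof. rewrite <- (add_0_l 1), mul_succ_l, mul_0_l; apply add_0_l. Qed.

Lemma mul_add_l (x y z : M) : (x + y) * z = x * z + y * z.
Proof.
  ind z; [rewrite !mul_0_r, add_0_r; reflexivity|].
  intros z IH; rewrite !mul_succ_r, IH, !add_assoc. f_equal.
  rewrite <- !add_assoc; f_equal; apply add_comm.
Qed.

Lemma mul_assoc (x y z : M) : (x * y) * z = x * (y * z).
Proof.
  ind z; [rewrite !mul_0_r; reflexivity|].
  intros z IH. rewrite !mul_succ_r, IH, (mul_comm x (_ + _)), mul_add_l, !(mul_comm _ x).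
  reflexivity.
Qed.

Lemma num_semi_ring : @semi_ring_theory M 0 1 iadd imul eq.
Proof.
  constructor; intros.
  - apply add_0_l.
  - apply add_comm.
  - symmetry; apply add_assoc.
  - apply mul_1_l.
  - apply mul_0_l.
  - apply mul_comm.
  - symmetry; apply mul_assoc.
  - apply mul_add_l.
Qed.

Lemma lt_trans (x y z : M) : x < y -> y < z -> x < z.
Proof.
  intros H; ind z; [intros H'; destruct (nlt_0 _ H')|].
  intros z IH H'. apply lt_succ in H'. apply lt_succ; left.
  destruct H' as [H'| ->]; auto.
Qed.

Lemma succ_lt_mono (x y : M) : x < y -> x + 1 < y + 1.
Proof.
  ind y; [intros H'; destruct (nlt_0 _ H')|].
  intros y IH H. apply lt_succ in H. apply lt_succ.
  destruct H as [H| ->]; [left; auto|right; reflexivity].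
Qed.

Lemma le_0 (x : M) : 0 <= x.
Proof. ind x; [now right|]. intros x H; left; apply lt_succ, H. Qed.

Lemma lt_total (x y : M) : x < y \/ x = y \/ y < x.
Proof.
  ind y.
  - destruct (le_0 x); auto.
  - intros y [H|[->|H]].
    + left; apply lt_succ; now left.
    + left; apply lt_succ; now right.
    + apply succ_lt_mono, lt_succ in H. destruct H; auto.
Qed.

Lemma lt_irrefl (x : M) : ~ x < x.
Proof.
  ind x; [apply nlt_0|].
  intros x IH H. apply lt_succ in H. apply IH. destruct H as [H|H].
  - eapply lt_trans; [|apply H]. apply lt_succ; now right.
  - rewrite <- H at 2. apply lt_succ; now right.
Qed.

Lemma le_trans (x y z : M) : x <= y -> y <= z -> x <= z.
Proof.
  intros [H| ->] [H'| <-]; try (now left); try (now right). left; eapply lt_trans; eauto.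
Qed.

Lemma le_refl (x : M) : x <= x.
Proof. now right. Qed.

Lemma nlt_le (x y : M) : ~ x < y -> y <= x.
Proof. intros H; destruct (lt_total x y) as [H'|[->|H']]; [tauto|now right|now left]. Qed.

Lemma nle_lt (x y : M) : ~ x <= y -> y < x.
Proof.
  intros H; destruct (lt_total x y) as [H'|[H'|H']]; [|now destruct H; right|exact H'].
  destruct H; now left.
Qed.

Lemma lt_succ_le (x y : M) : x < y -> x + 1 <= y.
Proof. intros H; apply lt_succ, succ_lt_mono, H. Qed.

Lemma succ_le_lt (x y : M) : x + 1 <= y -> x < y.
Proof.
  intros H. assert (x < x + 1) by (apply lt_succ; now right).
  destruct H as [H| <-]; [eapply lt_trans; eauto|assumption].
Qed.

Lemma add_le_mono_r (x y z : M) : x <= y -> x + z <= y + z.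
Proof.
  intros H; ind z; [rewrite !add_0_r; exact H|].
  intros z IH; rewrite !add_succ_r. apply lt_succ_le, lt_succ, IH.
Qed.

Lemma add_le_mono (x y z w : M) : x <= y -> z <= w -> x + z <= y + w.
Proof.
  intros H H'. apply le_trans with (y + z); [now apply add_le_mono_r|].
  rewrite !(add_comm y). now apply add_le_mono_r.
Qed.

Lemma mul_le_mono_l (x y z : M) : x <= y -> z * x <= z * y.
Proof.
  intros H; ind z; [rewrite !mul_0_l; apply le_refl|].
  intros z IH; rewrite !mul_succ_l. now apply add_le_mono.
Qed.

Lemma le_antisym (x y : M) : x <= y -> y <= x -> x = y.
Proof.
  intros [H|H] [H'|H']; auto. destruct (lt_irrefl x); eapply lt_trans; eauto.
Qed.

(** * Linear arithmetic by Farkas certificates *)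

Fixpoint num (k : nat) : M := match k with O => 0 | S O => 1 | S k => num k + 1 end.

Fixpoint comb (f : M * M -> M) (ks : list nat) (l : list (M * M)) : M :=
  match ks, l with
  | O :: ks, _ :: l => comb f ks l
  | S O :: ks, x :: l => f x + comb f ks l
  | k :: ks, x :: l => num k * f x + comb f ks l
  | _, _ => 0
  end.

(** A Farkas certificate: a combination of the inequalities [l] with the
    coefficients [ks] reads [L + 1 + m <= L]. *)
Lemma farkas (l : list (M * M)) ks m :
  Forall (fun p => fst p <= snd p) l ->
  comb fst ks l = comb snd ks l + 1 + num m -> False.
Proof.
  intros Hl H. apply (lt_irrefl (comb snd ks l)).
  apply succ_le_lt.
  apply le_trans with (comb fst ks l).
  - rewrite H. rewrite <- (add_0_r (_ + 1)) at 1. apply add_le_mono; [apply le_refl|apply le_0].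
  - clear H. revert ks; induction Hl as [|[x y] l H Hl IH]; intros [|[|[|k]] ks]; simpl;
      try apply le_refl; auto using add_le_mono, mul_le_mono_l.
Qed.
End Arithmetic.

(** With every variable sent to 0, a reified polynomial evaluates to its constant term. *)
Definition zero_eval : PExpr Q -> Q :=
  PEeval Qplus Qmult Qminus Qopp (fun q => q) (fun n => n) (fun _ _ => 0%Q) (fun _ => 0%Q).

Fixpoint coefs (w : Psatz Q) (n : nat) : Q :=
  match w with
  | PsatzIn _ k => if Nat.eqb k n then 1%Q else 0%Q
  | PsatzAdd u v => Qplus (coefs u n) (coefs v n)
  | PsatzMulE (PsatzC c) v => Qmult c (coefs v n)
  | PsatzMulC (Pc c) v => Qmult c (coefs v n)
  | _ => 0%Q
  end.

(** [wlra_Q] numbers the hypotheses backwards, so that 0 and 1 are the dummy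
    inequalities of [le_system] below. *)
Definition int_coefs (w : list (Psatz Q)) (n : nat) : list nat :=
  match w with
  | w :: _ =>
    let qs := List.map (coefs w) (rev (seq 2 n)) in
    let d := fold_right (fun q d => Pos.mul (Qden q) d) xH qs in
    List.map (fun q => Z.to_nat (Qnum (Qred (Qmult q (Qmake (Zpos d) 1))))) qs
  | nil => nil
  end.

(** In a refutation the variable parts of the two combined sides cancel, so their difference is its
    constant term. One unit of it is the explicit [1] in [farkas], hence [pred]. *)
Definition slack (ks : list nat) (l : list (PExpr Q * PExpr Q)) : nat :=
  pred (Z.to_nat (Qnum (Qred (fold_right Qplus 0%Q
    (List.map (fun x => Qmult (inject_Z (Z.of_nat (fst x)))
       (Qminus (zero_eval (fst (snd x))) (zero_eval (snd (snd x))))) (combine ks l)))))).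

(** The preprocessing of [wlra_Q] discards, without a certificate, a system in which
    two inequalities contradict each other; the two dummy variables, bounded
    by 0 and added to all right-hand sides, prevent this. *)
Definition le_system (l : list (PExpr Q * PExpr Q)) : Tauto.BFormula (Formula Q) Tauto.isProp :=
  let d := PEX 1000 in
  let e := PEX 1001 in
  let le x y := Tauto.A Tauto.isProp {| Flhs := x; Fop := OpLe; Frhs := y |} tt in
  fold_right (fun x f => Tauto.IMPL x None f) (Tauto.FF Tauto.isProp)
    (List.map (fun x => le (fst x) (PEadd (snd x) (PEadd d e))) l ++
     [le d (PEc 0%Q); le e (PEc 0%Q)]).

Ltac atom_in t l :=
  lazymatch l with
  | nil => constr:(false)
  | cons ?a ?l => match a with
                  | _ => let _ := match goal with _ => constr_eq a t end in constr:(true)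
                  | _ => atom_in t l
                  end
  end.

Ltac atoms_of t l :=
  lazymatch t with
  | iadd ?a ?b => let l := atoms_of a l in atoms_of b l
  | imul ?a ?b => let l := atoms_of a l in atoms_of b l
  | izero => l
  | ione => l
  | _ => let b := atom_in t l in
         lazymatch b with true => l | false => constr:(cons t l) end
  end.

Ltac atoms_of_pairs ps l :=
  lazymatch ps with
  | nil => l
  | cons (?a, ?b) ?ps =>
    let l := atoms_of a l in let l := atoms_of b l in atoms_of_pairs ps l
  end.

Ltac atom_index t l n :=
  match l with
  | cons ?a _ => let _ := match goal with _ => constr_eq a t end in n
  | cons _ ?l => let n := eval compute in (Pos.succ n) in atom_index t l n
  end.

Ltac reify_num l t :=
  lazymatch t with
  | iadd ?a ?b => let a := reify_num l a in let b := reify_num l b in constr:(@PEadd Q a b)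
  | imul ?a ?b => let a := reify_num l a in let b := reify_num l b in constr:(@PEmul Q a b)
  | izero => constr:(@PEc Q 0%Q)
  | ione => constr:(@PEc Q 1%Q)
  | _ => let n := atom_index t l xH in constr:(@PEX Q n)
  end.

Ltac reify_pairs l ps :=
  lazymatch ps with
  | nil => constr:(@nil (PExpr Q * PExpr Q))
  | cons (?a, ?b) ?ps =>
    let a := reify_num l a in let b := reify_num l b in
    let r := reify_pairs l ps in constr:(cons (a, b) r)
  end.

Ltac add_nonneg acc l :=
  lazymatch l with
  | nil => idtac
  | cons ?a ?l => apply (Forall_cons (0%num, a) (le_0 a)) in acc; add_nonneg acc l
  end.

Ltac products_of t l :=
  lazymatch t with
  | iadd ?a ?b => let l := products_of a l in products_of b l
  | imul ?a ?b => let l := products_of a l in let l := products_of b l in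
         let c := atom_in t l in
         lazymatch c with true => l | false => constr:(cons t l) end
  | _ => l
  end.

Ltac products_of_pairs ps l :=
  lazymatch ps with
  | nil => l
  | cons (?a, ?b) ?ps =>
    let l := products_of a l in let l := products_of b l in products_of_pairs ps l
  end.

(** Linear arithmetic in the discretely ordered semiring of a model. Strict inequalities become
    [x + 1 <= y], and variables and products enter with their nonnegativity, which takes the place
    of negative numbers. The rational certificate is scaled to natural coefficients and checked by
    [ring]. *)
Ltac mlia :=
  let acc := fresh "acc" in
  lazymatch goal with
  | |- False => idtac
  | |- ilt _ _ => apply NNPP; let H := fresh in intros H; apply nlt_le in H
  | |- ile _ _ => apply NNPP; let H := fresh in intros H; apply nle_lt in H
  | |- @eq (dom _) _ _ => apply le_antisym;
       (apply NNPP; let H := fresh in intros H; apply nle_lt in H)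
  | |- ~ _ => let H := fresh in intros H
  | |- _ => exfalso
  end;
  repeat match goal with
  | H : ~ ilt _ _ |- _ => apply nlt_le in H
  | H : ~ ile _ _ |- _ => apply nle_lt in H
  | H : _ /\ _ |- _ => destruct H
  end;
  lazymatch goal with
  | _ : RCA ?A |- _ =>
    pose proof (Forall_nil (fun p : dom A * dom A => ile (fst p) (snd p))) as acc
  end;
  repeat match goal with
  | H : ilt ?a ?b |- _ => apply lt_succ_le in H
  end;
  repeat match goal with
  | H : ile ?a ?b |- _ => apply (Forall_cons (a, b) H) in acc; clear H
  | H : @eq (dom _) ?a ?b |- _ =>
      apply (Forall_cons (a, b) (or_intror H)) in acc;
      apply (Forall_cons (b, a) (or_intror (eq_sym H))) in acc; clear H
  end;
  lazymatch type of acc with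
  | Forall _ ?ps =>
    let T := lazymatch type of ps with list (?T * _) => T end in
    let l := atoms_of_pairs ps (@nil T) in
    let pr := products_of_pairs ps (@nil T) in
    add_nonneg acc l; add_nonneg acc pr;
    lazymatch type of acc with
    | Forall _ ?ps =>
      let rs := reify_pairs l ps in
      let f := eval cbv in (le_system rs) in
      let w := fresh "w" in
      wlra_Q w f;
      let wv := eval cbv delta [w] in w in
      let ks := eval vm_compute in (int_coefs wv (length rs)) in
      let m := eval vm_compute in (slack ks rs) in
      clear w;
      apply (farkas ps ks m acc); cbn [comb num fst snd]; ring
    end
  end.

(** * Classes of definable predicates *)

Record good {A : structure} (B : ((nat -> dom A) -> Prop) -> Prop) : Prop := {
  g_ext P Q : B P -> (forall r, P r <-> Q r) -> B Q;
  g_D0 P : D0 P -> B P;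
  g_and P Q : B P -> B Q -> B (fun r => P r /\ Q r);
  g_or P Q : B P -> B Q -> B (fun r => P r \/ Q r);
  g_ball t P : Tm t -> B (fun r => P (r O) (fun i => r (S i))) ->
    B (fun r => forall x, ilt x (t r) -> P x r);
  g_bex t P : Tm t -> B (fun r => P (r O) (fun i => r (S i))) ->
    B (fun r => exists x, ilt x (t r) /\ P x r);
  g_comp P (s : (nat -> dom A) -> nat -> dom A) :
    B P -> (forall i, Tm (fun r => s r i)) -> B (fun r => P (s r)) }.

Definition inductive_class {A : structure} (B : ((nat -> dom A) -> Prop) -> Prop) : Prop :=
  forall P : dom A -> Prop, B (fun r => P (r O)) -> P izero ->
    (forall x, P x -> P (iadd x ione)) -> forall x, P x.

Section Classes.
Context {A : structure} {HA : RCA A}.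
Local Notation M := (dom A).
Local Notation env := (nat -> dom A).
Local Notation class := ((env -> Prop) -> Prop).
Local Open Scope num_scope.
Add Ring num_ring : (@num_semi_ring A HA).

Lemma good_D0 : good (@D0 A).
Proof.
  constructor.
  - intros P Q; apply D0_ext.
  - auto.
  - apply D0_and.
  - apply D0_or.
  - apply D0_ball.
  - apply D0_bex.
  - intros P s HP; apply (D0_comp P HP s).
Qed.

Lemma good_co (B : class) : good B -> good (co B).
Proof.
  intros [He H0 Ha Ho Hl Hx Hc]; unfold co; constructor.
  - intros P Q HP HPQ. eapply He; [apply HP|]. intros r; specialize (HPQ r); cbv beta; tauto.
  - intros P HP; apply H0, D0_not, HP.
  - intros P Q HP HQ. eapply He; [apply (Ho _ _ HP HQ)|]. intros r; cbv beta; tauto.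
  - intros P Q HP HQ. eapply He; [apply (Ha _ _ HP HQ)|]. intros r; cbv beta; tauto.
  - intros t P Ht HP. eapply He; [apply (Hx t (fun x r => ~ P x r) Ht HP)|].
    intros r; cbv beta; split; [firstorder|].
    intros H; apply NNPP; intros H'; apply H; intros x Hx' ; apply NNPP; eauto.
  - intros t P Ht HP. eapply He; [apply (Hl t (fun x r => ~ P x r) Ht HP)|].
    intros r; cbv beta; firstorder.
  - intros P s HP Hs. exact (Hc _ s HP Hs).
Qed.

Lemma SB_ext (B : class) P Q : SB B P -> (forall r, P r <-> Q r) -> SB B Q.
Proof. intros [R [HR H]] H'; exists R; split; [exact HR|]. intros r; rewrite <- H'; apply H. Qed.

Lemma SB_of (B : class) P : good B -> B P -> SB B P.
Proof.
  intros HB HP. exists (fun r => P (fun i => r (S i))); split.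
  - apply (g_comp _ HB P (fun r i => r (S i)) HP); intros; tm.
  - intros r; simpl; split; [intros H; exists 0; exact H|intros [_ H]; exact H].
Qed.

(** Two unbounded quantifiers contract to a single one that bounds both witnesses. This needs no
    pairing function, only closure of [B] under bounded quantifiers. *)
Lemma SB_ex (B : class) P : good B -> SB B (fun r => P (r O) (fun i => r (S i))) ->
  SB B (fun r => exists x, P x r).
Proof.
  intros HB [Q [HQ H]].
  exists (fun r => exists x, ilt x (r O) /\ exists y, ilt y (r O) /\
            Q (scons y (scons x (fun i => r (S i))))).
  split.
  - apply (g_bex _ HB (fun r => r O)
      (fun x r => exists y, ilt y (r O) /\ Q (scons y (scons x (fun i => r (S i)))))); [tm|].
    apply (g_bex _ HB (fun r => r (S O))
      (fun y r => Q (scons y (scons (r O) (fun i => r (S (S i))))))); [tm|].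
    apply (g_comp _ HB Q (fun r => scons (r O) (scons (r (S O)) (fun i => r (S (S (S i))))))); [exact HQ|].
    intros [|[|i]]; simpl; tm.
  - intros r; simpl; split.
    + intros [x Hx]. apply (H (scons x r)) in Hx. destruct Hx as [y Hy].
      exists (x + y + 1), x; cbn [scons]; split; [mlia|]. exists y; split; [mlia|exact Hy].
    + intros [z [x [_ [y [_ Hy]]]]]. exists x. apply (H (scons x r)). exists y; exact Hy.
Qed.

Lemma SB_or (B : class) P Q : good B -> SB B P -> SB B Q -> SB B (fun r => P r \/ Q r).
Proof.
  intros HB [P' [HP H]] [Q' [HQ H']]. exists (fun r => P' r \/ Q' r); split.
  - now apply (g_or _ HB).
  - intros r; rewrite H, H'; split.
    + intros [[x Hx]|[x Hx]]; exists x; auto.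
    + intros [x [Hx|Hx]]; eauto.
Qed.

Lemma SB_comp (B : class) P s : good B -> SB B P -> (forall i, Tm (fun r : env => s r i)) ->
  SB B (fun r => P (s r)).
Proof.
  intros HB [Q [HQ H]] Hs.
  exists (fun r => Q (scons (r O) (s (fun i => r (S i))))); split.
  - apply (g_comp _ HB Q (fun r => scons (r O) (s (fun i => r (S i)))) HQ), Tm_scons, Hs.
  - intros r; simpl; apply H.
Qed.

Lemma SB_and (B : class) P Q : good B -> SB B P -> SB B Q -> SB B (fun r => P r /\ Q r).
Proof.
  intros HB [P' [HP H]] HQ.
  apply SB_ext with (fun r => exists x, P' (scons x r) /\ Q r).
  2:{ intros r; rewrite H; firstorder. }
  apply (SB_ex B (fun x r => P' (scons x r) /\ Q r) HB).
  pose proof (SB_comp B Q (fun r i => r (S i)) HB HQ ltac:(intros; tm)) as [Q' [HQ' H']].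
  exists (fun r => P' (scons (r (S O)) (fun i => r (S (S i)))) /\ Q' r); split.
  - apply (g_and _ HB); [|exact HQ'].
    apply (g_comp _ HB P' (fun r => scons (r (S O)) (fun i => r (S (S i))))); [exact HP|].
    intros [|i]; simpl; tm.
  - intros r; simpl. specialize (H' r). cbv beta in H'. rewrite H'. firstorder.
Qed.

Lemma SB_bex (B : class) t P : good B -> Tm t -> SB B (fun r => P (r O) (fun i => r (S i))) ->
  SB B (fun r => exists x, ilt x (t r) /\ P x r).
Proof.
  intros HB Ht HP. apply (SB_ex B (fun x r => ilt x (t r) /\ P x r) HB), SB_and; auto.
  apply SB_of, g_D0, D0_lt; auto; [apply Tm_var|].
  apply (Tm_comp t (fun r i => r (S i)) Ht); intros; tm.
Qed.

(** Induction on [z] for the existence of a bound that serves all [x < z]. The restriction to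
    [x < a] enters as the disjunct [~ x < a], since a [good] class is closed under disjunction but
    not under implication. *)
Lemma collection (B : class) (R : M -> M -> Prop) a : good B -> inductive_class (SB B) ->
  B (fun r => R (r O) (r 1%nat)) -> (forall x, x < a -> exists y, R x y) ->
  exists b, forall x, x < a -> exists y, y < b /\ R x y.
Proof.
  intros HB HI HR Ha.
  assert (G : forall z, exists b, forall x, x < z -> ~ x < a \/ exists y, y < b /\ R x y).
  { apply (HI (fun z => exists b, forall x, x < z -> ~ x < a \/ exists y, y < b /\ R x y)).
    - exists (fun e => forall x, ilt x (e (S O)) -> ~ x < a \/ exists y, ilt y (e O) /\ R x y).
      split; [|reflexivity].
      apply (g_ball _ HB (fun e => e (S O)) (fun x e => ~ x < a \/ exists y, ilt y (e O) /\ R x y)); [tm|].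
      apply (g_or _ HB); [apply (g_D0 _ HB), D0_not, D0_lt; tm|].
      apply (g_bex _ HB (fun e => e (S O)) (fun y e => R (e O) y)); [tm|].
      apply (g_comp _ HB _ (fun e i => match i with O => e 1%nat | _ => e O end) HR).
      intros [|i]; tm.
    - exists 0; intros x Hx; destruct (nlt_0 _ Hx).
    - intros z [b Hb]. destruct (classic (z < a)) as [Hz|Hz].
      + destruct (Ha z Hz) as [y Hy].
        exists (b + y + 1). intros x Hx. apply lt_succ in Hx. destruct Hx as [Hx| ->].
        * destruct (Hb x Hx) as [H1|[w [Hw Hq]]]; [now left|right].
          exists w; split; [mlia|exact Hq].
        * right; exists y; split; [mlia|exact Hy].
      + exists b; intros x Hx. apply lt_succ in Hx. destruct Hx as [Hx| ->]; auto. }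
  destruct (G a) as [b Hb]. exists b; intros x Hx.
  destruct (Hb x Hx); [contradiction|assumption].
Qed.

(** Collection moves the unbounded existential quantifier in front of the bounded universal one. *)
Lemma SB_ball (B : class) t P : good B -> inductive_class (SB B) ->
  Tm t -> SB B (fun r => P (r O) (fun i => r (S i))) ->
  SB B (fun r => forall x, ilt x (t r) -> P x r).
Proof.
  intros HB HI Ht [Q [HQ H]].
  assert (Hcoll : forall r a, (forall x, x < a -> P x r) ->
    exists b, forall x, x < a -> exists y, y < b /\ Q (scons y (scons x r))).
  { intros r a Ha. apply (collection B (fun x y => Q (scons y (scons x r)))); auto.
    - apply (g_comp _ HB Q (fun e => scons (e (S O)) (scons (e O) r)) HQ).
      intros [|[|i]]; simpl; tm.
    - intros x Hx. apply (H (scons x r)), (Ha x Hx). }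
  exists (fun r => forall x, ilt x (t (fun i => r (S i))) ->
            exists y, ilt y (r O) /\ Q (scons y (scons x (fun i => r (S i))))).
  split.
  - apply (g_ball _ HB (fun r => t (fun i => r (S i))) (fun x r =>
            exists y, ilt y (r O) /\ Q (scons y (scons x (fun i => r (S i)))))).
    + apply (Tm_comp t (fun r i => r (S i)) Ht); intros; tm.
    + apply (g_bex _ HB (fun r => r (S O)) (fun y r => Q (scons y (scons (r O) (fun i => r (S (S i))))))); [tm|].
      apply (g_comp _ HB Q (fun r => scons (r O) (scons (r (S O)) (fun i => r (S (S (S i)))))) HQ).
      intros [|[|i]]; simpl; tm.
  - intros r; simpl; split.
    + intros Hr. destruct (Hcoll r (t r) Hr) as [b Hb]. exists b; exact Hb.
    + intros [b Hb] x Hx. destruct (Hb x Hx) as [y [_ Hy]]. apply (H (scons x r)). exists y; exact Hy.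
Qed.

Lemma good_SB (B : class) : good B -> inductive_class (SB B) -> good (SB B).
Proof.
  intros HB HI; constructor.
  - apply SB_ext.
  - intros P HP; apply SB_of, g_D0; auto.
  - intros P Q; now apply SB_and.
  - intros P Q; now apply SB_or.
  - intros t P; now apply SB_ball.
  - intros t P; now apply SB_bex.
  - intros P s; now apply SB_comp.
Qed.

Section Extrema.
Context (B : class) (HB : good B) (HI : inductive_class (SB B)).
Local Notation C := (SB B).
Let HC : good C := good_SB B HB HI.

(** Without a maximum, induction on [i] finds elements of [P] above every [i], against the bound
    [a]. *)
Lemma SB_max (P : M -> Prop) x a : C (fun r => P (r O)) -> P x -> (forall y, P y -> y <= a) ->
  exists y, P y /\ forall z, P z -> z <= y.
Proof.
  intros HP Hx Ha. apply NNPP; intros Hn.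
  assert (G : forall i, exists y, i <= y /\ P y).
  { apply (HI (fun i => exists y, i <= y /\ P y)).
    - apply (SB_ex B (fun y r => r O <= y /\ P y) HB). apply (g_and _ HC).
      + apply (g_D0 _ HC). unfold ile; apply D0_or; [apply D0_lt|apply D0_eq]; tm.
      + exact (g_comp _ HC (fun r => P (r O)) (fun r _ => r O) HP ltac:(intros; tm)).
    - exists x; split; [mlia|exact Hx].
    - intros i [y [Hi Hy]].
      destruct (classic (exists z, P z /\ y < z)) as [[z [Hz Hyz]]|Hz].
      + exists z; split; [mlia|exact Hz].
      + exfalso; apply Hn. exists y; split; [exact Hy|].
        intros z Pz. apply nlt_le. intros H; apply Hz; eauto. }
  destruct (G (a + 1)) as [y [Hy Py]]. specialize (Ha y Py). mlia.
Qed.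

(** Reflection at [x] turns a least element into a greatest one: the distance [i] with [y + i <= x]
    is maximised. *)
Lemma SB_least (P : M -> Prop) x : C (fun r => P (r O)) -> P x ->
  exists y, P y /\ forall z, P z -> y <= z.
Proof.
  intros HP Hx.
  destruct (SB_max (fun i => exists y, y + i <= x /\ P y) 0 x) as [i [[y [Hi Hy]] Hmax]].
  - apply (SB_ex B (fun y r => y + r O <= x /\ P y) HB). apply (g_and _ HC).
    + apply (g_D0 _ HC). unfold ile; apply D0_or; [apply D0_lt|apply D0_eq]; tm.
    + exact (g_comp _ HC (fun r => P (r O)) (fun r _ => r O) HP ltac:(intros; tm)).
  - exists x; split; [mlia|exact Hx].
  - intros i [y [Hy _]]; mlia.
  - exists y; split; [exact Hy|]. intros z Hz. apply nlt_le; intros Hzy.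
    assert (i + 1 <= i); [|mlia]. apply Hmax. exists z; split; [mlia|exact Hz].
Qed.

(** The dual of [SB_max], for a bounded set whose complement is in the class. If it has no greatest
    element, then [P] holds at the last [i] numbers up to [a], by induction on [i]; for [i = a + 1]
    this reaches [x]. *)
Lemma co_max (P : M -> Prop) x a : C (fun r => P (r O)) -> ~ P x -> (forall y, ~ P y -> y <= a) ->
  exists y, ~ P y /\ forall z, y < z -> P z.
Proof.
  intros HP Hx Ha. apply NNPP; intros Hn.
  assert (G : forall i y, y < a + 1 -> ~ a < y + i \/ P y).
  { apply (HI (fun i => forall y, y < a + 1 -> ~ a < y + i \/ P y)).
    - apply (g_ball _ HC (fun r => a + 1) (fun y r => ~ a < y + r O \/ P y)); [tm|].
      apply (g_or _ HC).
      + apply (g_D0 _ HC), D0_not, D0_lt; tm.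
      + exact (g_comp _ HC (fun r => P (r O)) (fun r _ => r O) HP ltac:(intros; tm)).
    - intros y Hy; left; intros H; mlia.
    - intros i IH y Hy.
      destruct (classic (a < y + i)) as [Hyi|Hyi].
      { destruct (IH y Hy) as [H|H]; [contradiction|now right]. }
      destruct (classic (a < y + (i + 1))) as [Hyi'|Hyi']; [right|now left].
      apply NNPP; intros Hp. apply Hn. exists y; split; [exact Hp|].
      intros z Hz. apply NNPP; intros Hpz. pose proof (Ha z Hpz) as Hza.
      destruct (IH z) as [H|H]; [mlia| |contradiction].
      apply H. mlia. }
  destruct (G (a + 1) x) as [H|H].
  - specialize (Ha x Hx); mlia.
  - apply H; mlia.
  - contradiction.
Qed.
End Extrema.
End Classes.

Definition S1 {A : structure} : ((nat -> dom A) -> Prop) -> Prop := SB D0.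

(** * Delta_1 predicates and functions *)

Section Delta1.
Context {A : structure} {HA : RCA A}.
Local Notation M := (dom A).
Local Notation env := (nat -> dom A).
Local Open Scope num_scope.
Add Ring num_ring : (@num_semi_ring A HA).

Lemma S1_ind : inductive_class (@S1 A).
Proof. intros P; apply S1_induction. Qed.

Lemma good_S1 : good (@S1 A).
Proof. apply good_SB; [apply good_D0|apply S1_ind]. Qed.

(** Delta_1 predicates, with parameters. In [Df] a function is presented by its graph, so that
    functions that are not given by terms, such as those defined by minimisation, can be used inside
    definitions. *)
Definition D (P : env -> Prop) : Prop := S1 P /\ S1 (fun r => ~ P r).
Definition Df (t : env -> M) : Prop := D (fun r => r O = t (fun i => r (S i))).

Lemma D_S1 P : D P -> S1 P.
Proof. now intros [H _]. Qed.

Lemma D_ext P Q : D P -> (forall r, P r <-> Q r) -> D Q.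
Proof.
  intros [H1 H2] H; split.
  - exact (SB_ext _ _ _ H1 H).
  - apply (SB_ext _ _ _ H2). intros r; specialize (H r); cbv beta; tauto.
Qed.

Lemma D_D0 P : D0 P -> D P.
Proof. intros H; split; apply (g_D0 _ good_S1); [|apply D0_not]; exact H. Qed.

Lemma D_const (P : Prop) : D (fun _ => P).
Proof. apply D_D0, D0_const. Qed.

Lemma D_not P : D P -> D (fun r => ~ P r).
Proof.
  intros [H1 H2]; split; [exact H2|]. eapply SB_ext; [apply H1|]. intros r; cbv beta.
  split; [tauto|apply NNPP].
Qed.

Lemma D_and P Q : D P -> D Q -> D (fun r => P r /\ Q r).
Proof.
  intros [H1 H2] [H3 H4]; split; [now apply (g_and _ good_S1)|].
  eapply SB_ext; [apply (g_or _ good_S1 _ _ H2 H4)|]. intros r; cbv beta; tauto.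
Qed.

Lemma D_or P Q : D P -> D Q -> D (fun r => P r \/ Q r).
Proof.
  intros HP HQ. eapply D_ext; [apply D_not, D_and; apply D_not; [apply HP|apply HQ]|].
  intros r; cbv beta; tauto.
Qed.

Lemma D_imp P Q : D P -> D Q -> D (fun r => P r -> Q r).
Proof.
  intros HP HQ. eapply D_ext; [apply D_or; [apply D_not, HP|apply HQ]|].
  intros r; cbv beta; tauto.
Qed.

Lemma D_iff P Q : D P -> D Q -> D (fun r => P r <-> Q r).
Proof. intros; apply D_and; now apply D_imp. Qed.

Lemma D_comp P (s : env -> env) : D P -> (forall i, Tm (fun r => s r i)) -> D (fun r => P (s r)).
Proof. intros [H1 H2] Hs; split; [apply (g_comp _ good_S1 P)|apply (g_comp _ good_S1 _ s H2)]; auto. Qed.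

Lemma Df_Tm t : Tm t -> Df t.
Proof.
  intros H; apply D_D0, (D0_eq (fun r => r O) (fun r => t (fun i => r (S i)))); [tm|].
  apply (Tm_comp t (fun r i => r (S i)) H); intros; tm.
Qed.

Lemma Df_comp t (s : env -> env) : Df t -> (forall i, Tm (fun r => s r i)) -> Df (fun r => t (s r)).
Proof.
  intros H Hs. exact (D_comp _ (fun r => scons (r O) (s (fun i => r (S i)))) H (Tm_scons _ Hs)).
Qed.

Lemma S1_ex (P : M -> env -> Prop) : S1 (fun r => P (r O) (fun i => r (S i))) -> S1 (fun r => exists x, P x r).
Proof. apply (SB_ex _ P good_D0). Qed.

Lemma S1_subst (t : env -> M) (P : M -> env -> Prop) : Df t -> S1 (fun r => P (r O) (fun i => r (S i))) -> S1 (fun r => P (t r) r).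
Proof.
  intros [Ht _] HP. apply SB_ext with (fun r => exists y, y = t r /\ P y r).
  - apply (S1_ex (fun y r => y = t r /\ P y r)), (g_and _ good_S1); [exact Ht|exact HP].
  - intros r; split; [intros [y [-> H]]; exact H|eauto].
Qed.

(** Naming the value of a total function costs one existential quantifier, for [P] and for its
    complement alike. *)
Lemma D_subst (t : env -> M) (P : M -> env -> Prop) : Df t -> D (fun r => P (r O) (fun i => r (S i))) -> D (fun r => P (t r) r).
Proof. intros Ht [H1 H2]; split; [now apply S1_subst|now apply (S1_subst t (fun x r => ~ P x r))]. Qed.

Lemma D_app1 (P : M -> Prop) t : D (fun r => P (r O)) -> Df t -> D (fun r => P (t r)).
Proof.
  intros HP Ht. apply (D_subst t (fun x _ => P x) Ht).
  exact (D_comp _ (fun r _ => r O) HP ltac:(intros; tm)).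
Qed.

Lemma D_app2 (P : M -> M -> Prop) t u :
  D (fun r => P (r O) (r 1%nat)) -> Df t -> Df u -> D (fun r => P (t r) (u r)).
Proof.
  intros HP Ht Hu. apply (D_subst t (fun x r => P x (u r)) Ht).
  apply (D_subst (fun r => u (fun i => r (S i))) (fun y r => P (r O) y)).
  - apply (Df_comp u (fun r i => r (S i)) Hu); intros; tm.
  - apply (D_comp _ (fun r i => match i with O => r 1%nat | _ => r O end) HP).
    intros [|i]; tm.
Qed.

Lemma D_app3 (P : M -> M -> M -> Prop) t u v :
  D (fun r => P (r O) (r 1%nat) (r 2%nat)) -> Df t -> Df u -> Df v -> D (fun r => P (t r) (u r) (v r)).
Proof.
  intros HP Ht Hu Hv. apply (D_subst t (fun x r => P x (u r) (v r)) Ht).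
  apply (D_subst (fun r => u (fun i => r (S i))) (fun y r => P (r O) y (v (fun i => r (S i))))).
  { apply (Df_comp u (fun r i => r (S i)) Hu); intros; tm. }
  apply (D_subst (fun r => v (fun i => r (S (S i)))) (fun y r => P (r 1%nat) (r O) y)).
  - apply (Df_comp v (fun r i => r (S (S i))) Hv); intros; tm.
  - apply (D_comp _ (fun r i => match i with O => r 2%nat | 1%nat => r 1%nat | _ => r O end) HP).
    intros [|[|i]]; tm.
Qed.

Lemma Df_tail t : Df t -> Df (fun r => t (fun i => r (S i))).
Proof. intros H; apply (Df_comp t (fun r i => r (S i)) H); intros; tm. Qed.

Lemma Df_app1 (f : M -> M) t : Df (fun r => f (r O)) -> Df t -> Df (fun r => f (t r)).
Proof.
  intros Hf Ht. apply (D_app2 (fun x y => x = f y) (fun r => r O) (fun r => t (fun i => r (S i)))).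
  - exact Hf.
  - apply Df_Tm; tm.
  - now apply Df_tail.
Qed.

Lemma Df_app2 (f : M -> M -> M) t u :
  Df (fun r => f (r O) (r 1%nat)) -> Df t -> Df u -> Df (fun r => f (t r) (u r)).
Proof.
  intros Hf Ht Hu.
  apply (D_app3 (fun x y z => x = f y z) (fun r => r O) (fun r => t (fun i => r (S i))) (fun r => u (fun i => r (S i)))).
  - exact Hf.
  - apply Df_Tm; tm.
  - now apply Df_tail.
  - now apply Df_tail.
Qed.

Lemma Df_var i : Df (fun r => r i).
Proof. apply Df_Tm; tm. Qed.

Lemma Df_cst c : Df (fun _ => c).
Proof. apply Df_Tm; tm. Qed.

Lemma Df_add (t u : env -> M) : Df t -> Df u -> Df (fun r => t r + u r).
Proof. apply (Df_app2 iadd), Df_Tm; tm. Qed.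

Lemma Df_mul (t u : env -> M) : Df t -> Df u -> Df (fun r => t r * u r).
Proof. apply (Df_app2 imul), Df_Tm; tm. Qed.

Lemma D_eq (t u : env -> M) : Df t -> Df u -> D (fun r => t r = u r).
Proof. apply (D_app2 eq), D_D0, (D0_eq (fun r => r O) (fun r => r 1%nat)); tm. Qed.

Lemma D_lt (t u : env -> M) : Df t -> Df u -> D (fun r => t r < u r).
Proof. apply (D_app2 ilt), D_D0, (D0_lt (fun r => r O) (fun r => r 1%nat)); tm. Qed.

Lemma D_le (t u : env -> M) : Df t -> Df u -> D (fun r => t r <= u r).
Proof. intros; apply D_or; [now apply D_lt|now apply D_eq]. Qed.

Lemma D_mem (t : env -> M) X : Df t -> D (fun r => t r ∈ X).
Proof. apply (D_app1 (fun x => x ∈ X)), D_D0, (D0_mem (fun r => r O)); tm. Qed.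

Lemma D_ball (t : env -> M) (P : M -> env -> Prop) : Df t -> D (fun r => P (r O) (fun i => r (S i))) ->
  D (fun r => forall x, x < t r -> P x r).
Proof.
  intros Ht HP. apply (D_subst t (fun y r => forall x, x < y -> P x r) Ht).
  assert (HP' : D (fun r => P (r O) (fun i => r (S (S i))))).
  { apply (D_comp _ (fun r => scons (r O) (fun i => r (S (S i)))) HP).
    intros [|i]; simpl; tm. }
  destruct HP' as [H1 H2]; split.
  - apply (g_ball _ good_S1 (fun r => r O) (fun x r => P x (fun i => r (S i)))); [tm|exact H1].
  - eapply SB_ext; [apply (g_bex _ good_S1 (fun r => r O) (fun x r => ~ P x (fun i => r (S i)))); [tm|exact H2]|].
    intros r; cbv beta; split; [firstorder|].
    intros H; apply NNPP; intros H'; apply H; intros x Hx; apply NNPP; eauto.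
Qed.

Lemma D_bex (t : env -> M) (P : M -> env -> Prop) : Df t -> D (fun r => P (r O) (fun i => r (S i))) ->
  D (fun r => exists x, x < t r /\ P x r).
Proof.
  intros Ht HP. eapply D_ext; [apply D_not, (D_ball t (fun x r => ~ P x r) Ht), D_not, HP|].
  intros r; cbv beta; split; [|firstorder].
  intros H; apply NNPP; intros H'; apply H; intros x Hx Hp; apply H'; eauto.
Qed.

Lemma D_ball_le (t : env -> M) (P : M -> env -> Prop) : Df t -> D (fun r => P (r O) (fun i => r (S i))) ->
  D (fun r => forall x, x <= t r -> P x r).
Proof.
  intros Ht HP. eapply D_ext; [apply (D_ball (fun r => t r + 1) P)|].
  - apply Df_add; [exact Ht|apply Df_cst].
  - exact HP.
  - intros r; cbv beta. split; intros H x Hx; apply H; mlia.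
Qed.

Lemma D_bex_le (t : env -> M) (P : M -> env -> Prop) : Df t -> D (fun r => P (r O) (fun i => r (S i))) ->
  D (fun r => exists x, x <= t r /\ P x r).
Proof.
  intros Ht HP. eapply D_ext; [apply (D_bex (fun r => t r + 1) P)|].
  - apply Df_add; [exact Ht|apply Df_cst].
  - exact HP.
  - intros r; cbv beta. split; intros [x [Hx H]]; exists x; (split; [mlia|exact H]).
Qed.

Lemma S1_and (P Q : env -> Prop) : S1 P -> S1 Q -> S1 (fun r => P r /\ Q r).
Proof. apply (g_and _ good_S1). Qed.

Lemma S1_or (P Q : env -> Prop) : S1 P -> S1 Q -> S1 (fun r => P r \/ Q r).
Proof. apply (g_or _ good_S1). Qed.

Lemma D_least (P : M -> Prop) x : D (fun r => P (r O)) -> P x ->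
  exists y, P y /\ forall z, z < y -> ~ P z.
Proof.
  intros [H _] Hx. destruct (SB_least D0 good_D0 S1_ind P x H Hx) as [y [Hy Hl]].
  exists y; split; [exact Hy|]. intros z Hz Hp. specialize (Hl z Hp). mlia.
Qed.

Lemma D_ind (P : M -> Prop) : D (fun r => P (r O)) -> P 0 -> (forall x, P x -> P (x + 1)) ->
  forall x, P x.
Proof. intros [H _]; now apply S1_ind. Qed.

(** The least element of [P], and 0 if there is none. *)
Definition mu (P : M -> Prop) : M :=
  epsilon (inhabits 0) (fun x => (P x /\ forall z, z < x -> ~ P z) \/ ((forall y, ~ P y) /\ x = 0)).

Lemma mu_spec (P : M -> Prop) x : D (fun r => P (r O)) -> P x ->
  P (mu P) /\ (forall z, z < mu P -> ~ P z) /\ mu P <= x.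
Proof.
  intros HP Hx. unfold mu.
  match goal with |- context [epsilon ?i ?Q] => pose proof (epsilon_spec i Q) as H; set (m := epsilon i Q) in * end.
  destruct H as [[H1 H2]|[H1 _]].
  - destruct (D_least P x HP Hx) as [y Hy]; exists y; now left.
  - split; [exact H1|split; [exact H2|]]. apply nlt_le; intros Hlt. exact (H2 _ Hlt Hx).
  - destruct (H1 x Hx).
Qed.

Lemma mu_none (P : M -> Prop) : (forall y, ~ P y) -> mu P = 0.
Proof.
  intros Hn. unfold mu.
  match goal with |- epsilon ?i ?Q = _ => pose proof (epsilon_spec i Q) as H; set (m := epsilon i Q) in * end.
  destruct H as [[H1 _]|[_ H]]; [exists 0; right; auto|destruct (Hn _ H1)|exact H].
Qed.

Lemma D_section (P : M -> env -> Prop) r : D (fun r => P (r O) (fun i => r (S i))) ->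
  D (fun e => P (e O) r).
Proof.
  intros H. apply (D_comp _ (fun e => scons (e O) r) H). intros [|i]; simpl; tm.
Qed.

(** Totality rules out the default value of [mu], so the graph says only that [P] holds here and
    nowhere below. *)
Lemma Df_mu_total (P : M -> env -> Prop) :
  D (fun r => P (r O) (fun i => r (S i))) -> (forall r, exists x, P x r) ->
  Df (fun r => mu (fun x => P x r)).
Proof.
  intros HP Ht.
  assert (HP' : D (fun r => P (r O) (fun i => r (S (S i))))).
  { apply (D_comp _ (fun r => scons (r O) (fun i => r (S (S i)))) HP). intros [|i]; simpl; tm. }
  eapply D_ext.
  - apply (D_and _ (fun r => forall z, z < r O -> ~ P z (fun i => r (S i))) HP).
    apply (D_ball (fun r => r O) (fun z r => ~ P z (fun i => r (S i)))); [apply Df_var|apply D_not, HP'].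
  - intros r; cbv beta. set (e := fun i => r (S i)).
    destruct (Ht e) as [x Hx].
    destruct (mu_spec (fun x => P x e) x (D_section P e HP) Hx) as [H1 [H2 _]].
    split.
    + intros [H3 H4]. destruct (lt_total (r O) (mu (fun x => P x e))) as [H|[H|H]]; [|exact H|].
      * destruct (H2 _ H H3).
      * destruct (H4 _ H H1).
    + intros ->; auto.
Qed.

(** The bound [t] makes the absence of a witness a bounded statement, so that the default value 0
    keeps the graph Delta_1. *)
Lemma Df_mu (P : M -> env -> Prop) t :
  D (fun r => P (r O) (fun i => r (S i))) -> Df t -> (forall r x, P x r -> x < t r) ->
  Df (fun r => mu (fun x => P x r)).
Proof.
  intros HP Ht Hb.
  assert (HP' : D (fun r => P (r O) (fun i => r (S (S i))))).
  { apply (D_comp _ (fun r => scons (r O) (fun i => r (S (S i)))) HP). intros [|i]; simpl; tm. }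
  eapply D_ext.
  - apply D_or; apply D_and.
    + exact HP.
    + apply (D_ball (fun r => r O) (fun z r => ~ P z (fun i => r (S i)))); [apply Df_var|apply D_not, HP'].
    + apply (D_ball (fun r => t (fun i => r (S i))) (fun z r => ~ P z (fun i => r (S i)))).
      * now apply Df_tail.
      * apply D_not, HP'.
    + apply (D_eq (fun r => r O) (fun _ => 0)); [apply Df_var|apply Df_cst].
  - intros r; cbv beta. set (e := fun i => r (S i)). split.
    + intros [[H3 H4]|[H3 H4]].
      * destruct (mu_spec (fun x => P x e) (r O) (D_section P e HP) H3) as [H1 [H2 H5]].
        destruct H5 as [H5|H5]; [|congruence]. destruct (H4 _ H5 H1).
      * rewrite mu_none; [exact H4|]. intros y Hy; exact (H3 y (Hb _ _ Hy) Hy).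
    + intros ->. destruct (classic (exists x, P x e)) as [[x Hx]|Hn].
      * left. destruct (mu_spec (fun x => P x e) x (D_section P e HP) Hx) as [H1 [H2 H5]]; auto.
      * right. split; [intros y _ Hy; eauto|]. apply mu_none; intros y Hy; eauto.
Qed.
End Delta1.

(** * Codes of finite sets and sequences *)

Ltac def_user := fail.
Ltac def1 :=
  match goal with
  | |- D (fun _ => ?P) => apply (D_const P)
  | |- D (fun r => _ /\ _) => apply D_and
  | |- D (fun r => _ \/ _) => apply D_or
  | |- D (fun r => ~ _) => apply D_not
  | |- D (fun r => _ <-> _) => apply D_iff
  | |- D (fun r => forall x, ilt x _ -> _) => apply D_ball
  | |- D (fun r => forall x, ile x _ -> _) => apply D_ball_le
  | |- D (fun r => exists x, ilt x _ /\ _) => apply D_bex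
  | |- D (fun r => exists x, ile x _ /\ _) => apply D_bex_le
  | |- D (fun r => _ -> _) => apply D_imp
  | |- D (fun r => _ = _) => apply D_eq
  | |- D (fun r => ilt _ _) => apply D_lt
  | |- D (fun r => ile _ _) => apply D_le
  | |- D (fun r => imem _ _) => apply D_mem
  | |- Df (fun r => r _) => apply Df_var
  | |- Df (fun _ => ?c) => apply (Df_cst c)
  | |- Df (fun r => iadd _ _) => apply Df_add
  | |- Df (fun r => imul _ _) => apply Df_mul
  | H : D (fun r => ?P (r O)) |- D (fun r => ?P _) => apply (D_app1 P _ H)
  | H : D (fun r => ?P (r O) (r 1)) |- D (fun r => ?P _ _) => apply (D_app2 P _ _ H)
  | H : D (fun r => ?P (r O) (r 1) (r 2)) |- D (fun r => ?P _ _ _) => apply (D_app3 P _ _ _ H)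
  | H : Df (fun r => ?f (r O)) |- Df (fun r => ?f _) => apply (Df_app1 f _ H)
  | H : Df (fun r => ?f (r O) (r 1)) |- Df (fun r => ?f _ _) => apply (Df_app2 f _ _ H)
  | _ => def_user
  end.
Ltac def := repeat def1.

Section Coding.
Context {A : structure} {HA : RCA A}.
Local Notation M := (dom A).
Local Notation env := (nat -> dom A).
Local Open Scope num_scope.
Add Ring num_ring : (@num_semi_ring A HA).

(** This and the following notions are spelled exactly as [sat] unfolds their syntactic
    counterparts, so that the principles agree with the sentences by conversion. *)
Definition cpair (i j : M) : M := (i + j) * (i + j) + i.
Definition triple (c : M) : Prop := exists k m n, c = cpair k (cpair m n).
Definition elt (i c : M) : Prop :=
  exists k m n, c = cpair k (cpair m n) /\ i < k /\ exists q, n = q * (m * (i + 1) + 1).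
Definition fset (c : M) : Prop :=
  triple c /\ forall d, d < c -> triple d -> ~ (forall i, elt i d <-> elt i c).
Definition has_len (s l : M) : Prop := forall i, i < l <-> exists j, elt (cpair i j) s.
Definition fseq (s : M) : Prop :=
  fset s /\
  (forall x, elt x s -> exists i j, x = cpair i j) /\
  (forall i j k, elt (cpair i j) s -> elt (cpair i k) s -> j = k) /\
  (exists l, has_len s l).

Lemma le_lt_trans (x y z : M) : x <= y -> y < z -> x < z.
Proof. intros; mlia. Qed.

Lemma zero_or_pos (x : M) : x = 0 \/ 1 <= x.
Proof. destruct (lt_total x 0) as [H|[H|H]]; [destruct (nlt_0 _ H)|now left|right; mlia]. Qed.

Lemma le_square (x : M) : x <= x * x.
Proof.
  destruct (zero_or_pos x) as [->|H]; [mlia|].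
  pose proof (mul_le_mono_l 1 x x H). mlia.
Qed.

Lemma le_mul_r (x y : M) : 1 <= y -> x <= x * y.
Proof. intros H; pose proof (mul_le_mono_l 1 y x H); mlia. Qed.

Lemma cpair_ge_sum (i j : M) : i + j <= cpair i j.
Proof. unfold cpair; pose proof (le_square (i + j)); mlia. Qed.

Lemma cpair_ge_l (i j : M) : i <= cpair i j.
Proof. pose proof (cpair_ge_sum i j); mlia. Qed.

Lemma cpair_ge_r (i j : M) : j <= cpair i j.
Proof. pose proof (cpair_ge_sum i j); mlia. Qed.

Lemma cpair_mono (i j i' j' : M) : i <= i' -> j <= j' -> cpair i j <= cpair i' j'.
Proof.
  intros H H'. unfold cpair.
  assert (Hs : i + j <= i' + j') by mlia.
  pose proof (mul_le_mono_l _ _ (i + j) Hs). pose proof (mul_le_mono_l _ _ (i' + j') Hs).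
  mlia.
Qed.

(** From one diagonal to the next the square of [i + j] grows by more than [i], so the code
    determines first [i + j] and then [i]. *)
Lemma cpair_inj (i j i' j' : M) : cpair i j = cpair i' j' -> i = i' /\ j = j'.
Proof.
  assert (G : forall i j i' j' : M, i + j < i' + j' -> cpair i j < cpair i' j').
  { intros a b c d H. unfold cpair. apply lt_succ_le in H.
    pose proof (mul_le_mono_l _ _ (a + b + 1) H). pose proof (mul_le_mono_l _ _ (c + d) H). mlia. }
  intros H. destruct (lt_total (i + j) (i' + j')) as [H1|[H1|H1]].
  - apply G in H1; rewrite H in H1; destruct (lt_irrefl _ H1).
  - unfold cpair in H. rewrite H1 in H. assert (i = i') by mlia. split; mlia.
  - apply G in H1; rewrite H in H1; destruct (lt_irrefl _ H1).
Qed.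

Lemma Df_cpair (t u : env -> M) : Df t -> Df u -> Df (fun r => cpair (t r) (u r)).
Proof. intros; unfold cpair; def; assumption. Qed.

Ltac def_user ::= apply Df_cpair.

Definition dvd (x y : M) : Prop := exists q, y = q * x.

Lemma dvd_bounded (x y : M) : dvd x y <-> exists q, q <= y /\ y = q * x.
Proof.
  split; [|intros [q [_ H]]; now exists q].
  intros [q ->]. destruct (zero_or_pos x) as [->|H].
  - exists 0; split; [mlia|ring].
  - exists q; split; [now apply le_mul_r|reflexivity].
Qed.

Lemma D_dvd (t u : env -> M) : Df t -> Df u -> D (fun r => dvd (t r) (u r)).
Proof.
  intros Ht Hu. apply (D_app2 dvd); auto.
  eapply D_ext; [|intros r; symmetry; apply dvd_bounded]. cbv beta. def.
Qed.

Lemma D_triple (t : env -> M) : Df t -> D (fun r => triple (t r)).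
Proof.
  apply (D_app1 triple).
  apply D_ext with (fun r => exists k, k <= r O /\ exists m, m <= r O /\ exists n, n <= r O /\
    r O = cpair k (cpair m n)); [def|].
  intros r; split.
  - intros [k [_ [m [_ [n [_ H]]]]]]; exists k, m, n; exact H.
  - intros [k [m [n H]]]; rewrite H.
    pose proof (cpair_ge_l k (cpair m n)). pose proof (cpair_ge_r k (cpair m n)).
    pose proof (cpair_ge_l m n). pose proof (cpair_ge_r m n).
    exists k; split; [assumption|]. exists m; split; [mlia|]. exists n; split; [mlia|reflexivity].
Qed.

Lemma D_elt (t u : env -> M) : Df t -> Df u -> D (fun r => elt (t r) (u r)).
Proof.
  apply (D_app2 elt).
  apply D_ext with (fun r => exists k, k <= r 1%nat /\ exists m, m <= r 1%nat /\ exists n, n <= r 1%nat /\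
    (r 1%nat = cpair k (cpair m n) /\ r O < k /\ dvd (m * (r O + 1) + 1) n)).
  { def. apply D_dvd; def. }
  intros r; split.
  - intros [k [_ [m [_ [n [_ H]]]]]]; exists k, m, n; exact H.
  - intros [k [m [n [H H']]]]; rewrite H.
    pose proof (cpair_ge_l k (cpair m n)). pose proof (cpair_ge_r k (cpair m n)).
    pose proof (cpair_ge_l m n). pose proof (cpair_ge_r m n).
    exists k; split; [assumption|]. exists m; split; [mlia|]. exists n; split; [mlia|auto].
Qed.

Lemma elt_lt (i c : M) : elt i c -> i < c.
Proof. intros [k [m [n [-> [H _]]]]]. pose proof (cpair_ge_l k (cpair m n)). mlia. Qed.

Ltac def_user ::= first [apply Df_cpair | apply D_elt | apply D_dvd | apply D_triple].

Lemma le_sub (x y : M) : x <= y -> exists d, y = x + d.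
Proof.
  intros H.
  assert (G : forall c, x <= c -> exists d, d <= c /\ c = x + d).
  { apply (D_ind (fun c => x <= c -> exists d, d <= c /\ c = x + d)); [def| |].
    - intros H0. exists 0; split; mlia.
    - intros c IH Hc. destruct Hc as [Hc| <-].
      + apply lt_succ, IH in Hc. destruct Hc as [d [H1 H2]]. exists (d + 1); split; mlia.
      + exists 0; split; mlia. }
  destruct (G y H) as [d [_ Hd]]; eauto.
Qed.

Lemma dvd_mul_r (x y z : M) : dvd x y -> dvd x (y * z).
Proof. intros [q ->]; exists (q * z); ring. Qed.

Lemma dvd_sub (x y z : M) : dvd x (y + z) -> dvd x z -> dvd x y.
Proof.
  intros [a Ha] [b Hb]. destruct (zero_or_pos x) as [->|Hx].
  { exists 0. assert (y <= y + z) by mlia. rewrite Ha in H. mlia. }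
  destruct (lt_total a b) as [H|H].
  - exfalso. apply lt_succ_le in H. pose proof (mul_le_mono_l _ _ x H). mlia.
  - destruct (le_sub b a) as [d ->]; [destruct H; mlia|]. exists d. mlia.
Qed.

(** The moduli [m * (i + 1) + 1] of Goedel's beta function satisfy explicit Bezout
    identities, the difference of their indices being a divisor of [m]. *)
Lemma moduli_coprime (k m i j z : M) :
  (forall d, 1 <= d -> d <= k -> dvd d m) -> i < k -> j < k -> i <> j ->
  dvd (m * (i + 1) + 1) ((m * (j + 1) + 1) * z) -> dvd (m * (i + 1) + 1) z.
Proof.
  intros Hm Hi Hj Hij H. destruct (lt_total i j) as [Hlt|[Heq|Hlt]]; [|contradiction|].
  - destruct (le_sub (i + 1) j) as [d Hd]; [mlia|].
    destruct (Hm (d + 1)) as [q Hq]; [mlia|mlia|]. subst j.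
    apply dvd_sub with ((i + 1) * q * (i + 1 + d + 1) * (m * (i + 1) + 1) * z).
    + replace (z + _) with ((m * (i + 1) + 1) * z + (i + 1) * (i + 1) * q * ((m * (i + 1 + d + 1) + 1) * z))
        by (subst m; ring).
      destruct H as [b ->]. exists (z + (i + 1) * (i + 1) * q * b). ring.
    + exists ((i + 1) * q * (i + 1 + d + 1) * z). ring.
  - destruct (le_sub (j + 1) i) as [d Hd]; [mlia|].
    destruct (Hm (d + 1)) as [q Hq]; [mlia|mlia|]. subst i.
    apply dvd_sub with (q * (j + 1 + d + 1) * (j + 1 + d + 1) * ((m * (j + 1) + 1) * z)).
    + exists ((1 + q * (j + 1) * (j + 1 + d + 1)) * z). subst m. ring.
    + destruct H as [b ->]. exists (q * (j + 1 + d + 1) * (j + 1 + d + 1) * b). ring.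
Qed.

(** The induction produces the factorial of [k]. *)
Lemma common_multiple (k : M) : exists m, 1 <= m /\ forall d, 1 <= d -> d <= k -> dvd d m.
Proof.
  apply (S1_ind (fun k => exists m, 1 <= m /\ forall d, 1 <= d -> d <= k -> dvd d m)).
  - apply (S1_ex (fun m r => 1 <= m /\ forall d, 1 <= d -> d <= r O -> dvd d m)), D_S1.
    apply D_ext with (fun r => 1 <= r O /\ forall d, d <= r 1%nat -> 1 <= d -> dvd d (r O)); [def|].
    intros r; split; intros [H1 H2]; split; auto.
  - exists 1; split; [mlia|]. intros d H1 H2; mlia.
  - intros x [m [Hm H]]. exists (m * (x + 1)); split.
    + pose proof (le_mul_r m (x + 1) ltac:(mlia)). mlia.
    + intros d H1 H2. destruct H2 as [H2| ->].
      * apply dvd_mul_r, H; [exact H1|]. apply lt_succ, H2.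
      * exists m; reflexivity.
Qed.

(** The bound is independent of [P]: the product [n] of the moduli of the elements
    of [P] divides the product [N] of all moduli below [k]. *)
Lemma moduli_product (k m : M) : 1 <= m -> (forall d, 1 <= d -> d <= k -> dvd d m) ->
  exists N, forall P, D (fun r => P (r O)) ->
    exists n, n <= N /\ forall i, i < k -> dvd (m * (i + 1) + 1) n <-> P i.
Proof.
  intros Hm1 Hm.
  assert (Hone : forall i, ~ dvd (m * (i + 1) + 1) 1).
  { intros i [q Hq]. destruct (zero_or_pos q) as [->|Hq1]; [mlia|].
    pose proof (le_mul_r (m * (i + 1) + 1) q Hq1). pose proof (le_mul_r m (i + 1) ltac:(mlia)). mlia. }
  assert (Hstep : forall l P n, l < k ->
    (forall i, i < k -> dvd (m * (i + 1) + 1) n <-> i < l /\ P i) -> P l ->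
    (forall i, i < k -> dvd (m * (i + 1) + 1) (n * (m * (l + 1) + 1)) <-> i < l + 1 /\ P i)).
  { intros l P n Hl Hn Hpl i Hi. split.
    - intros H. destruct (lt_total i l) as [H1|[->|H1]].
      + rewrite (mul_comm n) in H. apply moduli_coprime with (k := k) in H; auto; [|intros ->; now apply lt_irrefl in H1].
        apply Hn in H; auto. destruct H; split; [mlia|assumption].
      + split; [mlia|exact Hpl].
      + rewrite (mul_comm n) in H. apply moduli_coprime with (k := k) in H; auto; [|intros ->; now apply lt_irrefl in H1].
        apply Hn in H; auto. destruct H; mlia.
    - intros [H1 H2]. apply lt_succ in H1; destruct H1 as [H1| ->].
      + apply dvd_mul_r, Hn; auto.
      + exists n; reflexivity. }
  assert (HN : exists N, 1 <= N /\ forall i, i < k -> dvd (m * (i + 1) + 1) N).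
  { assert (G : forall l, l <= k -> exists n, 1 <= n /\ forall i, i < k -> dvd (m * (i + 1) + 1) n <-> i < l).
    { apply (S1_ind (fun l => l <= k -> exists n, 1 <= n /\ forall i, i < k -> dvd (m * (i + 1) + 1) n <-> i < l)).
      - eapply SB_ext; [apply (S1_ex (fun n r => r O <= k -> 1 <= n /\ forall i, i < k -> dvd (m * (i + 1) + 1) n <-> i < r O))|].
        + apply D_S1. def.
        + intros r; cbv beta; split.
          * intros [n H] Hr; exists n; auto.
          * intros H. destruct (classic (r O <= k)) as [Hr|Hr]; [|exists 0; tauto].
            destruct (H Hr) as [n Hn]; eauto.
      - intros _; exists 1; split; [apply le_refl|]. intros i _; split; [intros H; destruct (Hone i H)|intros H; destruct (nlt_0 _ H)].
      - intros l IH Hl. destruct IH as [n [Hn1 Hn]]; [mlia|].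
        exists (n * (m * (l + 1) + 1)); split; [apply le_trans with n; [exact Hn1|apply le_mul_r; mlia]|].
        intros i Hi. rewrite (Hstep l (fun _ => True) n); auto; [tauto|mlia|].
        intros; rewrite Hn; tauto. }
    destruct (G k (le_refl k)) as [N [HN1 HN]]; exists N; split; [exact HN1|].
    intros i Hi; apply HN; auto. }
  destruct HN as [N [HN1 HN]]. exists N. intros P HP.
  (* The cofactor [u], still divisible by the moduli not yet treated, keeps [n] a divisor of [N].
     Both are thus bounded by [N], and the induction is on a Delta_1 statement. *)
  assert (G : forall l, l <= k -> exists n, n <= N /\ (1 <= n /\ exists u, u <= N /\ (N = n * u /\
    (forall i, i < k -> l <= i -> dvd (m * (i + 1) + 1) u) /\
    (forall i, i < k -> dvd (m * (i + 1) + 1) n <-> i < l /\ P i)))).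
  { apply (D_ind (fun l => l <= k -> exists n, n <= N /\ (1 <= n /\ exists u, u <= N /\ (N = n * u /\
    (forall i, i < k -> l <= i -> dvd (m * (i + 1) + 1) u) /\
    (forall i, i < k -> dvd (m * (i + 1) + 1) n <-> i < l /\ P i))))); [def| |].
    - intros _. exists 1; split; [exact HN1|split; [apply le_refl|]]. exists N; split; [apply le_refl|].
      split; [ring|split; [auto|]]. intros i _; split; [intros H; destruct (Hone i H)|intros [H _]; destruct (nlt_0 _ H)].
    - intros l IH Hl. destruct IH as [n [_ [Hn1 [u [_ [HNu [Hu Hn]]]]]]]; [mlia|].
      assert (Hdiv : forall x y, N = x * y -> x <= N /\ y <= N).
      { intros x y E. assert (1 <= x /\ 1 <= y) as [H1 H2].
        { split; [destruct (zero_or_pos x) as [->|]|destruct (zero_or_pos y) as [->|]]; auto; mlia. }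
        rewrite E; split; [now apply le_mul_r|rewrite mul_comm; now apply le_mul_r]. }
      destruct (classic (P l)) as [Hpl|Hpl].
      + destruct (Hu l) as [v Hv]; [mlia|mlia|].
        assert (E : N = n * (m * (l + 1) + 1) * v) by (rewrite HNu, Hv; ring).
        exists (n * (m * (l + 1) + 1)); split; [apply (Hdiv _ _ E)|split].
        { apply le_trans with n; [exact Hn1|apply le_mul_r; mlia]. }
        exists v; split; [apply (Hdiv _ _ E)|split; [exact E|split]].
        * intros i Hi Hli. apply moduli_coprime with (k := k) (j := l); auto; [mlia|intros ->; mlia|].
          rewrite (mul_comm _ v), <- Hv. apply Hu; [exact Hi|mlia].
        * apply Hstep; auto. mlia.
      + exists n; split; [apply (Hdiv _ _ HNu)|split; [exact Hn1|]].
        exists u; split; [apply (Hdiv _ _ HNu)|split; [exact HNu|split]].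
        * intros i Hi Hli. apply Hu; [exact Hi|mlia].
        * intros i Hi. rewrite Hn by exact Hi. split.
          -- intros [H1 H2]; split; [mlia|exact H2].
          -- intros [H1 H2]; split; [|exact H2]. apply lt_succ in H1. destruct H1 as [H1| ->]; [exact H1|contradiction]. }
  destruct (G k (le_refl k)) as [n [Hn [_ [u [_ [_ [_ H]]]]]]].
  exists n; split; [exact Hn|]. intros i Hi; rewrite H by exact Hi; tauto.
Qed.

Lemma elt_cpair (i k m n : M) :
  elt i (cpair k (cpair m n)) <-> i < k /\ dvd (m * (i + 1) + 1) n.
Proof.
  split.
  - intros [k' [m' [n' [E [H1 H2]]]]]. apply cpair_inj in E; destruct E as [-> E].
    apply cpair_inj in E; destruct E as [-> ->]. auto.
  - intros [H1 H2]; exists k, m, n; auto.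
Qed.

(** The bound [b] is independent of [P], so that later inductions can quantify over all finite sets
    below [k] by a bounded quantifier. *)
Lemma fset_comprehension (k : M) : exists b, forall P, D (fun r => P (r O)) ->
  exists c, c < b /\ fset c /\ forall i, elt i c <-> i < k /\ P i.
Proof.
  destruct (common_multiple k) as [m [Hm1 Hm]].
  destruct (moduli_product k m Hm1 Hm) as [N HN].
  exists (cpair k (cpair m N) + 1). intros P HP.
  destruct (HN P HP) as [n [Hn Hd]].
  (* At and beyond [c + k] neither side can hold, so the comparison may be bounded; the search for
     the least code is then Delta_1. *)
  assert (HD : D (fun r => triple (r O) /\ forall i, i < r O + k -> elt i (r O) <-> i < k /\ P i)) by def.
  assert (HE : forall c, (forall i, i < c + k -> elt i c <-> i < k /\ P i) <-> (forall i, elt i c <-> i < k /\ P i)).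
  { intros c; split; [|auto]. intros H i. destruct (classic (i < c + k)) as [Hi|Hi]; [auto|].
    split; [intros H1; apply elt_lt in H1; mlia|intros [H1 _]; mlia]. }
  destruct (D_least (fun c => triple c /\ forall i, i < c + k -> elt i c <-> i < k /\ P i)
              (cpair k (cpair m n)) HD) as [c [[Hc Hc'] Hl]].
  - split; [now exists k, m, n|]. intros i _; rewrite elt_cpair. split.
    + intros [H1 H2]; split; [exact H1|]. now apply Hd.
    + intros [H1 H2]; split; [exact H1|]. now apply Hd.
  - exists c. rewrite HE in Hc'. split; [|split; [split; [exact Hc|]|exact Hc']].
    + apply lt_succ, nlt_le. intros H. apply (Hl (cpair k (cpair m n))).
      * eapply le_lt_trans; [|exact H]. apply cpair_mono; [apply le_refl|].
        apply cpair_mono; [apply le_refl|exact Hn].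
      * split; [now exists k, m, n|]. intros i _; rewrite elt_cpair. split.
        -- intros [H1 H2]; split; [exact H1|]. now apply Hd.
        -- intros [H1 H2]; split; [exact H1|]. now apply Hd.
    + intros d Hd1 Hd2 Hsame. apply (Hl d Hd1). split; [exact Hd2|]. rewrite HE.
      intros i; rewrite Hsame; apply Hc'.
Qed.

Lemma fset_ext (c d : M) : fset c -> fset d -> (forall i, elt i c <-> elt i d) -> c = d.
Proof.
  intros [Hc1 Hc2] [Hd1 Hd2] H. destruct (lt_total c d) as [H1|[H1|H1]]; [|exact H1|].
  - destruct (Hd2 c H1 Hc1 H).
  - destruct (Hc2 d H1 Hd1). intros i; now rewrite H.
Qed.
End Coding.

Ltac def_user ::= first [apply Df_cpair | apply D_elt | apply D_dvd | apply D_triple].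

(** * Finite sequences *)

Section Sequences.
Context {A : structure} {HA : RCA A}.
Local Notation M := (dom A).
Local Notation env := (nat -> dom A).
Local Open Scope num_scope.
Add Ring num_ring : (@num_semi_ring A HA).

Lemma D_fset (t : env -> M) : Df t -> D (fun r => fset (t r)).
Proof.
  apply (D_app1 fset).
  apply D_ext with (fun r => triple (r O) /\ forall d, d < r O -> triple d ->
    ~ (forall i, i < r O -> elt i d <-> elt i (r O))); [def|].
  intros r; split; intros [H1 H2]; split; auto; intros d Hd Ht H; apply (H2 d Hd Ht); auto.
  intros i. destruct (classic (i < r O)) as [Hi|Hi]; [auto|].
  split; intros Hm; apply elt_lt in Hm; mlia.
Qed.

Lemma elt_cpair_lt (i j s : M) : elt (cpair i j) s -> i < s /\ j < s.
Proof.
  intros H; apply elt_lt in H; pose proof (cpair_ge_l i j); pose proof (cpair_ge_r i j). split; mlia.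
Qed.

Lemma has_len_le (s l : M) : has_len s l -> l <= s.
Proof.
  intros H. apply nlt_le; intros Hs. apply H in Hs. destruct Hs as [j Hj].
  apply elt_cpair_lt in Hj; mlia.
Qed.

Lemma has_len_unique (s l l' : M) : has_len s l -> has_len s l' -> l = l'.
Proof.
  intros H H'. destruct (lt_total l l') as [Hl|[Hl|Hl]]; [|exact Hl|].
  - apply H', H in Hl. destruct (lt_irrefl _ Hl).
  - apply H, H' in Hl. destruct (lt_irrefl _ Hl).
Qed.

Lemma D_has_len (t u : env -> M) : Df t -> Df u -> D (fun r => has_len (t r) (u r)).
Proof.
  apply (D_app2 has_len).
  apply D_ext with (fun r => (forall i, i < r 1%nat -> exists j, j < r O /\ elt (cpair i j) (r O)) /\
    forall i, i < r O -> (exists j, j < r O /\ elt (cpair i j) (r O)) -> i < r 1%nat); [def|].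
  intros r; split.
  - intros [H1 H2] i; split.
    + intros Hi; destruct (H1 i Hi) as [j [_ Hj]]; eauto.
    + intros [j Hj]. destruct (elt_cpair_lt _ _ _ Hj). apply H2; eauto.
  - intros H; split; intros i Hi.
    + apply H in Hi. destruct Hi as [j Hj]. destruct (elt_cpair_lt _ _ _ Hj). eauto.
    + intros [j [_ Hj]]. apply H; eauto.
Qed.

Lemma D_fseq (t : env -> M) : Df t -> D (fun r => fseq (t r)).
Proof.
  apply (D_app1 fseq).
  apply D_ext with (fun r => fset (r O) /\
    ((forall x, x < r O -> elt x (r O) -> exists i, i <= x /\ exists j, j <= x /\ x = cpair i j) /\
    ((forall i, i < r O -> forall j, j < r O -> forall k, k < r O ->
      elt (cpair i j) (r O) -> elt (cpair i k) (r O) -> j = k) /\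
    (exists l, l <= r O /\ has_len (r O) l)))).
  { apply D_and; [apply D_fset; def|]. apply D_and; [def|]. apply D_and; [def|].
    apply D_bex_le; [def|]. apply D_has_len; def. }
  intros r; split.
  - intros [H1 [H2 [H3 [l [_ H4]]]]]. split; [exact H1|split; [|split; [|eauto]]].
    + intros x Hx. destruct (H2 x (elt_lt _ _ Hx) Hx) as [i [_ [j [_ H]]]]; eauto.
    + intros i j k Hj Hk. destruct (elt_cpair_lt _ _ _ Hj), (elt_cpair_lt _ _ _ Hk).
      apply (H3 i); assumption.
  - intros [H1 [H2 [H3 [l H4]]]]. split; [exact H1|split; [|split]].
    + intros x _ Hx. destruct (H2 x Hx) as [i [j ->]].
      exists i; split; [apply cpair_ge_l|]. exists j; split; [apply cpair_ge_r|reflexivity].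
    + intros i _ j _ k _ Hj Hk; exact (H3 i j k Hj Hk).
    + exists l; split; [now apply has_len_le|exact H4].
Qed.

Definition len (s : M) : M := mu (fun l => has_len s l).
Definition nth (s i : M) : M := mu (fun x => elt (cpair i x) s).

Lemma Df_len (t : env -> M) : Df t -> Df (fun r => len (t r)).
Proof.
  apply (Df_app1 len). apply (Df_mu (fun l r => has_len (r O) l) (fun r => r O + 1)).
  - apply D_has_len; def.
  - def.
  - intros r l H. apply has_len_le in H. mlia.
Qed.

Lemma Df_nth (t u : env -> M) : Df t -> Df u -> Df (fun r => nth (t r) (u r)).
Proof.
  apply (Df_app2 nth). apply (Df_mu (fun x r => elt (cpair (r 1%nat) x) (r O)) (fun r => r O)).
  - def.
  - def.
  - intros r x H. now apply elt_cpair_lt in H.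
Qed.

Lemma len_eq (s l : M) : has_len s l -> len s = l.
Proof.
  intros H. apply (has_len_unique s); [|exact H].
  apply (mu_spec (fun l => has_len s l) l); [apply D_has_len; def|exact H].
Qed.

Lemma fseq_has_len (s : M) : fseq s -> has_len s (len s).
Proof. intros [_ [_ [_ [l H]]]]. now rewrite (len_eq s l H). Qed.

Lemma elt_nth (s i : M) : fseq s -> i < len s -> elt (cpair i (nth s i)) s.
Proof.
  intros Hs Hi. apply (fseq_has_len s Hs) in Hi. destruct Hi as [x Hx].
  apply (mu_spec (fun x => elt (cpair i x) s) x); [def|exact Hx].
Qed.

Lemma elt_cpair_nth (s i x : M) : fseq s -> elt (cpair i x) s <-> i < len s /\ x = nth s i.
Proof.
  intros Hs; split.
  - intros Hx. assert (Hi : i < len s) by (apply (fseq_has_len s Hs); eauto).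
    split; [exact Hi|]. pose proof (elt_nth s i Hs Hi). destruct Hs as [_ [_ [Hf _]]].
    exact (Hf _ _ _ Hx H).
  - intros [Hi ->]. now apply elt_nth.
Qed.

Lemma elt_fseq (s x : M) : fseq s -> elt x s <-> exists i, i < len s /\ x = cpair i (nth s i).
Proof.
  intros Hs; split.
  - intros Hx. destruct Hs as [H1 [H2 H3]]. destruct (H2 x Hx) as [i [j ->]].
    assert (Hs : fseq s) by (split; auto). apply elt_cpair_nth in Hx; [|exact Hs].
    destruct Hx as [Hi ->]; eauto.
  - intros [i [Hi ->]]. now apply elt_nth.
Qed.

Lemma len_le (s : M) : fseq s -> len s <= s.
Proof. intros Hs. now apply has_len_le, fseq_has_len. Qed.

Lemma fseq_ext (s t : M) : fseq s -> fseq t -> len s = len t ->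
  (forall i, i < len s -> nth s i = nth t i) -> s = t.
Proof.
  intros Hs Ht Hl Hn. apply fset_ext; [apply Hs|apply Ht|].
  intros x; rewrite !elt_fseq by assumption. rewrite <- Hl.
  split; intros [i [Hi ->]]; exists i; rewrite Hn; auto.
Qed.

Definition mkseq (l : M) (f : M -> M) : M :=
  mu (fun s => fseq s /\ len s = l /\ forall i, i < l -> nth s i = f i).
End Sequences.

Ltac def_user ::= first [apply Df_cpair | apply D_elt | apply D_dvd | apply D_triple
  | apply D_fset | apply D_has_len | apply D_fseq | apply Df_len | apply Df_nth ].

Section Sequences.
Context {A : structure} {HA : RCA A}.
Local Notation M := (dom A).
Local Notation env := (nat -> dom A).
Local Open Scope num_scope.
Add Ring num_ring : (@num_semi_ring A HA).

Lemma D_mkseq (f : M -> M) l : Df (fun r => f (r O)) ->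
  D (fun r => fseq (r O) /\ len (r O) = l /\ forall i, i < l -> nth (r O) i = f i).
Proof. intros Hf; def. Qed.

Lemma bounded_values (f : M -> M) l : Df (fun r => f (r O)) -> exists b, forall i, i < l -> f i < b.
Proof.
  intros Hf.
  apply (S1_ind (fun l => exists b, forall i, i < l -> f i < b)).
  - apply (S1_ex (fun b r => forall i, i < r O -> f i < b)), D_S1. def.
  - exists 0; intros i Hi; destruct (nlt_0 _ Hi).
  - intros x [b Hb]. exists (b + f x + 1). intros i Hi. apply lt_succ in Hi. destruct Hi as [Hi| ->].
    + specialize (Hb i Hi); mlia.
    + mlia.
Qed.

Lemma mkseq_bound (l v : M) : exists b, forall k f, Df (fun r => f (r O)) -> k <= l ->
  (forall i, i < k -> f i < v) ->
  mkseq k f < b /\ fseq (mkseq k f) /\ len (mkseq k f) = k /\ forall i, i < k -> nth (mkseq k f) i = f i.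
Proof.
  destruct (fset_comprehension (cpair l v)) as [b Hb]. exists b.
  intros k f Hf Hk Hv.
  destruct (Hb (fun x => exists i, i < k /\ x = cpair i (f i))) as [s [Hsb [Hs Hel]]]; [def|].
  assert (Hel' : forall x, elt x s <-> exists i, i < k /\ x = cpair i (f i)).
  { intros x; rewrite Hel; split; [tauto|]. intros [i [Hi ->]]; split; [|eauto].
    specialize (Hv i Hi). unfold cpair.
    pose proof (cpair_mono i (f i + 1) l v ltac:(mlia) ltac:(mlia)). unfold cpair in H.
    assert (i + f i <= (i + f i) * (i + f i)) by apply le_square. mlia. }
  assert (Hlen : has_len s k).
  { intros i; split.
    - intros Hi; exists (f i). apply Hel'; eauto.
    - intros [j Hj]. apply Hel' in Hj. destruct Hj as [i' [Hi' E]].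
      apply cpair_inj in E. destruct E as [-> _]; exact Hi'. }
  assert (Hseq : fseq s).
  { split; [exact Hs|split; [|split; [|eauto]]].
    - intros x Hx. apply Hel' in Hx. destruct Hx as [i [_ ->]]; eauto.
    - intros i j j' Hj Hj'. apply Hel' in Hj, Hj'.
      destruct Hj as [i1 [_ E1]], Hj' as [i2 [_ E2]].
      apply cpair_inj in E1, E2. destruct E1 as [<- ->], E2 as [<- ->]. reflexivity. }
  pose proof (len_eq s k Hlen) as Hlk.
  assert (Hnth : forall i, i < k -> nth s i = f i).
  { intros i Hi. assert (He : elt (cpair i (f i)) s) by (apply Hel'; eauto).
    apply elt_cpair_nth in He; [|exact Hseq]. symmetry; apply He. }
  unfold mkseq.
  destruct (mu_spec (fun s => fseq s /\ len s = k /\ forall i, i < k -> nth s i = f i) s) as [H1 [_ H2]].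
  - apply (D_mkseq f k Hf).
  - auto.
  - destruct H1 as [H3 [H4 H5]]. split; [mlia|auto].
Qed.

Lemma mkseq_spec (k : M) f : Df (fun r => f (r O)) ->
  fseq (mkseq k f) /\ len (mkseq k f) = k /\ forall i, i < k -> nth (mkseq k f) i = f i.
Proof.
  intros Hf. destruct (bounded_values f k Hf) as [v Hv]. destruct (mkseq_bound k v) as [b Hb].
  apply (Hb k f Hf (le_refl k) Hv).
Qed.

Lemma Df_section (f : M -> env -> M) r : Df (fun r => f (r O) (fun i => r (S i))) ->
  Df (fun e => f (e O) r).
Proof.
  intros H. apply (Df_comp _ (fun e => scons (e O) r) H). intros [|i]; simpl; tm.
Qed.

Lemma Df_mkseq (t : env -> M) (f : M -> env -> M) :
  Df t -> Df (fun r => f (r O) (fun i => r (S i))) -> Df (fun r => mkseq (t r) (fun i => f i r)).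
Proof.
  intros Ht Hf. unfold mkseq.
  apply (Df_mu_total (fun s r => fseq s /\ len s = t r /\ forall i, i < t r -> nth s i = f i r)).
  - apply D_and; [def|]. apply D_and; [apply D_eq; [def|now apply Df_tail]|].
    apply (D_ball (fun r => t (fun i => r (S i))) (fun i r => nth (r O) i = f i (fun i => r (S i)))).
    + now apply Df_tail.
    + apply D_eq; [def|]. apply (Df_comp _ (fun r => scons (r O) (fun i => r (S (S i)))) Hf).
      intros [|i]; simpl; tm.
  - intros r. exists (mkseq (t r) (fun i => f i r)). apply mkseq_spec, Df_section, Hf.
Qed.

Definition ite (P : Prop) (x y : M) : M := if excluded_middle_informative P then x else y.

Lemma ite_true (P : Prop) x y : P -> ite P x y = x.
Proof. unfold ite; destruct excluded_middle_informative; tauto. Qed.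

Lemma ite_false (P : Prop) x y : ~ P -> ite P x y = y.
Proof. unfold ite; destruct excluded_middle_informative; tauto. Qed.

Lemma Df_ite (P : env -> Prop) (t u : env -> M) : D P -> Df t -> Df u ->
  Df (fun r => ite (P r) (t r) (u r)).
Proof.
  intros HP Ht Hu.
  assert (HP' : D (fun r => P (fun i => r (S i)))) by (apply (D_comp P (fun r i => r (S i)) HP); intros; tm).
  eapply D_ext; [apply D_or; apply D_and|].
  - exact HP'.
  - exact Ht.
  - apply D_not, HP'.
  - exact Hu.
  - intros r; cbv beta. destruct (classic (P (fun i => r (S i)))).
    + rewrite ite_true by assumption; tauto.
    + rewrite ite_false by assumption; tauto.
Qed.
End Sequences.

Ltac def_user ::= first [apply Df_cpair | apply D_elt | apply D_dvd | apply D_triple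
  | apply D_fset | apply D_has_len | apply D_fseq | apply Df_len | apply Df_nth
  | apply Df_mkseq | apply Df_ite ].

(** * The pigeonhole principle and cardinalities *)

Section Counting.
Context {A : structure} {HA : RCA A}.
Local Notation M := (dom A).
Local Notation env := (nat -> dom A).
Local Open Scope num_scope.
Add Ring num_ring : (@num_semi_ring A HA).

Definition injective_below (l : M) (f : M -> M) : Prop :=
  forall i, i < l -> forall j, j < l -> f i = f j -> i = j.

(** Induction on the number [v] of values, for all coded injections below a fixed bound at once,
    which is a Delta_1 statement. An entry equal to the largest value is overwritten by the last
    entry, and the last place is dropped. *)
Lemma pigeonhole (k l : M) (f : M -> M) : Df (fun r => f (r O)) ->
  (forall i, i < k -> f i < l) -> injective_below k f -> k <= l.
Proof.
  intros Hf Hl Hinj. destruct (mkseq_bound k l) as [b Hb].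
  assert (G : forall v, v <= l -> forall s, s < b -> fseq s -> len s <= k ->
    (forall i, i < len s -> nth s i < v) -> injective_below (len s) (nth s) -> len s <= v).
  { apply (D_ind (fun v => v <= l -> forall s, s < b -> fseq s -> len s <= k ->
    (forall i, i < len s -> nth s i < v) -> injective_below (len s) (nth s) -> len s <= v)).
    - unfold injective_below. def.
    - intros _ s _ _ _ H _. apply nlt_le; intros H0. destruct (nlt_0 _ (H 0 H0)).
    - intros v IH Hv s Hsb Hs Hk Hval Hi.
      destruct (zero_or_pos (len s)) as [->|Hpos]; [mlia|].
      destruct (le_sub 1 (len s) Hpos) as [p Hp].
      pose (g := fun i => ite (nth s i = v) (nth s p) (nth s i)).
      assert (Hg : Df (fun r => g (r O))) by (unfold g; def).
      assert (Hgv : forall i, i < p -> g i < v).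
      { intros i Hip. unfold g. destruct (classic (nth s i = v)) as [E|E].
        - rewrite ite_true by exact E.
          assert (Hpv : nth s p < v + 1) by (apply Hval; mlia).
          apply lt_succ in Hpv. destruct Hpv as [Hpv|Hpv]; [exact Hpv|].
          assert (i = p) by (apply Hi; [mlia|mlia|congruence]). mlia.
        - rewrite ite_false by exact E.
          assert (Hpv : nth s i < v + 1) by (apply Hval; mlia).
          apply lt_succ in Hpv. destruct Hpv as [Hpv|Hpv]; [exact Hpv|contradiction]. }
      assert (Hpk : p <= k) by mlia.
      destruct (Hb p g Hg Hpk) as [H1 [H2 [H3 H4]]].
      { intros i Hip. specialize (Hgv i Hip). mlia. }
      assert (Hpv : len (mkseq p g) <= v).
      { apply IH; auto; [mlia|rewrite H3; exact Hpk| |].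
        - rewrite H3. intros i Hip. rewrite H4 by exact Hip. now apply Hgv.
        - rewrite H3. intros i Hip j Hjp. rewrite !H4 by assumption. unfold g. intros E.
          destruct (classic (nth s i = v)) as [Ei|Ei], (classic (nth s j = v)) as [Ej|Ej].
          + apply Hi; [mlia|mlia|congruence].
          + rewrite ite_true, ite_false in E by assumption.
            assert (p = j) by (apply Hi; [mlia|mlia|exact E]). mlia.
          + rewrite ite_false, ite_true in E by assumption.
            assert (i = p) by (apply Hi; [mlia|mlia|exact E]). mlia.
          + rewrite !ite_false in E by assumption. apply Hi; [mlia|mlia|exact E]. }
      rewrite H3 in Hpv. mlia. }
  destruct (Hb k f Hf (le_refl k) Hl) as [H1 [H2 [H3 H4]]].
  rewrite <- H3. apply (G l (le_refl l)); auto.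
  - rewrite H3; apply le_refl.
  - rewrite H3. intros i Hi; rewrite H4; auto.
  - rewrite H3. intros i Hi j Hj; rewrite !H4 by assumption. now apply Hinj.
Qed.

Definition card (F l : M) : Prop :=
  exists s, fseq s /\ has_len s l /\
    (forall i j x, elt (cpair i x) s -> elt (cpair j x) s -> i = j) /\
    (forall x, elt x F <-> exists i, elt (cpair i x) s).
Definition card_le (F c : M) : Prop := exists l, l <= c /\ card F l.
Definition class_card_le (P : M -> Prop) (c : M) : Prop :=
  forall F, fset F -> (forall x, elt x F -> P x) -> card_le F c.

Definition injseq (s : M) : Prop := fseq s /\ injective_below (len s) (nth s).

Lemma card_injseq (F l : M) :
  card F l <-> exists s, injseq s /\ len s = l /\ forall x, elt x F <-> exists i, i < len s /\ x = nth s i.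
Proof.
  split; intros [s H]; exists s.
  - destruct H as [H1 [H2 [H3 H4]]]. rewrite (len_eq s l H2).
    pose proof (len_eq s l H2) as E.
    split; [split; [exact H1|]|split; [reflexivity|]].
    + intros i Hi j Hj E'. apply (H3 i j (nth s i)); [|rewrite E']; now apply elt_nth.
    + intros x. rewrite H4. split; intros [i Hi]; exists i; rewrite elt_cpair_nth in *; rewrite ?E in *; auto.
  - destruct H as [[H1 H2] [<- H3]]. split; [exact H1|split; [now apply fseq_has_len|split]].
    + intros i j x Hi Hj. apply elt_cpair_nth in Hi, Hj; auto.
      destruct Hi as [Hi ->], Hj as [Hj E]. now apply H2.
    + intros x; rewrite H3. split; intros [i Hi]; exists i; rewrite elt_cpair_nth in *; auto.
Qed.

Lemma D_injseq (t : env -> M) : Df t -> D (fun r => injseq (t r)).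
Proof. apply (D_app1 injseq). unfold injseq, injective_below. def. Qed.

Definition append (s x : M) : M := mkseq (len s + 1) (fun i => ite (i < len s) (nth s i) x).

Lemma append_spec (s x : M) :
  fseq (append s x) /\ len (append s x) = len s + 1 /\
  (forall i, i < len s -> nth (append s x) i = nth s i) /\ nth (append s x) (len s) = x.
Proof.
  destruct (mkseq_spec (len s + 1) (fun i => ite (i < len s) (nth s i) x)) as [H1 [H2 H3]]; [def|].
  fold (append s x) in *. split; [exact H1|split; [exact H2|split]].
  - intros i Hi. rewrite H3 by mlia. now apply ite_true.
  - rewrite H3 by mlia. apply ite_false, lt_irrefl.
Qed.

Lemma injseq_append (s x : M) : injseq s -> (forall i, i < len s -> nth s i <> x) -> injseq (append s x).
Proof.
  intros [Hs Hi] Hx. destruct (append_spec s x) as [H1 [H2 [H3 H4]]].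
  split; [exact H1|]. rewrite H2. intros i Hil j Hjl E.
  apply lt_succ in Hil, Hjl. destruct Hil as [Hil| ->], Hjl as [Hjl| ->].
  - rewrite !H3 in E by assumption. now apply Hi.
  - rewrite H3, H4 in E by assumption. destruct (Hx i Hil E).
  - rewrite H4, H3 in E by assumption. symmetry in E. destruct (Hx j Hjl E).
  - reflexivity.
Qed.

Lemma card_exists (F : M) : exists l, card F l.
Proof.
  assert (G : forall k, exists s, injseq s /\
    (forall x, x < k -> elt x F -> exists i, i < len s /\ x = nth s i) /\
    (forall i, i < len s -> elt (nth s i) F /\ nth s i < k)).
  { apply (S1_ind (fun k => exists s, injseq s /\
    (forall x, x < k -> elt x F -> exists i, i < len s /\ x = nth s i) /\
    (forall i, i < len s -> elt (nth s i) F /\ nth s i < k))).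
    - apply (S1_ex (fun s r => injseq s /\
        (forall x, x < r O -> elt x F -> exists i, i < len s /\ x = nth s i) /\
        (forall i, i < len s -> elt (nth s i) F /\ nth s i < r O))), D_S1.
      apply D_and; [apply D_injseq; def|def].
    - destruct (mkseq_spec 0 (fun i => i)) as [H1 [H2 _]]; [def|].
      exists (mkseq 0 (fun i => i)). split; [split; [exact H1|]|split].
      + rewrite H2. intros i Hi; destruct (nlt_0 _ Hi).
      + intros x Hx; destruct (nlt_0 _ Hx).
      + rewrite H2. intros i Hi; destruct (nlt_0 _ Hi).
    - intros k [s [Hs [H1 H2]]]. destruct (classic (elt k F)) as [Hk|Hk].
      + exists (append s k). destruct (append_spec s k) as [_ [E1 [E2 E3]]].
        split; [apply injseq_append; [exact Hs|]|split].
        * intros i Hi E. destruct (H2 i Hi) as [_ H]. rewrite E in H. destruct (lt_irrefl _ H).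
        * intros x Hx He. rewrite E1. apply lt_succ in Hx. destruct Hx as [Hx| ->].
          -- destruct (H1 x Hx He) as [i [Hi ->]]. exists i; split; [mlia|]. now rewrite E2.
          -- exists (len s); split; [mlia|]. now rewrite E3.
        * rewrite E1. intros i Hi. apply lt_succ in Hi. destruct Hi as [Hi| ->].
          -- rewrite E2 by exact Hi. destruct (H2 i Hi) as [H3 H4]. split; [exact H3|mlia].
          -- rewrite E3. split; [exact Hk|mlia].
      + exists s; split; [exact Hs|split].
        * intros x Hx He. apply lt_succ in Hx. destruct Hx as [Hx| ->]; [auto|contradiction].
        * intros i Hi. destruct (H2 i Hi) as [H3 H4]. split; [exact H3|mlia]. }
  destruct (G F) as [s [Hs [H1 H2]]]. exists (len s). apply card_injseq.
  exists s; split; [exact Hs|split; [reflexivity|]]. intros x; split.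
  - intros Hx. apply H1; [now apply elt_lt|exact Hx].
  - intros [i [Hi ->]]. now apply H2.
Qed.

(** Finite sets are traded for injective enumerations, with which all later counting is done. The
    set of entries of [s] has another enumeration [t] of length at most [c]; sending a place in [s]
    to the place of the same entry in [t] is injective. *)
Lemma class_card_le_injseq (P : M -> Prop) (c : M) :
  class_card_le P c <-> forall s, injseq s -> (forall i, i < len s -> P (nth s i)) -> len s <= c.
Proof.
  split.
  - intros H s [Hs Hi] HP.
    destruct (bounded_values (nth s) (len s)) as [b Hb]; [def|].
    destruct (fset_comprehension b) as [k Hk].
    destruct (Hk (fun x => exists i, i < len s /\ x = nth s i)) as [F [_ [HF HF']]]; [def|].
    destruct (H F HF) as [l [Hl Hc]].
    { intros x Hx. apply HF' in Hx. destruct Hx as [_ [i [Hi' ->]]]; auto. }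
    apply card_injseq in Hc. destruct Hc as [t [Ht [<- Ht']]].
    apply le_trans with (len t); [|exact Hl].
    pose (f := fun i => mu (fun j => j < len t /\ nth s i = nth t j)).
    assert (Hf : Df (fun r => f (r O))).
    { apply (Df_mu (fun j r => j < len t /\ nth s (r O) = nth t j) (fun _ => len t)); [def|def|].
      intros r j [Hj _]; exact Hj. }
    assert (Hspec : forall i, i < len s -> f i < len t /\ nth s i = nth t (f i)).
    { intros i Hi'. assert (He : elt (nth s i) F) by (apply HF'; split; [auto|eauto]).
      apply Ht' in He. destruct He as [j Hj].
      apply (mu_spec (fun j => j < len t /\ nth s i = nth t j) j); [def|exact Hj]. }
    apply (pigeonhole _ _ f Hf).
    + intros i Hi'; now apply Hspec.
    + intros i Hi1 j Hj1 E. apply Hi; auto.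
      rewrite (proj2 (Hspec i Hi1)), (proj2 (Hspec j Hj1)), E. reflexivity.
  - intros H F HF HP. destruct (card_exists F) as [l Hl]. exists l; split; [|exact Hl].
    apply card_injseq in Hl. destruct Hl as [s [Hs [<- Hs']]].
    apply H; [exact Hs|]. intros i Hi. apply HP, Hs'. eauto.
Qed.
End Counting.

(** * From Sigma_1 weak Konig to Sigma_2 induction *)

Section Principles.
Context {A : structure} {HA : RCA A}.
Local Notation M := (dom A).
Local Notation env := (nat -> dom A).
Local Open Scope num_scope.
Add Ring num_ring : (@num_semi_ring A HA).

Definition prefix (s t : M) : Prop := forall i j, elt (cpair i j) s -> elt (cpair i j) t.
Definition binary (s : M) : Prop := forall i j, elt (cpair i j) s -> j = 0 \/ j = 1.
Definition function (f : sets A) : Prop :=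
  (forall x, x ∈ f -> exists i j, x = cpair i j) /\
  (forall i, exists j, cpair i j ∈ f /\ forall k, cpair i k ∈ f -> k = j).
Definition is_tree (T : M -> Prop) : Prop :=
  (forall s, T s -> fseq s) /\ (forall s t, T t -> fseq s -> prefix s t -> T s).
Definition infinite (P : M -> Prop) : Prop := forall m, exists x, m < x /\ P x.
Definition level (T : M -> Prop) (n s : M) : Prop := T s /\ has_len s n.
Definition weakly_bounded (T : M -> Prop) : Prop :=
  exists c, forall n, class_card_le (level T n) c.
Definition has_path (T : M -> Prop) : Prop :=
  exists g, function g /\ forall n, exists s, fseq s /\ has_len s n /\
    (forall i j, elt (cpair i j) s -> cpair i j ∈ g) /\ T s.
Definition range (f : sets A) (s : M) : Prop := exists i, cpair i s ∈ f.
Definition Sigma1_WKL_wbd_in : Prop :=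
  forall f, function f -> is_tree (range f) -> (forall s, range f s -> binary s) ->
    infinite (range f) -> weakly_bounded (range f) -> has_path (range f).
Definition KL_wbd_in : Prop :=
  forall X, is_tree (fun s => s ∈ X) -> infinite (fun s => s ∈ X) ->
    weakly_bounded (fun s => s ∈ X) -> has_path (fun s => s ∈ X).
Definition ISigma2_in : Prop :=
  forall q : M -> M -> M -> Prop, D (fun r => q (r O) (r 1%nat) (r 2%nat)) ->
    (exists x, forall y, q 0 x y) ->
    (forall k, (exists x, forall y, q k x y) -> exists x, forall y, q (k + 1) x y) ->
    forall k, exists x, forall y, q k x y.

Lemma comprehension (P : M -> Prop) : D (fun r => P (r O)) -> exists X, forall x, x ∈ X <-> P x.
Proof. intros [H1 H2]; now apply comprehension_D1. Qed.

Lemma comprehension_function (f : M -> M) : Df (fun r => f (r O)) ->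
  exists X, function X /\ forall i j, cpair i j ∈ X <-> j = f i.
Proof.
  intros Hf. destruct (comprehension (fun x => exists i, i <= x /\ x = cpair i (f i))) as [X HX]; [def|].
  assert (HX' : forall i j, cpair i j ∈ X <-> j = f i).
  { intros i j. rewrite HX. split.
    - intros [i' [_ E]]. apply cpair_inj in E. destruct E as [-> ->]; reflexivity.
    - intros ->. exists i; split; [apply cpair_ge_l|reflexivity]. }
  exists X; split; [split|exact HX'].
  - intros x Hx. apply HX in Hx. destruct Hx as [i [_ E]]; eauto.
  - intros i. exists (f i); split; [now apply HX'|]. intros k; apply HX'.
Qed.

Definition ap (f : sets A) (i : M) : M := mu (fun j => cpair i j ∈ f).

Lemma ap_spec f i j : function f -> cpair i j ∈ f <-> j = ap f i.
Proof.
  intros [_ Hf]. destruct (Hf i) as [k [Hk Hu]].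
  assert (H : cpair i (ap f i) ∈ f) by (apply (mu_spec (fun j => cpair i j ∈ f) k); [def|exact Hk]).
  split; [|intros ->; exact H]. intros Hj. rewrite (Hu _ Hj). symmetry; apply Hu, H.
Qed.

Lemma Df_ap f : function f -> Df (fun r => ap f (r O)).
Proof.
  intros [_ Hf]. apply (Df_mu_total (fun j r => cpair (r O) j ∈ f)); [def|].
  intros r. destruct (Hf (r O)) as [j [Hj _]]; eauto.
Qed.

Lemma prefix_iff (s t : M) : fseq s -> fseq t ->
  prefix s t <-> len s <= len t /\ forall i, i < len s -> nth s i = nth t i.
Proof.
  intros Hs Ht; split.
  - intros H. split.
    + apply nlt_le. intros Hl. pose proof (H _ _ (elt_nth s (len t) Hs Hl)) as He.
      apply elt_cpair_nth in He; [|exact Ht]. destruct He as [He _]. destruct (lt_irrefl _ He).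
    + intros i Hi. pose proof (H _ _ (elt_nth s i Hs Hi)) as He.
      apply elt_cpair_nth in He; [|exact Ht]. apply He.
  - intros [H1 H2] i j Hij. apply elt_cpair_nth in Hij; [|exact Hs]. destruct Hij as [Hi ->].
    apply elt_cpair_nth; [exact Ht|]. split; [mlia|auto].
Qed.

Definition take (n t : M) : M := mkseq n (nth t).

Lemma take_spec (n t : M) : fseq (take n t) /\ len (take n t) = n /\
  forall i, i < n -> nth (take n t) i = nth t i.
Proof. apply mkseq_spec. def. Qed.

Lemma take_prefix (n t : M) : fseq t -> n <= len t -> prefix (take n t) t.
Proof.
  intros Ht Hn. destruct (take_spec n t) as [H1 [H2 H3]].
  apply prefix_iff; [exact H1|exact Ht|]. rewrite H2. auto.
Qed.

Lemma prefix_trans (s t u : M) : prefix s t -> prefix t u -> prefix s u.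
Proof. intros H H' i j Hij; auto. Qed.

Lemma level_len (T : M -> Prop) n s : is_tree T -> level T n s <-> T s /\ len s = n.
Proof.
  intros [HT _]; unfold level; split; intros [H1 H2]; split; auto.
  - now apply len_eq.
  - rewrite <- H2. now apply fseq_has_len, HT.
Qed.

Definition has_liminf (J : M -> M) : Prop :=
  exists v, (forall t0, exists t, t0 <= t /\ J t = v) /\ exists t0, forall t, t0 <= t -> v <= J t.

(** * Stagewise refutation of a Sigma_2 formula *)

Section Sigma2Approximation.
Context (q : M -> M -> M -> Prop) (Hq : D (fun r => q (r O) (r 1%nat) (r 2%nat))).
Let phi (k : M) : Prop := exists x, forall y, q k x y.
(** A candidate [x] counts as refuted only together with all smaller ones, so the refuted candidates
    form an initial segment that grows with [s]; [k] acts at the stages at which it grows. The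
    clause [x <= s] forces [t0] to be refuted no earlier than stage [t0], so that late actions
    exist. *)
Let refuted (k x s : M) : Prop := x <= s /\ forall x', x' <= x -> exists y, y <= s /\ ~ q k x' y.
Let acts (k s : M) : Prop := exists x, x <= s /\ (refuted k x s /\ forall s', s' < s -> ~ refuted k x s').

Lemma D_refuted : D (fun r => refuted (r O) (r 1%nat) (r 2%nat)).
Proof. unfold refuted. def. Qed.

Lemma D_acts : D (fun r => acts (r O) (r 1%nat)).
Proof. pose proof D_refuted. unfold acts. def. Qed.

Lemma refuted_mono k x x' s s' : refuted k x s -> x' <= x -> s <= s' -> refuted k x' s'.
Proof.
  intros [H1 H2] Hx Hs. split; [mlia|]. intros x'' Hx''.
  destruct (H2 x'') as [y [Hy Hq']]; [mlia|]. exists y; split; [mlia|exact Hq'].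
Qed.

Lemma acts_unbounded k : ~ phi k -> forall t0, exists s, t0 <= s /\ acts k s.
Proof.
  intros Hk t0. pose proof D_refuted as HD.
  assert (Hk' : forall x, exists y, ~ q k x y).
  { intros x. apply NNPP; intros H. apply Hk. exists x; intros y. apply NNPP; intros H'; apply H; eauto. }
  assert (G : forall x, exists s, refuted k x s).
  { apply (S1_ind (fun x => exists s, refuted k x s)).
    - apply (S1_ex (fun s r => refuted k (r O) s)), D_S1. def.
    - destruct (Hk' 0) as [y Hy]. exists y; split; [apply le_0|].
      intros x' Hx'. exists y; split; [apply le_refl|].
      assert (x' = 0) as -> by (apply le_antisym; [exact Hx'|apply le_0]). exact Hy.
    - intros x [s [Hs1 Hs2]]. destruct (Hk' (x + 1)) as [y Hy]. exists (s + y + 1); split; [mlia|].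
      intros x' Hx'. destruct Hx' as [Hx'| ->].
      + apply lt_succ in Hx'. destruct (Hs2 x' Hx') as [y' [Hy1 Hy2]].
        exists y'; split; [mlia|exact Hy2].
      + exists y; split; [mlia|exact Hy]. }
  destruct (G t0) as [s0 Hs0].
  destruct (D_least (fun s => refuted k t0 s) s0) as [s [Hs Hl]]; [def|exact Hs0|].
  exists s; split; [apply Hs|]. exists t0; split; [apply Hs|]. auto.
Qed.

(** If [x] is refuted at stage [s1], an action after [s1] refutes some [x'] for the first time, and
    by monotonicity [x' > x]. So all candidates are refuted, by Sigma_1 induction. *)
Lemma unbounded_acts k : (forall t0, exists s, t0 <= s /\ acts k s) -> ~ phi k.
Proof.
  intros H. pose proof D_refuted as HD.
  assert (G : forall x, exists s, refuted k x s).
  { apply (S1_ind (fun x => exists s, refuted k x s)).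
    - apply (S1_ex (fun s r => refuted k (r O) s)), D_S1. def.
    - destruct (H 0) as [s [_ [x [_ [Hx _]]]]]. exists s.
      apply (refuted_mono _ _ _ _ _ Hx); [apply le_0|apply le_refl].
    - intros x [s1 Hs1]. destruct (H (s1 + 1)) as [s [Hs [x' [_ [Hx' Hmin]]]]].
      exists s. apply (refuted_mono _ _ _ _ _ Hx'); [|apply le_refl].
      apply lt_succ_le, nle_lt. intros Hle.
      apply (Hmin s1); [mlia|]. apply (refuted_mono _ _ _ _ _ Hs1); [exact Hle|apply le_refl]. }
  intros [x Hx]. destruct (G x) as [s [_ Hs]]. destruct (Hs x (le_refl x)) as [y [_ Hy]]. auto.
Qed.

(** The limit inferior of the least [k <= a] that acts is the least counterexample
    to [phi]. *)
Lemma liminf_induction :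
  (forall J a, Df (fun r => J (r O)) -> (forall s, J s <= a) -> has_liminf J) ->
  phi 0 -> (forall k, phi k -> phi (k + 1)) -> forall k, phi k.
Proof.
  intros HL H0 HS a. apply NNPP; intros Ha. pose proof D_acts as HD.
  (* The alternative [k = a] makes the search total. It does no harm as a limit inferior, since [a]
     is itself a counterexample. *)
  pose (J := fun s => mu (fun k => k = a \/ acts k s)).
  assert (HJ : forall s, (J s = a \/ acts (J s) s) /\ J s <= a /\ forall k, acts k s -> J s <= k).
  { intros s. destruct (mu_spec (fun k => k = a \/ acts k s) a) as [H1 [H2 H3]]; [def|now left|].
    fold (J s) in *. split; [exact H1|split; [exact H3|]].
    intros k Hk. apply nlt_le. intros Hlt. apply (H2 k Hlt). now right. }
  destruct (HL J a) as [v [Hv1 [t0 Hv2]]].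
  { apply (Df_mu_total (fun k r => k = a \/ acts k (r O))); [def|]. intros r; exists a; now left. }
  { intros s; exact (proj1 (proj2 (HJ s))). }
  assert (Hv : ~ phi v).
  { destruct (classic (v = a)) as [->|Hva]; [exact Ha|].
    apply unbounded_acts. intros t1. destruct (Hv1 t1) as [t [Ht E]]. exists t; split; [exact Ht|].
    destruct (HJ t) as [[H|H] _]; [congruence|]. now rewrite <- E. }
  destruct (zero_or_pos v) as [->|Hpos]; [contradiction|].
  destruct (le_sub 1 v Hpos) as [k ->].
  (* If [phi] failed at the predecessor [k] of the limit inferior, [k] would act at unboundedly many
     stages and push [J] down to [k] there. *)
  apply Hv. rewrite add_comm. apply HS. apply NNPP; intros Hk.
  destruct (acts_unbounded k Hk t0) as [s [Hs Hac]].
  destruct (HJ s) as [_ [_ H]]. specialize (H k Hac). specialize (Hv2 s Hs). mlia.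
Qed.
End Sigma2Approximation.

(** * The true stages of a bounded function and its limit inferior *)

Section Liminf.
Context (J : M -> M) (HJ : Df (fun r => J (r O))) (a : M) (Ha : forall s, J s <= a).

Definition bit (s m : M) : M := ite (forall t, t <= s -> m < t -> J m <= J t) 1 0.
Definition bits (s n : M) : M := mkseq n (bit s).
Definition fst_of (i : M) : M := mu (fun s => exists n, n <= i /\ i = cpair s n).
Definition snd_of (i : M) : M := mu (fun n => exists s, s <= i /\ i = cpair s n).

Lemma fst_of_cpair s n : fst_of (cpair s n) = s.
Proof.
  destruct (mu_spec (fun s' => exists n', n' <= cpair s n /\ cpair s n = cpair s' n') s) as [[n' [_ H]] _].
  - def.
  - exists n; split; [apply cpair_ge_r|reflexivity].
  - apply cpair_inj in H. symmetry; apply H.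
Qed.

Lemma snd_of_cpair s n : snd_of (cpair s n) = n.
Proof.
  destruct (mu_spec (fun n' => exists s', s' <= cpair s n /\ cpair s n = cpair s' n') n) as [[n' [_ H]] _].
  - def.
  - exists s; split; [apply cpair_ge_l|reflexivity].
  - apply cpair_inj in H. symmetry; apply H.
Qed.

Lemma Df_fst_of : Df (fun r => fst_of (r O)).
Proof.
  apply (Df_mu (fun s r => exists n, n <= r O /\ r O = cpair s n) (fun r => r O + 1)); [def|def|].
  intros r s [n [_ ->]]. pose proof (cpair_ge_l s n). mlia.
Qed.

Lemma Df_snd_of : Df (fun r => snd_of (r O)).
Proof.
  apply (Df_mu (fun n r => exists s, s <= r O /\ r O = cpair s n) (fun r => r O + 1)); [def|def|].
  intros r n [s [_ ->]]. pose proof (cpair_ge_r s n). mlia.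
Qed.

Lemma Df_bit : Df (fun r => bit (r O) (r 1%nat)).
Proof. unfold bit. def. Qed.

Lemma bit_01 s m : bit s m = 0 \/ bit s m = 1.
Proof.
  unfold bit. destruct (classic (forall t, t <= s -> m < t -> J m <= J t)).
  - right; now apply ite_true.
  - left; now apply ite_false.
Qed.

Lemma bit_1 s m : bit s m = 1 <-> forall t, t <= s -> m < t -> J m <= J t.
Proof.
  unfold bit; split; intros H; [|now apply ite_true].
  apply NNPP; intros Hn. rewrite ite_false in H by exact Hn. mlia.
Qed.

Lemma bits_spec s n : fseq (bits s n) /\ len (bits s n) = n /\ forall m, m < n -> nth (bits s n) m = bit s m.
Proof. pose proof Df_bit. apply mkseq_spec. def. Qed.

(** Below [n], the bits of [s >= n] depend only on the minimum of [J] on [[n, s]]. *)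
Lemma bits_code s n : n <= s -> exists v, v <= a /\
  forall m, m < n -> bit s m = 1 <-> (forall t, t < n -> m < t -> J m <= J t) /\ J m <= v.
Proof.
  intros Hn.
  destruct (D_least (fun v => exists t, t <= s /\ (n <= t /\ J t = v)) (J n)) as [v [[u [Hu [Hnu <-]]] Hl]].
  - def.
  - exists n; split; [exact Hn|split; [apply le_refl|reflexivity]].
  - exists (J u); split; [apply Ha|]. intros m Hm. rewrite bit_1. split.
    + intros H; split.
      * intros t Ht Hmt. apply H; [mlia|exact Hmt].
      * apply H; [exact Hu|mlia].
    + intros [H1 H2] t Ht Hmt. destruct (classic (t < n)) as [Htn|Htn]; [auto|].
      apply le_trans with (J u); [exact H2|]. apply nlt_le; intros Hlt. apply (Hl (J t) Hlt).
      exists t; split; [exact Ht|split; [now apply nlt_le|reflexivity]].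
Qed.

(** [f i] is the least [v <= a] that describes the entry [i] in the sense of [bits_code]. Entries
    with the same [v] agree bit by bit, so [f] is injective into the [a + 1] numbers up to [a]. *)
Lemma bits_width n b : injseq b ->
  (forall i, i < len b -> exists s, n <= s /\ nth b i = bits s n) -> len b <= a + 1.
Proof.
  intros [Hb Hinj] H.
  pose (C := fun x v => v <= a /\ forall m, m < n ->
     nth x m = 1 <-> (forall t, t < n -> m < t -> J m <= J t) /\ J m <= v).
  assert (HC : D (fun r => C (r O) (r 1%nat))) by (unfold C; def).
  pose (f := fun i => mu (fun v => C (nth b i) v)).
  assert (Hf : Df (fun r => f (r O))).
  { apply (Df_mu (fun v r => C (nth b (r O)) v) (fun _ => a + 1)); [def|def|].
    intros r v [Hv _]. mlia. }
  assert (Hspec : forall i, i < len b -> C (nth b i) (f i)).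
  { intros i Hi. destruct (H i Hi) as [s [Hs E]]. destruct (bits_code s n Hs) as [v [Hv1 Hv2]].
    apply (mu_spec (fun v => C (nth b i) v) v); [def|]. split; [exact Hv1|].
    intros m Hm. rewrite E. destruct (bits_spec s n) as [_ [_ Hbit]]. rewrite Hbit by exact Hm.
    now apply Hv2. }
  apply (pigeonhole _ _ f Hf).
  - intros i Hi. destruct (Hspec i Hi) as [H1 _]. mlia.
  - intros i Hi j Hj E. apply Hinj; auto.
    destruct (Hspec i Hi) as [_ Hci], (Hspec j Hj) as [_ Hcj]. rewrite E in Hci.
    destruct (H i Hi) as [s [_ Es]], (H j Hj) as [s' [_ Es']]. rewrite Es, Es' in *.
    destruct (bits_spec s n) as [S1 [S2 S3]], (bits_spec s' n) as [S1' [S2' S3']].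
    apply fseq_ext; auto; [congruence|]. rewrite S2. intros m Hm.
    specialize (Hci m Hm). specialize (Hcj m Hm). rewrite S3, S3' in * by exact Hm.
    destruct (bit_01 s m) as [E1|E1], (bit_01 s' m) as [E2|E2]; rewrite E1, E2 in *; auto.
    + apply Hci, Hcj; reflexivity.
    + symmetry. apply Hcj, Hci; reflexivity.
Qed.

(** The path of the tree of all [bits s n], for [n <= s], is the set of the [m]
    such that no later value of [J] is smaller than [J m]. *)
Lemma Sigma1_WKL_min_set : Sigma1_WKL_wbd_in ->
  exists g, forall m, m ∈ g <-> forall t, m < t -> J m <= J t.
Proof.
  intros HW. pose proof Df_bit as HDb. pose proof Df_fst_of as HD1. pose proof Df_snd_of as HD2.
  (* A pair with [n > s] enumerates the empty string, which makes the enumeration total without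
     adding a node. *)
  pose (F := fun i => mkseq (ite (snd_of i <= fst_of i) (snd_of i) 0) (bit (fst_of i))).
  assert (HF : Df (fun r => F (r O))).
  { unfold F. apply (Df_mkseq _ (fun i r => bit (fst_of (r O)) i)); def. }
  destruct (comprehension_function F HF) as [f [Hfun Hf]].
  assert (Hr : forall x, range f x <-> exists s n, n <= s /\ x = bits s n).
  { intros x; split.
    - intros [i Hi]. apply Hf in Hi. unfold F in Hi.
      destruct (classic (snd_of i <= fst_of i)) as [Hc|Hc].
      + rewrite ite_true in Hi by exact Hc. exists (fst_of i), (snd_of i); auto.
      + rewrite ite_false in Hi by exact Hc. exists (fst_of i), 0; split; [apply le_0|exact Hi].
    - intros [s [n [Hn ->]]]. exists (cpair s n). apply Hf. unfold F.
      rewrite fst_of_cpair, snd_of_cpair, ite_true by exact Hn. reflexivity. }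
  assert (Hseq : forall x, range f x -> fseq x).
  { intros x Hx. apply Hr in Hx. destruct Hx as [s [n [_ ->]]]. apply bits_spec. }
  assert (Htree : is_tree (range f)).
  { split; [exact Hseq|]. intros y x Hx Hy Hyx. pose proof (Hseq x Hx) as Hxs.
    apply Hr in Hx. destruct Hx as [s [n [Hn ->]]].
    apply prefix_iff in Hyx; auto. destruct Hyx as [H1 H2].
    destruct (bits_spec s n) as [S1 [S2 S3]]. destruct (bits_spec s (len y)) as [S1' [S2' S3']].
    apply Hr. rewrite S2 in H1. exists s, (len y); split; [mlia|].
    apply fseq_ext; auto. intros i Hi. rewrite H2, S3, S3' by mlia. reflexivity. }
  destruct (HW f Hfun Htree) as [g [Hg Hpath]].
  - intros x Hx i j Hij. pose proof (Hseq x Hx) as Hxs.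
    apply Hr in Hx. destruct Hx as [s [n [Hn ->]]].
    apply elt_cpair_nth in Hij; [|exact Hxs]. destruct Hij as [Hi ->].
    destruct (bits_spec s n) as [S1 [S2 S3]]. rewrite S3 by mlia. apply bit_01.
  - intros m. exists (bits (m + 1) (m + 1)). destruct (bits_spec (m + 1) (m + 1)) as [S1 [S2 S3]].
    split.
    + pose proof (len_le _ S1) as H. rewrite S2 in H. mlia.
    + apply Hr. exists (m + 1), (m + 1); split; [apply le_refl|reflexivity].
  - exists (a + 1). intros n. apply class_card_le_injseq. intros b Hb H.
    apply (bits_width n b Hb). intros i Hi. specialize (H i Hi).
    apply level_len in H; [|exact Htree]. destruct H as [Hx Hl]. apply Hr in Hx.
    destruct Hx as [s [n' [Hn' E]]]. exists s. rewrite E in Hl.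
    destruct (bits_spec s n') as [_ [S2 _]]. rewrite S2 in Hl. subst n'. auto.
  - destruct (comprehension (fun m => cpair m 1 ∈ g)) as [X HX]; [def|].
    exists X. intros m. rewrite HX.
    (* The one value of the path at [m] is [bit s m] for arbitrarily late stages [s]; a 1 is
       therefore tested against every later [t]. *)
    assert (HP : forall n, m < n -> exists s, n <= s /\ cpair m (bit s m) ∈ g).
    { intros n Hn. destruct (Hpath n) as [x [Hx [Hl [Hsub Hrx]]]].
      apply Hr in Hrx. destruct Hrx as [s [n' [Hn' ->]]].
      destruct (bits_spec s n') as [S1 [S2 S3]]. apply len_eq in Hl. rewrite S2 in Hl. subst n'.
      exists s; split; [exact Hn'|]. apply Hsub. rewrite <- (S3 m Hn). apply elt_nth; [exact S1|].
      now rewrite S2. }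
    split.
    + intros Hm t Ht. destruct (HP (t + 1)) as [s [Hs Hin]]; [mlia|].
      apply ap_spec in Hm, Hin; try exact Hg. rewrite <- Hm in Hin.
      rewrite bit_1 in Hin. apply Hin; [mlia|exact Ht].
    + intros Hm. destruct (HP (m + 1)) as [s [Hs Hin]]; [mlia|].
      replace 1 with (bit s m); [exact Hin|]. apply bit_1. auto.
Qed.

(** [J] is nondecreasing on [g], and [g] is unbounded because every tail has a point of [g] at which
    [J] is least. As [g] is a set, the values of [J] on it form a Sigma_1 class; the largest of them
    is the limit inferior. *)
Lemma Sigma1_WKL_liminf : Sigma1_WKL_wbd_in -> has_liminf J.
Proof.
  intros HW. destruct (Sigma1_WKL_min_set HW) as [g Hg].
  assert (Hmin : forall t0, exists t, t0 <= t /\ t ∈ g /\ forall t', t0 <= t' -> J t <= J t').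
  { intros t0.
    destruct (SB_least D0 good_D0 S1_ind (fun w => exists t, t0 <= t /\ J t = w) (J t0)) as [w [[t [Ht <-]] Hl]].
    - apply (S1_ex (fun t r => t0 <= t /\ J t = r O)), D_S1. def.
    - exists t0; split; [apply le_refl|reflexivity].
    - exists t; split; [exact Ht|]. assert (Hm : forall t', t0 <= t' -> J t <= J t').
      { intros t' Ht'. apply Hl. eauto. }
      split; [|exact Hm]. apply Hg. intros t' Ht'. apply Hm. mlia. }
  destruct (SB_max D0 good_D0 S1_ind (fun w => exists m, m ∈ g /\ J m = w) (J (mu (fun m => m ∈ g))) a)
    as [v [[m [Hm <-]] Hmax]].
  - apply (S1_ex (fun m r => m ∈ g /\ J m = r O)), D_S1. def.
  - destruct (Hmin 0) as [t [_ [Ht _]]]. exists (mu (fun m => m ∈ g)); split; [|reflexivity].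
    apply (mu_spec (fun m => m ∈ g) t); [def|exact Ht].
  - intros w [m [_ <-]]; apply Ha.
  - assert (Hlow : forall t, m <= t -> J m <= J t).
    { intros t [Ht| <-]; [now apply Hg|apply le_refl]. }
    exists (J m); split; [|eauto]. intros t0. destruct (Hmin (t0 + m)) as [t [Ht [Htg _]]].
    exists t; split; [mlia|]. apply le_antisym; [|apply Hlow; mlia].
    apply Hmax. eauto.
Qed.
End Liminf.

Theorem Sigma1_WKL_ISigma2 : Sigma1_WKL_wbd_in -> ISigma2_in.
Proof.
  intros HW q Hq. apply (liminf_induction q Hq).
  intros J a HJ Ha. exact (Sigma1_WKL_liminf J HJ a Ha HW).
Qed.
End Principles.

(** * From Konig to Sigma_1 weak Konig *)

Section Konig.
Context {A : structure} {HA : RCA A}.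
Local Notation M := (dom A).
Local Notation env := (nat -> dom A).
Local Open Scope num_scope.
Add Ring num_ring : (@num_semi_ring A HA).

Lemma D_prefix (t u : env -> M) : Df t -> Df u -> D (fun r => prefix (t r) (u r)).
Proof.
  apply (D_app2 prefix).
  apply D_ext with (fun r => forall i, i < r O -> forall j, j < r O ->
    elt (cpair i j) (r O) -> elt (cpair i j) (r 1%nat)); [def|].
  intros r; split.
  - intros H i j Hij. destruct (elt_cpair_lt _ _ _ Hij). auto.
  - intros H i _ j _; apply H.
Qed.

Lemma take_in (T : M -> Prop) n s : is_tree T -> T s -> n <= len s -> T (take n s).
Proof.
  intros [HT1 HT2] Hs Hn. apply (HT2 _ s Hs); [apply take_spec|].
  apply take_prefix; [now apply HT1|exact Hn].
Qed.

Lemma prefix_refl (s : M) : prefix s s.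
Proof. now intros i j. Qed.

Lemma prefix_comparable (s s' t : M) : fseq s -> fseq s' -> fseq t ->
  prefix s t -> prefix s' t -> len s <= len s' -> prefix s s'.
Proof.
  intros Hs Hs' Ht H H' Hl.
  apply prefix_iff in H, H'; auto. destruct H as [_ H], H' as [_ H'].
  apply prefix_iff; auto. split; [exact Hl|]. intros i Hi. rewrite H, H' by mlia. reflexivity.
Qed.

(** Place [m] of an index sequence holds the first index of the initial segment of length [m + 1],
    so lengths are preserved and membership is a bounded check. Since first indices are unique,
    [str] is injective on each level, and the levels are no wider than before. *)
Theorem KL_Sigma1_WKL : @KL_wbd_in A -> @Sigma1_WKL_wbd_in A.
Proof.
  intros HK f Hf Htree Hbin Hinf [c Hc].
  pose (F := ap f). assert (HF : Df (fun r => F (r O))) by now apply Df_ap.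
  assert (HFr : forall s, range f s <-> exists i, s = F i).
  { intros s; split; intros [i Hi]; exists i; apply ap_spec; auto. }
  assert (HFs : forall i, fseq (F i)) by (intros i; apply Htree, HFr; eauto).
  (* Binary strings of length at most [n] are coded below [b]; a node with a larger code can be cut
     at length [n]. *)
  assert (Hlev : forall n, exists s, range f s /\ len s = n).
  { intros n. destruct (mkseq_bound n (1 + 1)) as [b Hb]. destruct (Hinf b) as [x [Hbx Hx]].
    pose proof (proj1 Htree x Hx) as Hxs. destruct (classic (n <= len x)) as [Hn|Hn].
    - exists (take n x). split; [now apply take_in|apply take_spec].
    - exfalso. destruct (Hb (len x) (nth x)) as [H1 [H2 [H3 H4]]]; [def|mlia| |].
      + intros i Hi. destruct (Hbin x Hx i (nth x i)) as [-> | ->]; [now apply elt_nth|mlia|mlia].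
      + assert (E : x = mkseq (len x) (nth x)).
        { apply fseq_ext; auto. intros i Hi; symmetry; auto. }
        rewrite <- E in H1. mlia. }
  pose (good_at := fun t m => len (F (nth t m)) = m + 1 /\
    (forall i, i < nth t m -> F i <> F (nth t m)) /\
    (forall m', m' < m -> prefix (F (nth t m')) (F (nth t m)))).
  assert (Hgood : D (fun r => good_at (r O) (r 1%nat))).
  { unfold good_at. def. apply D_prefix; def. }
  destruct (comprehension (fun t => fseq t /\ forall m, m < len t -> good_at t m)) as [X HX]; [def|].
  assert (HXtree : is_tree (fun t => t ∈ X)).
  { split; [intros t Ht; now apply HX|]. intros s t Ht Hs Hst.
    apply HX in Ht. destruct Ht as [Ht Hg]. apply HX; split; [exact Hs|]. intros m Hm.
    apply prefix_iff in Hst; auto. destruct Hst as [Hl Hn].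
    destruct (Hg m) as [G1 [G2 G3]]; [mlia|]. unfold good_at. rewrite Hn by exact Hm.
    split; [exact G1|split; [exact G2|]]. intros m' Hm'. rewrite Hn by mlia. auto. }
  pose (str := fun t => mkseq (len t) (fun m => nth (F (nth t m)) m)).
  assert (Hstr : Df (fun r => str (r O))).
  { unfold str. apply (Df_mkseq _ (fun m r => nth (F (nth (r O) m)) m)); def. }
  assert (Hstr_spec : forall t, fseq (str t) /\ len (str t) = len t /\
    forall m, m < len t -> nth (str t) m = nth (F (nth t m)) m).
  { intros t. apply mkseq_spec. def. }
  assert (Htake : forall t, t ∈ X -> forall m, m < len t -> F (nth t m) = take (m + 1) (str t)).
  { intros t Ht m Hm. apply HX in Ht. destruct Ht as [Ht Hg].
    destruct (Hg m Hm) as [G1 [_ G3]]. destruct (Hstr_spec t) as [S1 [S2 S3]].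
    destruct (take_spec (m + 1) (str t)) as [T1 [T2 T3]].
    apply fseq_ext; auto; [congruence|]. rewrite G1. intros i Hi.
    rewrite T3, S3 by mlia. apply lt_succ in Hi. destruct Hi as [Hi| ->]; [|reflexivity].
    specialize (G3 i Hi). apply prefix_iff in G3; auto. destruct G3 as [_ G3].
    symmetry. apply G3. destruct (Hg i) as [-> _]; mlia. }
  assert (Hstr_in : forall t, t ∈ X -> range f (str t)).
  { intros t Ht. destruct (Hstr_spec t) as [S1 [S2 S3]].
    destruct (zero_or_pos (len t)) as [E|Hpos].
    - destruct (Hlev 0) as [s [Hs Hl]]. replace (str t) with s; [exact Hs|].
      apply fseq_ext; auto; [now apply Htree|congruence|]. rewrite Hl. intros i Hi; destruct (nlt_0 _ Hi).
    - destruct (le_sub 1 (len t) Hpos) as [p Hp].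
      apply HFr. exists (nth t p). rewrite (Htake t Ht p) by mlia.
      destruct (take_spec (p + 1) (str t)) as [T1 [T2 T3]].
      apply fseq_ext; auto; [rewrite S2, T2; mlia|]. intros i Hi. rewrite T3; [reflexivity|mlia]. }
  destruct (HK X HXtree) as [g [Hg Hpath]].
  - intros n. destruct (Hlev (n + 1)) as [s [Hs Hl]].
    (* The premise [m < n + 1] makes the search total: other arguments get the value 0. *)
    pose (h := fun m => mu (fun i => m < n + 1 -> F i = take (m + 1) s)).
    assert (Hex : forall m, exists i, m < n + 1 -> F i = take (m + 1) s).
    { intros m. destruct (classic (m < n + 1)) as [Hm|Hm]; [|exists 0; tauto].
      destruct (proj1 (HFr (take (m + 1) s))) as [i Hi]; [apply take_in; auto; mlia|eauto]. }
    assert (HD : D (fun r => r 1%nat < n + 1 -> F (r O) = take (r 1%nat + 1) s)).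
    { def. }
    assert (Hh : Df (fun r => h (r O))).
    { apply (Df_mu_total (fun i r => r O < n + 1 -> F i = take (r O + 1) s) HD). intros r; apply Hex. }
    assert (Hh_spec : forall m, m < n + 1 -> F (h m) = take (m + 1) s /\
              forall i, i < h m -> F i <> take (m + 1) s).
    { intros m Hm. destruct (Hex m) as [i Hi].
      destruct (mu_spec (fun i => m < n + 1 -> F i = take (m + 1) s) i) as [H1 [H2 _]].
      - exact (D_section (fun i r => r O < n + 1 -> F i = take (r O + 1) s) (fun _ => m) HD).
      - exact Hi.
      - fold (h m) in *. split; [auto|]. intros j Hj E. apply (H2 j Hj). auto. }
    destruct (mkseq_spec (n + 1) h Hh) as [M1 [M2 M3]].
    exists (mkseq (n + 1) h). split.
    + pose proof (len_le _ M1) as H. rewrite M2 in H. mlia.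
    + apply HX. split; [exact M1|]. rewrite M2. intros m Hm. unfold good_at.
      rewrite M3 by exact Hm. destruct (Hh_spec m Hm) as [E1 E2]. rewrite E1.
      destruct (take_spec (m + 1) s) as [T1 [T2 T3]].
      split; [exact T2|split; [exact E2|]]. intros m' Hm'. rewrite M3 by mlia.
      destruct (Hh_spec m') as [E1' _]; [mlia|]. rewrite E1'.
      destruct (take_spec (m' + 1) s) as [T1' [T2' T3']].
      apply prefix_iff; auto. rewrite T2, T2'. split; [mlia|].
      intros i Hi. rewrite T3, T3' by mlia. reflexivity.
  - exists c. intros n. apply class_card_le_injseq. intros b [Hb Hinj] Hn.
    destruct (mkseq_spec (len b) (fun i => str (nth b i))) as [M1 [M2 M3]]; [def|].
    rewrite <- M2.
    apply (proj1 (class_card_le_injseq _ _) (Hc n)).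
    + split; [exact M1|]. rewrite M2. intros i Hi j Hj E. rewrite !M3 in E by assumption.
      apply Hinj; auto. pose proof (Hn i Hi) as Hi'. pose proof (Hn j Hj) as Hj'.
      apply level_len in Hi', Hj'; try exact HXtree. destruct Hi' as [Xi Li], Hj' as [Xj Lj].
      pose proof (Htake _ Xi) as Ti. pose proof (Htake _ Xj) as Tj.
      apply HX in Xi, Xj. destruct Xi as [Si Gi], Xj as [Sj Gj].
      apply fseq_ext; auto; [congruence|]. intros m Hm.
      assert (EF : F (nth (nth b i) m) = F (nth (nth b j) m)).
      { rewrite Ti, Tj, E by congruence. reflexivity. }
      destruct (Gi m Hm) as [_ [Mi _]]. destruct (Gj m) as [_ [Mj _]]; [congruence|].
      destruct (lt_total (nth (nth b i) m) (nth (nth b j) m)) as [H|[H|H]]; [|exact H|].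
      * destruct (Mj _ H EF).
      * destruct (Mi _ H). now symmetry.
    + rewrite M2. intros i Hi. rewrite M3 by exact Hi. pose proof (Hn i Hi) as Hi'.
      apply level_len in Hi'; [|exact HXtree]. destruct Hi' as [Xi Li].
      apply level_len; [exact Htree|]. split; [now apply Hstr_in|].
      destruct (Hstr_spec (nth b i)) as [_ [-> _]]. exact Li.
  - pose (h := fun m => nth (F (ap g m)) m).
    pose proof (Df_ap g Hg) as Hapg.
    destruct (comprehension_function h) as [p [Hp Hph]]; [unfold h; def|].
    exists p; split; [exact Hp|]. intros n.
    destruct (Hpath n) as [t [Ht [Hl [Hsub HtX]]]].
    destruct (Hstr_spec t) as [S1 [S2 S3]]. pose proof (len_eq _ _ Hl) as El.
    exists (str t). split; [exact S1|split; [|split]].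
    + rewrite <- El, <- S2. now apply fseq_has_len.
    + intros i j Hij. apply elt_cpair_nth in Hij; [|exact S1]. destruct Hij as [Hi ->].
      rewrite S2 in Hi. apply Hph. rewrite S3 by exact Hi. unfold h. f_equal. f_equal.
      apply ap_spec; [exact Hg|]. apply Hsub, elt_nth; assumption.
    + now apply Hstr_in.
Qed.

End Konig.

Ltac def_user ::= first [apply Df_cpair | apply D_elt | apply D_dvd | apply D_triple
  | apply D_fset | apply D_has_len | apply D_fseq | apply Df_len | apply Df_nth
  | apply Df_mkseq | apply Df_ite | apply D_injseq | apply D_prefix ].

(** * From Sigma_2 induction to Konig *)

Definition S2 {A : structure} : ((nat -> dom A) -> Prop) -> Prop := SB (co S1).

Section Konig.
Context {A : structure} {HA : RCA A}.
Local Notation M := (dom A).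
Local Notation env := (nat -> dom A).
Local Open Scope num_scope.
Add Ring num_ring : (@num_semi_ring A HA).

Lemma good_coS1 : good (co (@S1 A)).
Proof. apply good_co, good_S1. Qed.

Lemma S1_double_neg (P : env -> Prop) : S1 P -> S1 (fun r => ~ ~ P r).
Proof. intros H. apply (SB_ext _ _ _ H). intros r; split; [tauto|apply NNPP]. Qed.

Lemma S1_not_imp (P Q : env -> Prop) : S1 P -> S1 (fun r => ~ Q r) -> S1 (fun r => ~ (P r -> Q r)).
Proof.
  intros HP HQ. eapply SB_ext; [apply (S1_and _ _ HP HQ)|]. intros r; cbv beta. tauto.
Qed.

Lemma S1_not_and (P Q : env -> Prop) : S1 (fun r => ~ P r) -> S1 (fun r => ~ Q r) -> S1 (fun r => ~ (P r /\ Q r)).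
Proof.
  intros HP HQ. eapply SB_ext; [apply (S1_or _ _ HP HQ)|]. intros r; cbv beta. tauto.
Qed.

Lemma S1_not_all (P : M -> env -> Prop) : S1 (fun r => ~ P (r O) (fun i => r (S i))) ->
  S1 (fun r => ~ forall x, P x r).
Proof.
  intros HP. eapply SB_ext; [apply (S1_ex (fun x r => ~ P x r) HP)|].
  intros r; cbv beta; split; [intros [x Hx] H; auto|apply not_all_ex_not].
Qed.

Lemma ISigma2_inductive : @ISigma2_in A -> inductive_class (@S2 A).
Proof.
  intros HI P [Q [[R [HR HQR]] HPQ]] H0 HS.
  pose (q := fun k x y => ~ R (scons y (scons x (scons k (fun _ => 0))))).
  assert (HP : forall k, P k <-> exists x, forall y, q k x y).
  { intros k. rewrite (HPQ (scons k (fun _ => 0))). split; intros [x Hx]; exists x.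
    - intros y Hy. apply (proj2 (HQR (scons x (scons k (fun _ => 0))))); eauto.
    - apply NNPP; intros Hn. apply HQR in Hn. destruct Hn as [y Hy]. exact (Hx y Hy). }
  intros k. apply HP. apply (HI q).
  - unfold q. apply D_not, D_D0.
    apply (D0_comp R HR (fun r => scons (r 2%nat) (scons (r 1%nat) (scons (r O) (fun _ => 0))))).
    intros [|[|[|i]]]; simpl; tm.
  - now apply HP.
  - intros j Hj. apply HP, HS, HP, Hj.
Qed.

(** * Widths of the levels *)

Section Tree.
Context (HI : inductive_class (@S2 A)).
Context (X : sets A) (Htree : is_tree (fun t => t ∈ X)) (Hinf : infinite (fun t => t ∈ X)).
Context (c : M) (Hc : forall n, class_card_le (level (fun t => t ∈ X) n) c).

Let Hseq t : t ∈ X -> fseq t := proj1 Htree t.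

Definition nodes (n s : M) : Prop :=
  injseq s /\ forall i, i < len s -> nth s i ∈ X /\ len (nth s i) = n.

Lemma D_nodes : D (fun r => nodes (r O) (r 1%nat)).
Proof. unfold nodes. def. Qed.

Lemma nodes_le n s : nodes n s -> len s <= c.
Proof.
  intros [H1 H2]. apply (proj1 (class_card_le_injseq _ _) (Hc n)); [exact H1|].
  intros i Hi. apply level_len; auto.
Qed.

Lemma nodes_append n s t : nodes n s -> t ∈ X -> len t = n -> (forall i, i < len s -> nth s i <> t) ->
  nodes n (append s t) /\ len (append s t) = len s + 1.
Proof.
  intros [H1 H2] Ht Hl Hn. destruct (append_spec s t) as [_ [E1 [E2 E3]]].
  split; [|exact E1]. split; [now apply injseq_append|]. rewrite E1.
  intros i Hi. apply lt_succ in Hi. destruct Hi as [Hi| ->].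
  - rewrite E2 by exact Hi. auto.
  - rewrite E3; auto.
Qed.

Lemma nodes_nil n : nodes n (mkseq 0 (fun i => i)) /\ len (mkseq (A := A) 0 (fun i => i)) = 0.
Proof.
  destruct (mkseq_spec 0 (fun i : M => i)) as [M1 [M2 _]]; [def|].
  split; [|exact M2]. split; [split; [exact M1|]|]; rewrite M2; intros i Hi; destruct (nlt_0 _ Hi).
Qed.

Lemma take_X n t : t ∈ X -> n <= len t -> take n t ∈ X.
Proof. apply (take_in (fun t => t ∈ X) n t Htree). Qed.

(** A longest injective enumeration of nodes of the level exists by Sigma_1 induction, as its length
    is at most [c]; it contains every node of the level. *)
Lemma level_bounded n : exists b, forall t, t ∈ X -> len t = n -> t < b.
Proof.
  pose proof D_nodes as HD.
  destruct (SB_max D0 good_D0 S1_ind (fun l => exists s, nodes n s /\ len s = l) 0 c) as [l [[s [Hs <-]] Hmax]].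
  - apply (S1_ex (fun s r => nodes n s /\ len s = r O)), D_S1. def.
  - exists (mkseq 0 (fun i => i)). apply nodes_nil.
  - intros l [s [Hs <-]]. exact (nodes_le n s Hs).
  - destruct (bounded_values (nth s) (len s)) as [b Hb]; [def|].
    exists b. intros t Ht Hl. apply NNPP; intros Hn.
    destruct (nodes_append n s t Hs Ht Hl) as [H1 H2].
    + intros i Hi <-. auto.
    + assert (len s + 1 <= len s) by (apply Hmax; eauto). mlia.
Qed.

(** The codes of the nodes being unbounded, it is enough that those of the first
    [n] levels are bounded; this takes Sigma_2 induction. *)
Lemma level_inhabited n : exists t, t ∈ X /\ len t = n.
Proof.
  assert (G : forall m, exists b, forall t, t ∈ X -> len t < m -> t < b).
  { apply (HI (fun m => exists b, forall t, t ∈ X -> len t < m -> t < b)).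
    - exists (fun r => forall t, t ∈ X -> len t < r 1%nat -> t < r O). split; [|reflexivity].
      apply (S1_not_all (fun t r => t ∈ X -> len t < r 1%nat -> t < r O)), D_S1, D_not. def.
    - exists 0. intros t _ H; destruct (nlt_0 _ H).
    - intros m [b Hb]. destruct (level_bounded m) as [b' Hb']. exists (b + b').
      intros t Ht Hl. apply lt_succ in Hl. destruct Hl as [Hl|Hl].
      + specialize (Hb t Ht Hl). mlia.
      + specialize (Hb' t Ht Hl). mlia. }
  destruct (G n) as [b Hb]. destruct (Hinf b) as [t [Hbt Ht]].
  assert (Hn : n <= len t).
  { apply nlt_le; intros H. specialize (Hb t Ht H). mlia. }
  exists (take n t). split; [now apply take_X|apply take_spec].
Qed.

(** [K] is the limit superior of the widths of the levels. *)
Lemma limit_width : exists K n0, 1 <= K /\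
  (forall n, exists m, n <= m /\ exists s, nodes m s /\ len s = K) /\
  (forall m s, n0 <= m -> nodes m s -> len s <> K + 1).
Proof.
  pose proof D_nodes as HD.
  (* Occurring on unboundedly many levels is Pi_2, so [P] is its Sigma_2 negation, and [co_max]
     finds the greatest number outside [P]. *)
  pose (P := fun k => ~ forall n, exists m, n <= m /\ exists s, nodes m s /\ len s = k).
  assert (H1 : ~ P 1).
  { intros H; apply H. intros n. exists n; split; [apply le_refl|].
    destruct (level_inhabited n) as [t [Ht Hl]]. destruct (nodes_nil n) as [N1 N2].
    exists (append (mkseq 0 (fun i => i)) t).
    destruct (nodes_append n (mkseq 0 (fun i => i)) t N1 Ht Hl) as [N3 N4].
    - rewrite N2. intros i Hi; destruct (nlt_0 _ Hi).
    - split; [exact N3|]. rewrite N4, N2. ring. }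
  destruct (co_max (co S1) good_coS1 HI P 1 c) as [K [HK Hmax]].
  - exists (fun r => ~ exists m, r O <= m /\ exists s, nodes m s /\ len s = r 1%nat). split.
    + apply S1_double_neg.
      apply (S1_ex (fun m r => r O <= m /\ exists s, nodes m s /\ len s = r 1%nat)).
      apply S1_and; [apply D_S1; def|].
      apply (S1_ex (fun s r => nodes (r O) s /\ len s = r 2%nat)), D_S1. def.
    + intros r; unfold P; simpl. split; [apply not_all_ex_not|]. intros [n Hn] H; auto.
  - exact H1.
  - intros k Hk. apply NNPP in Hk. destruct (Hk 0) as [m [_ [s [Hs <-]]]]. exact (nodes_le m s Hs).
  - apply NNPP in HK.
    assert (Hk1 : P (K + 1)) by (apply Hmax; mlia).
    apply not_all_ex_not in Hk1. destruct Hk1 as [n0 Hn0].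
    exists K, n0. split; [|split; [exact HK|]].
    + apply nlt_le; intros Hlt. apply H1, Hmax. exact Hlt.
    + intros m s Hm Hs E. apply Hn0. eauto.
Qed.

(** * Extendible nodes *)

Section Full.
Context (K n0 : M) (HK1 : 1 <= K).
Context (HK : forall n, exists m, n <= m /\ exists s, nodes m s /\ len s = K).
Context (Hn0 : forall m s, n0 <= m -> nodes m s -> len s <> K + 1).

(** Since [K] is the maximal width beyond [n0], [full m s] says that [s] enumerates
    the whole level [m]: this makes extendibility a Pi_1 notion. *)
Definition full (m s : M) : Prop := n0 <= m /\ nodes m s /\ len s = K.

Lemma D_full : D (fun r => full (r O) (r 1%nat)).
Proof. pose proof D_nodes. unfold full. def. Qed.

Lemma full_exists n : exists m s, n <= m /\ full m s.
Proof.
  destruct (HK (n + n0)) as [m [Hm [s [Hs Hl]]]]. exists m, s.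
  split; [mlia|]. split; [mlia|auto].
Qed.

Lemma full_nth m s i : full m s -> i < K -> nth s i ∈ X /\ len (nth s i) = m.
Proof. intros [_ [[_ H] E]] Hi. apply H. now rewrite E. Qed.

Lemma full_complete m s t : full m s -> t ∈ X -> m <= len t -> exists i, i < K /\ prefix (nth s i) t.
Proof.
  intros Hs Ht Hm. apply NNPP; intros Hn.
  destruct Hs as [H1 [H2 H3]].
  destruct (take_spec m t) as [T1 [T2 _]].
  destruct (nodes_append m s (take m t)) as [N1 N2]; auto.
  - now apply take_X.
  - intros i Hi E. apply Hn. exists i. rewrite <- H3. split; [exact Hi|].
    rewrite E. apply take_prefix; auto.
  - apply (Hn0 m _ H1 N1). now rewrite N2, H3.
Qed.

Definition alive (t s : M) : Prop := exists i, i < K /\ prefix t (nth s i).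
Definition extendible (t : M) : Prop := forall m s, full m s -> len t <= m -> alive t s.

Lemma D_alive : D (fun r => alive (r O) (r 1%nat)).
Proof. unfold alive. def. Qed.

Lemma S1_not_extendible : S1 (fun r => ~ extendible (r O)).
Proof.
  pose proof D_full. pose proof D_alive. unfold extendible.
  apply (S1_not_all (fun m r => forall s, full m s -> len (r O) <= m -> alive (r O) s)).
  apply (S1_not_all (fun s r => full (r O) s -> len (r 1%nat) <= r O -> alive (r 1%nat) s)).
  apply D_S1. def.
Qed.

(** An extension of [t] in [s'] passes through level [m]; since [s] is full, it does so at a listed
    node, and that node is comparable with [t]. *)
Lemma alive_down t m s m' s' : t ∈ X -> full m s -> full m' s' -> len t <= m -> m <= m' ->
  alive t s' -> alive t s.
Proof.
  intros Ht Hs Hs' Hl Hm [i [Hi Hp]]. destruct (full_nth m' s' i Hs' Hi) as [H1 H2].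
  destruct (full_complete m s (nth s' i) Hs H1) as [j [Hj Hq]]; [now rewrite H2|].
  exists j; split; [exact Hj|]. destruct (full_nth m s j Hs Hj) as [H3 H4].
  apply (prefix_comparable t (nth s j) (nth s' i)); auto. now rewrite H4.
Qed.

Definition antichain (s : M) : Prop :=
  fseq s /\ (forall i, i < len s -> nth s i ∈ X) /\
  (forall i, i < len s -> forall j, j < len s -> prefix (nth s i) (nth s j) -> i = j).

Definition many_extendible (k : M) : Prop :=
  exists s, (antichain s /\ len s = k) /\ forall i, i < len s -> extendible (nth s i).

Lemma D_antichain : D (fun r => antichain (r O)).
Proof. unfold antichain. def. Qed.

Lemma S2_many_extendible : S2 (fun r => many_extendible (r O)).
Proof.
  pose proof D_antichain.
  exists (fun r => (antichain (r O) /\ len (r O) = r 1%nat) /\ forall i, i < len (r O) -> extendible (nth (r O) i)).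
  split; [|reflexivity].
  apply S1_not_and; [apply D_S1, D_not; def|].
  apply (S1_not_all (fun i r => i < len (r O) -> extendible (nth (r O) i))), S1_not_imp; [apply D_S1; def|].
  apply (S1_subst (fun r => nth (r 1%nat) (r O)) (fun t r => ~ extendible t)); [def|].
  apply S1_not_extendible.
Qed.

(** All members of the antichain have extensions on one full level, and incomparable nodes have
    different extensions; the pigeonhole principle compares them with the [K] nodes there. *)
Lemma many_extendible_le k : many_extendible k -> k <= K.
Proof.
  intros [s [[[Hs [HX Ha]] <-] He]].
  destruct (bounded_values (fun i => len (nth s i)) (len s)) as [b Hb]; [def|].
  destruct (full_exists b) as [m [u [Hm Hu]]].
  pose (f := fun i => mu (fun j => j < K /\ prefix (nth s i) (nth u j))).
  assert (Hf : Df (fun r => f (r O))).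
  { apply (Df_mu (fun j r => j < K /\ prefix (nth s (r O)) (nth u j)) (fun _ => K)); [def|def|].
    intros r j [Hj _]; exact Hj. }
  assert (Hspec : forall i, i < len s -> f i < K /\ prefix (nth s i) (nth u (f i))).
  { intros i Hi. destruct (He i Hi m u Hu) as [j Hj]; [specialize (Hb i Hi); mlia|].
    apply (mu_spec (fun j => j < K /\ prefix (nth s i) (nth u j)) j); [def|exact Hj]. }
  apply (pigeonhole _ _ f Hf); [intros i Hi; now apply Hspec|].
  intros i Hi j Hj E. destruct (Hspec i Hi) as [H1 H2], (Hspec j Hj) as [_ H3].
  rewrite <- E in H3. destruct (full_nth m u (f i) Hu H1) as [H4 _].
  destruct (lt_total (len (nth s i)) (len (nth s j))) as [H|[H|H]].
  - apply Ha; auto. apply (prefix_comparable _ _ (nth u (f i))); auto. now left.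
  - apply Ha; auto. apply (prefix_comparable _ _ (nth u (f i))); auto. now right.
  - symmetry. apply Ha; auto. apply (prefix_comparable _ _ (nth u (f i))); auto. now left.
Qed.

Lemma root_extendible : many_extendible 1.
Proof.
  destruct (level_inhabited 0) as [t [Ht Hl]].
  destruct (mkseq_spec 1 (fun _ : M => t)) as [M1 [M2 M3]]; [def|].
  exists (mkseq 1 (fun _ => t)). split; [split; [split; [exact M1|split]|exact M2]|]; rewrite ?M2.
  - intros i Hi. rewrite M3 by exact Hi. exact Ht.
  - intros i Hi j Hj _. mlia.
  - intros i Hi m u Hu _. rewrite M3 by exact Hi. exists 0; split; [mlia|].
    destruct (full_nth m u 0 Hu) as [H1 H2]; [mlia|].
    apply prefix_iff; auto. rewrite Hl. split; [apply le_0|]. intros j Hj; destruct (nlt_0 _ Hj).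
Qed.

(** Replacing the first element of a largest antichain of extendible nodes by two
    incomparable extensions would give a larger one. *)
Lemma unsplit_node : exists t0, t0 ∈ X /\ extendible t0 /\
  forall t1 t2, t1 ∈ X -> t2 ∈ X -> prefix t0 t1 -> prefix t0 t2 -> extendible t1 -> extendible t2 ->
    prefix t1 t2 \/ prefix t2 t1.
Proof.
  destruct (SB_max (co S1) good_coS1 HI many_extendible 1 K) as [k [[s [[[Hs [HX Ha]] Hk] He]] Hmax]].
  - apply S2_many_extendible.
  - apply root_extendible.
  - apply many_extendible_le.
  - assert (Hk1 : 1 <= k) by (apply Hmax, root_extendible).
    assert (H0 : 0 < len s) by mlia.
    exists (nth s 0). split; [auto|split; [auto|]].
    intros t1 t2 Ht1 Ht2 Hp1 Hp2 He1 He2. apply NNPP; intros Hn.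
    (* [g i] extends the old element [nth s (h i)]. Comparable new elements therefore lie above the
       same old one, which leaves only the pair [t1], [t2]. *)
    pose (g := fun i => ite (i = 0) t1 (ite (i = k) t2 (nth s i))).
    assert (Hg : Df (fun r => g (r O))) by (unfold g; def).
    pose (h := fun i => ite (i = k) 0 i).
    assert (Hcase : forall i, i < k + 1 -> (i = 0 /\ g i = t1 /\ h i = 0) \/ (i = k /\ g i = t2 /\ h i = 0)
              \/ (i <> 0 /\ i < k /\ g i = nth s i /\ h i = i)).
    { intros i Hi. unfold g, h. destruct (classic (i = 0)) as [E|E].
      - left. rewrite ite_true by exact E. split; [exact E|split; [reflexivity|]].
        rewrite ite_false; [exact E|]. intros ->. mlia.
      - right. destruct (classic (i = k)) as [E'|E'].
        + left. rewrite ite_false, !ite_true by assumption. auto.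
        + right. rewrite !ite_false by assumption. split; [exact E|split; [|auto]].
          apply lt_succ in Hi. destruct Hi as [Hi|Hi]; [exact Hi|contradiction]. }
    assert (Hgs : forall i, i < k + 1 -> h i < len s /\ (g i ∈ X /\ (prefix (nth s (h i)) (g i) /\ extendible (g i)))).
    { intros i Hi. destruct (Hcase i Hi) as [[-> [-> ->]]|[[-> [-> ->]]|[H1 [H2 [-> ->]]]]]; auto.
      assert (i < len s) by mlia. split; [assumption|split; [auto|split; [apply prefix_refl|auto]]]. }
    destruct (mkseq_spec (k + 1) g Hg) as [M1 [M2 M3]].
    assert (Hmany : many_extendible (k + 1)).
    { exists (mkseq (k + 1) g). split; [split; [split; [exact M1|split]|exact M2]|]; rewrite M2.
      - intros i Hi. rewrite M3 by exact Hi. now apply Hgs.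
      - intros i Hi j Hj. rewrite !M3 by assumption. intros Hp.
        destruct (Hgs i Hi) as [L1 [X1 [P1 _]]], (Hgs j Hj) as [L2 [X2 [P2 _]]].
        assert (P3 : prefix (nth s (h i)) (g j)) by (eapply prefix_trans; eassumption).
        assert (Eh : h i = h j).
        { destruct (lt_total (len (nth s (h i))) (len (nth s (h j)))) as [H|[H|H]].
          - apply Ha; auto. apply (prefix_comparable _ _ (g j)); auto. now left.
          - apply Ha; auto. apply (prefix_comparable _ _ (g j)); auto. now right.
          - symmetry. apply Ha; auto. apply (prefix_comparable _ _ (g j)); auto. now left. }
        destruct (Hcase i Hi) as [[Ei [Gi Hi']]|[[Ei [Gi Hi']]|[Ni [Li [Gi Hi']]]]],
                 (Hcase j Hj) as [[Ej [Gj Hj']]|[[Ej [Gj Hj']]|[Nj [Lj [Gj Hj']]]]]; try congruence;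
          rewrite Gi, Gj in Hp; exfalso; apply Hn; auto.
      - intros i Hi. rewrite M3 by exact Hi. now apply Hgs. }
    specialize (Hmax _ Hmany). mlia.
Qed.

(** * The path above an unsplit node *)

Section Path.
Context (t0 : M) (Ht0 : t0 ∈ X) (He0 : extendible t0).
Context (Hsplit : forall t1 t2, t1 ∈ X -> t2 ∈ X -> prefix t0 t1 -> prefix t0 t2 ->
  extendible t1 -> extendible t2 -> prefix t1 t2 \/ prefix t2 t1).

(** The nodes of [u] that are not extendible die on levels of their own. Collection for Pi_1
    relations, available from Sigma_2 induction, bounds these levels, and death persists by
    [alive_down]; an extendible node meets the relation with any bound. *)
Lemma common_death m u : full m u -> exists m' w, m <= m' /\ full m' w /\
  forall j, j < K -> extendible (nth u j) \/ ~ alive (nth u j) w.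
Proof.
  intros Hu. pose proof D_full as HDf. pose proof D_alive as HDa.
  destruct (collection (co S1) (fun j y => extendible (nth u j) \/
      exists m', m' < y /\ exists w, w < y /\ (full m' w /\ m <= m' /\ ~ alive (nth u j) w)) K) as [b Hb].
  - apply good_coS1.
  - exact HI.
  - apply (g_or _ good_coS1).
    + apply (S1_subst (fun r => nth u (r O)) (fun t r => ~ extendible t)); [def|]. apply S1_not_extendible.
    + apply D_S1, D_not. def.
  - intros j Hj. destruct (classic (extendible (nth u j))) as [H|H]; [exists 0; now left|].
    apply not_all_ex_not in H. destruct H as [m' H]. apply not_all_ex_not in H. destruct H as [w H].
    apply imply_to_and in H. destruct H as [Hw H]. apply imply_to_and in H. destruct H as [Hl H].
    exists (m' + w + 1). right. exists m'; split; [mlia|]. exists w; split; [mlia|].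
    destruct (full_nth m u j Hu Hj) as [_ E]. rewrite E in Hl. auto.
  - destruct (full_exists (m + b)) as [m' [w [Hm' Hw]]]. exists m', w.
    split; [mlia|split; [exact Hw|]]. intros j Hj.
    destruct (Hb j Hj) as [y [Hy [H|[m1 [Hm1 [w1 [_ [Hw1 [Hmm H]]]]]]]]]; [now left|right].
    intros Hal. apply H. destruct (full_nth m u j Hu Hj) as [H1 H2].
    apply (alive_down (nth u j) m1 w1 m' w); auto; [now rewrite H2|mlia].
Qed.

Definition on_path (t : M) : Prop :=
  t ∈ X /\ exists m u, full m u /\ len t <= m /\ len t0 <= m /\
    forall j, j < K -> prefix t0 (nth u j) -> prefix t (nth u j).

Lemma S1_on_path : S1 (fun r => on_path (r O)).
Proof.
  pose proof D_full. apply S1_and; [apply D_S1; def|].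
  apply (S1_ex (fun m r => exists u, full m u /\ len (r O) <= m /\ len t0 <= m /\
    forall j, j < K -> prefix t0 (nth u j) -> prefix (r O) (nth u j))).
  apply (S1_ex (fun u r => full (r O) u /\ len (r 1%nat) <= r O /\ len t0 <= r O /\
    forall j, j < K -> prefix t0 (nth u j) -> prefix (r 1%nat) (nth u j))), D_S1. def.
Qed.

(** Once the inextendible nodes of [u] are dead, every node of [w] above [t0] passes through an
    extendible node of [u] above [t0]. By [Hsplit] any two of these are comparable, and having the
    same length they coincide. *)
Lemma on_path_unbounded n : exists t, on_path t /\ n <= len t.
Proof.
  destruct (full_exists (n + len t0)) as [m [u [Hm Hu]]].
  destruct (common_death m u Hu) as [m' [w [Hm' [Hw Hd]]]].
  destruct (He0 m' w Hw) as [i [Hi Hp]]; [mlia|].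
  destruct (full_nth m' w i Hw Hi) as [HwX Hwl].
  assert (Hdown : forall i, i < K -> prefix t0 (nth w i) ->
            exists j, j < K /\ prefix t0 (nth u j) /\ prefix (nth u j) (nth w i) /\ extendible (nth u j)).
  { intros i' Hi' Hp'. destruct (full_nth m' w i' Hw Hi') as [HX' Hl'].
    destruct (full_complete m u (nth w i') Hu HX') as [j [Hj Hq]]; [mlia|].
    destruct (full_nth m u j Hu Hj) as [HuX Hul].
    exists j; split; [exact Hj|split; [|split; [exact Hq|]]].
    - apply (prefix_comparable t0 (nth u j) (nth w i')); auto. mlia.
    - destruct (Hd j Hj) as [H|H]; [exact H|]. destruct H. exists i'; auto. }
  destruct (Hdown i Hi Hp) as [j [Hj [Hj1 [Hj2 Hj3]]]].
  destruct (full_nth m u j Hu Hj) as [HuX Hul].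
  exists (nth u j). split; [|mlia]. split; [exact HuX|].
  exists m', w. split; [exact Hw|split; [mlia|split; [mlia|]]].
  intros i' Hi' Hp'. destruct (Hdown i' Hi' Hp') as [j' [Hj' [Hj1' [Hj2' Hj3']]]].
  destruct (full_nth m u j' Hu Hj') as [HuX' Hul'].
  assert (nth u j = nth u j') as ->; [|exact Hj2'].
  destruct (Hsplit (nth u j) (nth u j')) as [H|H]; auto; apply prefix_iff in H; auto; destruct H as [_ H].
  - apply fseq_ext; auto. congruence.
  - symmetry. apply fseq_ext; auto. congruence.
Qed.

(** As [t0] is extendible, some node of a common later full level lies above it; the certificates of
    [t] and of [t'] both place that node above theirs. *)
Lemma on_path_agree t t' i : on_path t -> on_path t' -> i < len t -> i < len t' -> nth t i = nth t' i.
Proof.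
  intros [Ht [m [u [Hu [Hl [Hl0 H]]]]]] [Ht' [m' [u' [Hu' [Hl' [Hl0' H']]]]]] Hi Hi'.
  destruct (full_exists (m + m')) as [M0 [w [HM Hw]]].
  destruct (He0 M0 w Hw) as [k [Hk Hp]]; [mlia|].
  destruct (full_nth M0 w k Hw Hk) as [HwX Hwl].
  assert (G : forall m u t, t ∈ X -> full m u -> m <= M0 -> len t0 <= m ->
    (forall j, j < K -> prefix t0 (nth u j) -> prefix t (nth u j)) -> prefix t (nth w k)).
  { intros m1 u1 t1 Ht1 Hu1 Hm1 Hl1 H1.
    destruct (full_complete m1 u1 (nth w k) Hu1 HwX) as [j [Hj Hq]]; [mlia|].
    destruct (full_nth m1 u1 j Hu1 Hj) as [HuX Hul].
    apply prefix_trans with (nth u1 j); [|exact Hq]. apply H1; [exact Hj|].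
    apply (prefix_comparable t0 (nth u1 j) (nth w k)); auto. mlia. }
  assert (P1 : prefix t (nth w k)) by (apply (G m u); auto; mlia).
  assert (P2 : prefix t' (nth w k)) by (apply (G m' u'); auto; mlia).
  apply prefix_iff in P1, P2; auto. destruct P1 as [_ P1], P2 as [_ P2].
  rewrite P1, P2; auto.
Qed.

(** The graph [G] is Sigma_1, total and single-valued, hence Delta_1: [~ G n x] says that [G n]
    holds of another value. *)
Lemma path_exists : has_path (fun t => t ∈ X).
Proof.
  pose (G := fun n x => exists t, on_path t /\ (n < len t /\ nth t n = x)).
  assert (HGt : forall n, exists x, G n x).
  { intros n. destruct (on_path_unbounded (n + 1)) as [t [Ht Hn]].
    exists (nth t n), t. split; [exact Ht|split; [mlia|reflexivity]]. }
  assert (HGf : forall n x y, G n x -> G n y -> x = y).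
  { intros n x y [t [Ht [Hn <-]]] [t' [Ht' [Hn' <-]]]. now apply on_path_agree. }
  assert (HGS : S1 (fun r => G (r O) (r 1%nat))).
  { apply (S1_ex (fun t r => on_path t /\ (r O < len t /\ nth t (r O) = r 1%nat))).
    apply S1_and; [|apply D_S1; def].
    apply (g_comp _ good_S1 (fun r => on_path (r O)) (fun r _ => r O) S1_on_path). intros; tm. }
  assert (HGD : D (fun r => G (r O) (r 1%nat))).
  { split; [exact HGS|].
    apply SB_ext with (fun r => exists y, y <> r 1%nat /\ G (r O) y).
    - apply (S1_ex (fun y r => y <> r 1%nat /\ G (r O) y)), S1_and; [apply D_S1; def|].
      apply (g_comp _ good_S1 _ (fun r i => match i with O => r 1%nat | _ => r O end) HGS).
      intros [|i]; tm.
    - intros r; split.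
      + intros [y [Hy HGy]] H. apply Hy. exact (HGf _ _ _ HGy H).
      + intros H. destruct (HGt (r O)) as [y Hy]. exists y; split; [|exact Hy]. intros ->. auto. }
  destruct (comprehension_function (fun n => mu (fun x => G n x))) as [g [Hg HgG]].
  { apply (Df_mu_total (fun x r => G (r O) x)); [def|]. intros r; apply HGt. }
  assert (Hmu : forall n, G n (mu (fun x => G n x))).
  { intros n. destruct (HGt n) as [x Hx]. apply (mu_spec (fun x => G n x) x); [def|exact Hx]. }
  exists g; split; [exact Hg|]. intros n.
  destruct (on_path_unbounded n) as [t [Ht Hn]]. pose proof Ht as [HtX _].
  destruct (take_spec n t) as [T1 [T2 T3]].
  exists (take n t). split; [exact T1|split; [|split; [|now apply take_X]]].
  - rewrite <- T2 at 2. now apply fseq_has_len.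
  - intros i j Hij. apply elt_cpair_nth in Hij; [|exact T1]. destruct Hij as [Hi ->].
    rewrite T2 in Hi. apply HgG. rewrite T3 by exact Hi.
    apply (HGf i); [|apply Hmu]. exists t. split; [exact Ht|split; [mlia|reflexivity]].
Qed.
End Path.
End Full.
End Tree.

Theorem ISigma2_KL : @ISigma2_in A -> @KL_wbd_in A.
Proof.
  intros HI X Htree Hinf [c Hc]. apply ISigma2_inductive in HI.
  destruct (limit_width HI X Htree Hinf c Hc) as [K [n0 [HK1 [HK Hn0]]]].
  destruct (unsplit_node HI X Htree Hinf c Hc K n0 HK1 HK) as [t0 [Ht0 [He0 Hsplit]]].
  eapply path_exists; eassumption.
Qed.
End Konig.

(** * The equivalences *)

Section Translation.
Context {A : structure} {HA : RCA A}.
Local Notation M := (dom A).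
Local Open Scope num_scope.
Add Ring num_ring : (@num_semi_ring A HA).

Lemma sat_induction p e E :
  sat A e E (induction p) <->
  (sat A (scons 0 e) E p /\ (forall x, sat A (scons x e) E p -> sat A (scons (x + 1) e) E p) ->
   forall x, sat A (scons x e) E p).
Proof.
  assert (H0 : sat A e E (inst tzero p) <-> sat A (scons 0 e) E p).
  { unfold inst; rewrite sat_subst. replace (fun i => _) with (scons 0 e); [tauto|].
    extensionality i; destruct i; reflexivity. }
  assert (HS : forall x, sat A (scons x e) E (subst (scons (tadd (tvar 0) tone) (fun i => tvar (S i)))
                 (fun X => X) p) <-> sat A (scons (x + 1) e) E p).
  { intros x; rewrite sat_subst. replace (fun i => _) with (scons (x + 1) e); [tauto|].
    extensionality i; destruct i; reflexivity. }
  unfold induction; cbn [sat]. rewrite H0.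
  split; intros H [H1 H2]; apply H; split; auto; intros x Hx; apply HS; auto.
Qed.

(** The scheme speaks of bounded matrices, [ISigma2_in] of Delta_1 ones. With [R] the matrix of the
    Sigma_1 form of [~ q], the statement [forall y, q k x y] has two universal quantifiers in front
    of [~ R]; in [Q] one variable bounds both. *)
Lemma ISigma2_sat :
  (forall s, ISigma2 s -> forall e E, sat A e E s) -> @ISigma2_in A.
Proof.
  intros HI q [_ [R [HR HqR]]] H0 HS.
  pose (Q := fun r : nat -> M => forall y, y < r O -> forall z, z < r O ->
    ~ R (scons z (scons (r 2%nat) (scons (r 1%nat) (scons y (fun _ => 0)))))).
  assert (HQ : D0 Q).
  { apply (D0_ball (fun r => r O) (fun y r => forall z, z < r O ->
      ~ R (scons z (scons (r 2%nat) (scons (r 1%nat) (scons y (fun _ => 0)))))));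
      [tm|].
    apply (D0_ball (fun r => r 1%nat) (fun z r =>
      ~ R (scons z (scons (r 3%nat) (scons (r 2%nat) (scons (r O) (fun _ => 0)))))));
      [tm|].
    apply D0_not, (D0_comp R HR (fun r =>
      scons (r O) (scons (r 4%nat) (scons (r 3%nat) (scons (r 1%nat) (fun _ => 0)))))).
    intros [|[|[|[|i]]]]; simpl; tm. }
  assert (Hq : forall k x, (forall w, Q (scons w (scons x (scons k (fun _ => 0))))) <-> forall y, q k x y).
  { intros k x. assert (HR' : forall y, ~ q k x y <-> exists z, R (scons z (scons k (scons x (scons y (fun _ => 0)))))).
    { intros y. exact (HqR (scons k (scons x (scons y (fun _ => 0))))). }
    split.
    - intros H y. apply NNPP; intros Hn. apply HR' in Hn. destruct Hn as [z Hz].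
      apply (H (y + z + 1) y) with z; cbn [scons]; [mlia|mlia|exact Hz].
    - intros H w y _ z _ Hz. assert (Hn : ~ q k x y) by (apply HR'; exists z; exact Hz). auto. }
  destruct (D0_form Q HQ) as [N [L [LS H]]].
  destruct rca_set as [X0].
  set (a := fun k => List.nth k L 0) in *. set (E := fun k => List.nth k LS X0) in *.
  destruct (H (S (S (S N))) a E) as [p [Hp Hs]];
    [lia|intros; now apply nth_covers|intros; now apply nth_covers|].
  assert (HP : forall k, sat A (scons k (app N (fun _ => 0) a)) E (Defs.ex (Defs.all p)) <-> exists x, forall y, q k x y).
  { intros k; cbn [sat]. split; intros [x Hx]; exists x.
    - apply Hq. intros w. apply Hs. rewrite !app_scons. apply Hx.
    - intros w. rewrite <- !app_scons. apply Hs. now apply Hq. }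
  assert (Hind : sat A (app N (fun _ => 0) a) E (induction (Defs.ex (Defs.all p)))).
  { apply sat_closure. apply HI. exists (Defs.ex (Defs.all p)). split; [exists p; auto|reflexivity]. }
  rewrite sat_induction in Hind. intros k. apply HP, Hind. split.
  - now apply HP.
  - intros x Hx. apply HP, HS, HP, Hx.
Qed.

Lemma sat_ISigma2 :
  @ISigma2_in A -> forall s, ISigma2 s -> forall e E, sat A e E s.
Proof.
  intros HI s [p [[q [Hq ->]] ->]]. apply sat_closure. intros e E.
  apply sat_induction. intros [H0 HS].
  apply (HI (fun k x y => sat A (scons y (scons x (scons k e))) E q)); auto.
  apply D_D0, (D0_sat q Hq E (fun r => scons (r 2%nat) (scons (r 1%nat) (scons (r O) e)))).
  intros [|[|[|i]]]; simpl; tm.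
Qed.
End Translation.

Lemma RCA0_closed s : RCA0 s -> closed s.
Proof.
  intros [H|[[p [_ ->]]|[p [q [_ [_ ->]]]]]]; [|apply closed_closure|apply closed_closure].
  simpl in H. repeat destruct H as [<-|H]; try (split; reflexivity). destruct H.
Qed.

Definition models (A : structure) (T : theory) : Prop :=
  forall s, T s -> forall e E, sat A e E s.

Lemma proves_over_RCA0 (T U : theory) :
  (forall s, T s -> closed s) -> (forall A, RCA A -> models A T -> models A U) ->
  forall p, U p -> proves (union RCA0 T) p.
Proof.
  intros HT H p Hp. apply completeness.
  - intros q [Hq|Hq]; [now apply RCA0_closed|now apply HT].
  - intros A HA e E. apply (H A); [|intros s Hs; apply HA; now right|exact Hp].
    (* The set environment at hand shows that the model has a set. *)
    constructor; [intros q Hq; apply HA; now left|exact (inhabits (E 0))].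
Qed.

Lemma ISigma2_closed s : ISigma2 s -> closed s.
Proof. intros [p [_ ->]]; apply closed_closure. Qed.

Lemma Sigma1_WKL_wbd_closed s : Sigma1_WKL_wbd s -> closed s.
Proof. intros ->; split; reflexivity. Qed.

Lemma KL_wbd_closed s : KL_wbd s -> closed s.
Proof. intros ->; split; reflexivity. Qed.

Lemma models_ISigma2 A : RCA A -> models A ISigma2 <-> @ISigma2_in A.
Proof. intros HA; split; [exact ISigma2_sat|exact sat_ISigma2]. Qed.

Lemma models_Sigma1_WKL A : RCA A -> models A Sigma1_WKL_wbd <-> @Sigma1_WKL_wbd_in A.
Proof.
  intros HA; destruct (@rca_set A HA) as [X]; split.
  - intros H. exact (H _ eq_refl (fun _ => izero) (fun _ => X)).
  - intros H s -> e E. exact H.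
Qed.

Lemma models_KL A : RCA A -> models A KL_wbd <-> @KL_wbd_in A.
Proof.
  intros HA; destruct (@rca_set A HA) as [X]; split.
  - intros H. exact (H _ eq_refl (fun _ => izero) (fun _ => X)).
  - intros H s -> e E. exact H.
Qed.

Theorem theorem2p3 :
  equivalent_over RCA0 ISigma2 Sigma1_WKL_wbd /\
  equivalent_over RCA0 Sigma1_WKL_wbd KL_wbd /\
  equivalent_over RCA0 ISigma2 KL_wbd.
Proof.
  assert (H1 : forall A, RCA A -> models A ISigma2 -> models A KL_wbd).
  { intros A HA H. exact (proj2 (models_KL A HA) (ISigma2_KL (proj1 (models_ISigma2 A HA) H))). }
  assert (H2 : forall A, RCA A -> models A KL_wbd -> models A Sigma1_WKL_wbd).
  { intros A HA H. exact (proj2 (models_Sigma1_WKL A HA) (KL_Sigma1_WKL (proj1 (models_KL A HA) H))). }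
  assert (H3 : forall A, RCA A -> models A Sigma1_WKL_wbd -> models A ISigma2).
  { intros A HA H. exact (proj2 (models_ISigma2 A HA) (Sigma1_WKL_ISigma2 (proj1 (models_Sigma1_WKL A HA) H))). }
  pose proof ISigma2_closed. pose proof Sigma1_WKL_wbd_closed. pose proof KL_wbd_closed.
  (* The three implications form a cycle, and the other directions are obtained by composition. *)
  repeat split; apply proves_over_RCA0; eauto.
Qed.
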